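(* Let $\mathfrak A$ be a commutative, separated, sequentially complete strong polymetric ring with $1\in\mathfrak A$, and let $G=\mathfrak A[z^{-1},z]^\star$ be the unit group of the algebra of Laurent series over $\mathfrak A$ with rapidly decreasing coefficients. Let $G^-$, $\tilde G$, $G^+$ be the subgroups of $G$ consisting of the strictly antiholomorphic, the orthogonal, and the strictly holomorphic Laurent series, respectively. Then there is an inner direct product decomposition \[G=G^-\times\tilde G\times G^+ ,\] and the projections $\boldsymbol\pi^-:G\to G^-$, $\tilde{\boldsymbol\pi}:G\to\tilde G$, $\boldsymbol\pi^+:G\to G^+$ to the factors are given by the following explicit expressions: for $a(z)\in G$, the elements $\boldsymbol\pi^-(a)$, $\tilde{\boldsymbol\pi}(a)$, $\boldsymbol\pi^+(a)$ are obtained by replacing $w$ by $z$ in \[\pi^-(a(z),1,w)=\det\bigl(\mathsf U^-(a(z),1,w)\,\mathsf U(a(z))^{-1}\bigr),\] \[\tilde\pi(a(z),w)=\det\bigl(\mathsf U(a(z))\,\widetilde{\mathsf U}(a(z),w)^{-1}\bigr),\] \[\pi^+(a(z),1,w)=\det\bigl(\mathsf U^+(a(z),1,w)\,\mathsf U(a(z))^{-1}\bigr),\] respectively.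
   Context: **Rings and Laurent series.** A topological ring $\mathfrak A$ is a strong polymetric ring if (a) its topology is induced by a family of ''seminorms'' $p:\mathfrak A\to[0,+\infty)$ with $p(0)=0$, $p(-X)=p(X)$, $p(X+Y)\le p(X)+p(Y)$; and (b) for each seminorm $p$ there is a seminorm $\tilde p$ such that for all $n\in\mathbb N$ and all $X_1,\dots,X_n\in\mathfrak A$, $p(X_1\cdots X_n)\le\tilde p(X_1)\cdots\tilde p(X_n)$. A family of elements of $\mathfrak A$ indexed by $\mathbb Z$ (or by pairs of indices) is rapidly decreasing if for every seminorm $p$ the family of values of $p$ stays bounded when multiplied by any function of polynomial growth of the index. $\mathfrak A[z^{-1},z]$ is the algebra of Laurent series $\sum_{n\in\mathbb Z}a_nz^n$ with rapidly decreasing coefficients, with its usual topology; $\mathfrak A[w^{-1},w]$ is the same in the variable $w$. $G$ carries the topology induced from $\mathfrak A[z^{-1},z]$ via the identity inclusion and the multiplicative inverse jointly. **Subgroups.** $a(z)=\sum a_nz^n\in G$ with inverse $a(z)^{-1}=\sum b_nz^n$ is strictly holomorphic if $a_0=b_0=1$ and $a_n=b_n=0$ for all $n<0$; it is strictly antiholomorphic if $a_0=b_0=1$ and $a_n=b_n=0$ for all $n>0$; it is orthogonal if $a_na_m=0$ for all $n\ne m$. **Matrices.** $\mathbf e_{n,m}$ denotes the elementary matrix. Matrices are $\mathbb Z\times\mathbb Z$, with $\mathbf 1_S=\sum_{s\in S}\mathbf e_{s,s}$ for $S\subset\mathbb Z$, $\mathbb Z^+=\{s\in\mathbb Z: s>0\}$,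 $\mathbb Z^-=\{s\in\mathbb Z:s<0\}$. The multiplication representation is $\mathsf U(a(z))=\sum_{n,m\in\mathbb Z}a_{n-m}\mathbf e_{n,m}$. Here $w$ is a formal Laurent series variable (coefficients rapidly decreasing) and $t$ a formal power series variable. Put \[\mathsf F^{R+}(t,w)=\mathbf 1_{\mathbb Z}-tw\,\mathbf 1_{\mathbb Z^-}\mathsf U(z^{-1}),\qquad \mathsf F^{R-}(t,w)=\mathbf 1_{\mathbb Z}-tw^{-1}\,\mathbf 1_{\mathbb Z^+}\mathsf U(z),\] \[\mathsf U^{\pm}(a(z),t,w)=\mathsf F^{R\pm}(t,w)\,\mathsf U(a(z))\,\mathsf F^{R\pm}(t,w)^{-1}\] (upper signs together, lower signs together; inverses as power series in $t$). The entries of $\mathsf U^{\pm}(z^n,t,w)$ are polynomials in $t,w,w^{-1}$, and one may substitute $t=1$ in $\mathsf U^{\pm}(a(z),t,w)=\sum_na_n\mathsf U^\pm(z^n,t,w)$; the result is $\mathsf U^{\pm}(a(z),1,w)$, a rapidly decreasing perturbation of $\mathsf U(a(z))$. The matrix $\widetilde{\mathsf U}(a(z),w)$ has $(n,m)$ entry - $a_{n-m}$ if $n,m>0$ or $n,m<0$; - $-w\,a_{n-m+1}$ if $n<0<m$; - $-w^{-1}a_{n-m-1}$ if $m<0<n$; - $1$ if $n=m=0$, and $0$ if exactly one of $n,m$ is $0$. It is also a rapidly decreasing perturbation of $\mathsf U(a(z))$. A rapidly decreasing perturbation of a matrix is that matrix plus a rapidly decreasing matrix. Inverses are taken among Toeplitz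 matrices over $\mathfrak A[w^{-1},w]$, i.e. matrices $\mathbf 1_{\mathbb Z^-}\mathsf U(a_{\mathrm n}(z))\mathbf 1_{\mathbb Z^-}+\mathbf 1_{\mathbb Z^+}\mathsf U(a_{\mathrm p}(z))\mathbf 1_{\mathbb Z^+}+A$ with $a_{\mathrm n},a_{\mathrm p}$ rapidly decreasing Laurent series and $A$ a rapidly decreasing matrix. **Determinant.** If $A$ is a rapidly decreasing $S\times S$ matrix, $\det(\mathbf 1_S+A)$ is the (convergent) alternating sum, over finite permutations $\sigma$ of $S$, of the products $\prod_{s\in S}(\mathbf 1_S+A)_{s,\sigma(s)}$. *)

(* Defs.v *)
From HB Require Import structures.
From mathcomp Require Import all_boot all_order all_algebra all_fingroup finmap.
From mathcomp Require Import all_classical reals topology.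
From mathcomp Require Import showcase.summability.
From mathcomp Require Import ring lra zify.

Set Implicit Arguments.
Unset Strict Implicit.
Unset Printing Implicit Defensive.

Import Order.TTheory GRing.Theory Num.Theory.

Local Open Scope classical_set_scope.
Local Open Scope ring_scope.

#[global] Existing Instance totally_filter.

Definition sn_entourage (R : realType) (I : Type) (A : zmodType)
    (p : I -> A -> R) : set_system (A * A) :=
  filter_from [set se : seq I * R | 0 < se.2]
    (fun se => [set xy | all (fun i => p i (xy.1 - xy.2) < se.2) se.1]).

(* The seminorm family is part of the data: rapid decrease depends on it, not
   only on the topology. The uniformity inducing the topology is the
   translation-invariant one. *)
HB.mixin Record isPolymetric (R : realType) A
    & GRing.ComPzRing A & Uniform A := {
  sn_index : Type;
  sn : sn_index -> A -> R;
  sn_ge0 : forall i x, 0 <= sn i x;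
  sn0 : forall i, sn i 0 = 0;
  snN : forall i x, sn i (- x) = sn i x;
  ler_snD : forall i x y, sn i (x + y) <= sn i x + sn i y;
  entourage_snE : entourage = sn_entourage sn
}.

#[short(type="polymetricRingType")]
HB.structure Definition PolymetricRing (R : realType) :=
  {A of GRing.ComPzRing A & Uniform A & isPolymetric R A}.

Arguments sn_index {R} s.

HB.factory Record ComPzRing_isPolymetric (R : realType) A
    & GRing.ComPzRing A := {
  sn_index : Type;
  sn : sn_index -> A -> R;
  sn_ge0 : forall i x, 0 <= sn i x;
  sn0 : forall i, sn i 0 = 0;
  snN : forall i x, sn i (- x) = sn i x;
  ler_snD : forall i x y, sn i (x + y) <= sn i x + sn i y
}.

HB.builders Context R A & ComPzRing_isPolymetric R A.

Let ent := sn_entourage sn.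

Let ent_filter : Filter ent.
Proof.
apply: filter_from_filter; first by exists ([::], 1) => /=.
move=> [s e] [s' e'] /= e0 e'0.
exists (s ++ s', Num.min e e') => /=; first by rewrite lt_min e0.
move=> [x y] /=; rewrite all_cat => /andP[xs xs']; split => /=.
  by apply: sub_all xs => i /lt_le_trans; apply; rewrite ge_min lexx.
by apply: sub_all xs' => i /lt_le_trans; apply; rewrite ge_min lexx orbT.
Qed.

Let ent_diagonal E : ent E -> diagonal `<=` E.
Proof.
move=> [[s e] /= e0 sE] [x y] /diagonalP ->; apply: sE => /=.
by elim: s => //= i s ->; rewrite subrr sn0 e0.
Qed.

Let ent_inv E : ent E -> ent E^-1%relation.
Proof.
move=> [[s e] /= e0 sE]; exists (s, e) => //= -[x y] /= xy.
apply: sE => /=; apply: sub_all xy => i; by rewrite -snN opprB.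
Qed.

Let ent_split E : ent E -> exists2 E', ent E' & (E' \; E')%relation `<=` E.
Proof.
move=> [[s e] /= e0 sE].
exists [set xy | all (fun i => sn i (xy.1 - xy.2) < e / 2) s].
  by exists (s, e / 2) => //=; rewrite divr_gt0.
move=> [x y] [z /= xz zy]; apply: sE => /=.
elim: s xz zy => //= i s IH /andP[xz {}/IH xzs] /andP[zy {}/xzs ->].
rewrite andbT -[x - y](subrKA z) [e]splitr.
by apply: le_lt_trans (ler_snD _ _ _) _; rewrite ltrD.
Qed.

HB.instance Definition _ :=
  isUniform.Build A ent_filter ent_diagonal ent_inv ent_split.

HB.instance Definition _ :=
  isPolymetric.Build R A sn_ge0 sn0 snN ler_snD erefl.

HB.end.

(* Products of at least one factor: no bound on sn i 1 is imposed. *)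
HB.mixin Record Polymetric_isStrong (R : realType) A
    & PolymetricRing R A := {
  sn_strong : forall i : sn_index A, exists j : sn_index A,
    forall n (X : 'I_n.+1 -> A),
      sn i (\prod_k X k) <= \prod_k sn j (X k)
}.

#[short(type="strongPolymetricRingType")]
HB.structure Definition StrongPolymetricRing (R : realType) :=
  {A of PolymetricRing R A & Polymetric_isStrong R A}.

HB.mixin Record isSeparatedSeqComplete A & Uniform A := {
  separated : hausdorff_space A;
  seq_complete : forall u : nat -> A,
    cauchy (u @ \oo) -> exists l : A, u @ \oo --> l
}.

(* csp: complete (sequentially) and separated, strong polymetric. *)
#[short(type="cspRingType")]
HB.structure Definition CspRing (R : realType) :=
  {A of StrongPolymetricRing R A & isSeparatedSeqComplete A}.

(* Limits along the net of finite subsets; the values of lsum and lprod are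
   0 and 1 when there is no limit. *)

Definition sums_to (R : realType) (B : polymetricRingType R) (T : choiceType)
    (f : T -> B) (s : B) : Prop :=
  (fun J : {fset T} => \sum_(t <- J) f t) @ totally --> s.

Definition lsum (R : realType) (B : polymetricRingType R) (T : choiceType)
    (f : T -> B) : B := xget 0 (sums_to f).

Definition prods_to (R : realType) (B : polymetricRingType R) (T : choiceType)
    (f : T -> B) (s : B) : Prop :=
  (fun J : {fset T} => \prod_(t <- J) f t) @ totally --> s.

Definition lprod (R : realType) (B : polymetricRingType R) (T : choiceType)
    (f : T -> B) : B := xget 1 (prods_to f).

Section PolymetricTheory.
Variables (R : realType) (B : polymetricRingType R).
Implicit Types (T : choiceType) (i : sn_index B).

Lemma sn_distC i (x y : B) : sn i (x - y) = sn i (y - x).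
Proof. by rewrite -snN opprB. Qed.

Lemma ler_snB i (x y : B) : sn i (x - y) <= sn i x + sn i y.
Proof. by rewrite -(snN i y) ler_snD. Qed.

Lemma ler_sn_sum i (T : Type) (r : seq T) (f : T -> B) :
  sn i (\sum_(t <- r) f t) <= \sum_(t <- r) sn i (f t).
Proof.
elim: r => [|t r IH]; first by rewrite !big_nil sn0.
by rewrite !big_cons (le_trans (ler_snD _ _ _))// lerD2l.
Qed.

Lemma entourage_sn i (e : R) :
  0 < e -> entourage [set xy : B * B | sn i (xy.1 - xy.2) < e].
Proof.
move=> e0; rewrite entourage_snE; exists ([:: i], e) => //= -[x y] /=.
by rewrite andbT.
Qed.

Lemma cvg_snP (F : set_system B) (x : B) : Filter F ->
  F --> x <-> forall i (e : R), 0 < e -> \forall y \near F, sn i (x - y) < e.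
Proof.
move=> FF; rewrite cvg_entourageP; split=> [Fx i e e0|Fx E].
  exact: Fx (entourage_sn i e0).
rewrite {1}entourage_snE => -[[s e] /= e0 sE].
suff : \forall y \near F, all (fun i => sn i (x - y) < e) s.
  by apply: filterS => y xy; exact: sE.
elim: s {sE} => [|i s IH] /=; first by apply: filterE.
by move: (Fx i e e0) IH; apply: filterS2 => y /= -> ->.
Qed.

Lemma totallyP T (P : {fset T} -> Prop) :
  (\forall J \near totally, P J) <->
  exists J0, forall J : {fset T}, (J0 `<=` J)%fset -> P J.
Proof. by split=> [[J0 _ JP]|[J0 JP]]; exists J0. Qed.

Lemma sums_toP T (f : T -> B) s :
  sums_to f s <-> forall i (e : R), 0 < e ->
    exists J0, forall J : {fset T}, (J0 `<=` J)%fset ->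
      sn i (s - \sum_(t <- J) f t) < e.
Proof.
rewrite /sums_to cvg_snP; split=> H i e e0.
  by have /totallyP := H i e e0.
by apply/totallyP; exact: H.
Qed.

Lemma eq_sums_to T (f g : T -> B) s : f =1 g -> sums_to f s -> sums_to g s.
Proof. by move=> /funext ->. Qed.

Lemma sums_to_delta T (f : T -> B) t0 :
  (forall t, t != t0 -> f t = 0) -> sums_to f (f t0).
Proof.
move=> f0; apply/sums_toP => i e e0; exists [fset t0]%fset => J.
rewrite fsub1set => tJ; rewrite (big_fsetD1 t0)//= big_seq big1 ?addr0 ?subrr ?sn0//.
by move=> t; rewrite !inE => /andP[/f0 ->].
Qed.

Lemma sums_toD T (f g : T -> B) s t :
  sums_to f s -> sums_to g t -> sums_to (fun x => f x + g x) (s + t).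
Proof.
move=> /sums_toP fs /sums_toP gt; apply/sums_toP => i e e0.
have e20 : 0 < e / 2 by rewrite divr_gt0.
have [J1 J1P] := fs i _ e20; have [J2 J2P] := gt i _ e20.
exists (J1 `|` J2)%fset => J; rewrite fsubUset => /andP[/J1P h1 /J2P h2].
rewrite big_split /= opprD addrACA [e]splitr.
by apply: le_lt_trans (ler_snD _ _ _) _; rewrite ltrD.
Qed.

Lemma sums_to_bij (T T' : choiceType) (h : T -> T') (f : T' -> B) s :
  bijective h -> sums_to f s -> sums_to (f \o h) s.
Proof.
move=> [k hk kh] /sums_toP fs; apply/sums_toP => i e e0.
have [J0 J0P] := fs i e e0; exists (k @` J0)%fset => J J0J.
have := J0P (h @` J)%fset; rewrite big_imfset /=; last first.
  by move=> x y _ _ /(can_inj hk).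
apply; apply/fsubsetP => x xJ0; apply/imfsetP; exists (k x); last by rewrite kh.
by apply: (fsubsetP J0J); apply/imfsetP; exists x.
Qed.

Lemma sums_to_fubini (T1 T2 : choiceType) (f : T1 * T2 -> B) (g : T1 -> B) s :
  sums_to f s -> (forall k, sums_to (fun l => f (k, l)) (g k)) -> sums_to g s.
Proof.
move=> /sums_toP fs fg; apply/sums_toP => i e e0.
have e20 : 0 < e / 2 by rewrite divr_gt0.
have [J0 J0P] := fs i _ e20.
exists (fst @` J0)%fset => K J0K.
pose d := e / 2 / (#|` K|.+1)%:R.
have d0 : 0 < d by rewrite divr_gt0.
have /choice[L LP] : forall k, exists L : {fset T2},
    (snd @` J0 `<=` L)%fset /\ sn i (g k - \sum_(l <- L) f (k, l)) < d.
  move=> k; have /sums_toP/(_ i d d0)[L0 L0P] := fg k.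
  exists (snd @` J0 `|` L0)%fset; rewrite fsubsetUl; split => //.
  by apply: L0P; rewrite fsubsetUr.
pose J := [fset ((k, l) : T1 * T2) | k in K, l in L k]%fset.
have J0J : (J0 `<=` J)%fset.
  apply/fsubsetP => -[k l] klJ0; apply/imfset2P; exists k.
    by apply: (fsubsetP J0K); apply/imfsetP; exists (k, l).
  exists l => //; apply: (fsubsetP (LP k).1).
  by apply/imfsetP; exists (k, l).
have -> : \sum_(k <- K) g k = \sum_(t <- J) f t
    + \sum_(k <- K) (g k - \sum_(l <- L k) f (k, l)).
  have -> : \sum_(t <- J) f t = \sum_(k <- K) \sum_(l <- L k) f (k, l).
    rewrite big_imfset2 /=; last first.
      by move=> [k1 l1] [k2 l2] _ _ /= [-> ->].
    by [].
  by rewrite -big_split /=; apply: eq_bigr => k _; rewrite addrC subrK.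
rewrite opprD addrA [e]splitr.
apply: le_lt_trans (ler_snB _ _ _) _; apply: ltrD; first exact: J0P.
apply: le_lt_trans (ler_sn_sum _ _ _) _.
apply: (@le_lt_trans _ _ (\sum_(k <- K) d)).
  by apply: ler_sum => k _; exact/ltW/(LP k).2.
rewrite big_const_seq count_predT iter_addr_0 -[ltLHS]mulr_natr /d.
rewrite -mulrA gtr_pMr// mulrC ltr_pdivrMr// mul1r ltr_nat.
by rewrite ltnS cardfE.
Qed.

End PolymetricTheory.

Section CspTheory.
Variables (R : realType) (A : cspRingType R).
Implicit Types (T : choiceType) (i : sn_index A).

Lemma sn_mul i : exists j, forall x y : A, sn i (x * y) <= sn j x * sn j y.
Proof.
have [j jP] := sn_strong i; exists j => x y.
have := jP 1%N (fun k => if k == 0 then x else y).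
by rewrite !big_ord_recl !big_ord0 /= !mulr1.
Qed.

Lemma sn_eq0 (x : A) : (forall i, sn i x = 0) -> x = 0.
Proof.
move=> x0; apply: (@separated _ A) => P Q xP Q0; exists 0.
split; last exact: nbhs_singleton.
move: xP; rewrite -nbhs_entourageE => -[E + EP].
rewrite entourage_snE => -[[s e] /= e0 sE]; apply: EP; apply/xsectionP.
by apply: sE => /=; elim: s => //= i s ->; rewrite subr0 x0 e0.
Qed.

Lemma sn_eq (x y : A) : (forall i (e : R), 0 < e -> sn i (x - y) < e) -> x = y.
Proof.
move=> xy; apply/eqP; rewrite -subr_eq0; apply/eqP/sn_eq0 => i.
apply/eqP; rewrite eq_le sn_ge0 andbT; apply/ler_addgt0Pl => e e0.
by rewrite addr0 ltW// xy.
Qed.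

Lemma sums_to_unique T (f : T -> A) s t :
  sums_to f s -> sums_to f t -> s = t.
Proof.
move=> /sums_toP fs /sums_toP ft; apply: sn_eq => i e e0.
have e20 : 0 < e / 2 by rewrite divr_gt0.
have [J1 J1P] := fs i _ e20; have [J2 J2P] := ft i _ e20.
have := J1P _ (fsubsetUl J1 J2); have := J2P _ (fsubsetUr J1 J2).
set S := \sum_(_ <- _) _ => h2 h1.
rewrite -(subrKA S) [e]splitr; apply: le_lt_trans (ler_snD _ _ _) _.
by apply: ltrD => //; rewrite sn_distC.
Qed.

Lemma lsumE T (f : T -> A) s : sums_to f s -> lsum f = s.
Proof.
move=> fs; rewrite /lsum; case: xgetP => [t _ ft|/(_ s)//].
exact: sums_to_unique ft fs.
Qed.

Lemma sums_toM T (f : T -> A) s c :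
  sums_to f s -> sums_to (fun t => c * f t) (c * s).
Proof.
move=> /sums_toP fs; apply/sums_toP => i e e0.
have [j jP] := sn_mul i.
have c0 : 0 < sn j c + 1 by rewrite ltr_wpDl ?sn_ge0.
have [J0 J0P] := fs j (e / (sn j c + 1)) (divr_gt0 e0 c0).
exists J0 => J /J0P h; rewrite -mulr_sumr -mulrBr.
apply: le_lt_trans (jP _ _) _.
apply: (@le_lt_trans _ _ ((sn j c + 1) * sn j (s - \sum_(t <- J) f t))).
  by rewrite ler_wpM2r ?sn_ge0// lerDl.
by rewrite mulrC -ltr_pdivlMr.
Qed.

Definition abs_summable T (f : T -> A) :=
  forall i, exists C, forall J : {fset T}, \sum_(t <- J) sn i (f t) <= C.

Lemma abs_summable_tail T (f : T -> A) i (e : R) :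
  abs_summable f -> 0 < e -> exists J0, forall J : {fset T},
    [disjoint J0 & J]%fset -> \sum_(t <- J) sn i (f t) < e.
Proof.
move=> /(_ i)[C fC] e0.
pose S := range (fun J : {fset T} => \sum_(t <- J) sn i (f t)).
have supS : has_sup S.
  split; first by exists (\sum_(t <- fset0) sn i (f t)), fset0.
  by exists C => _ [J _ <-].
have [_ [J0 _ <-] J0S] := sup_adherent e0 supS.
exists J0 => J dJ; rewrite -(ltrD2l (\sum_(t <- J0) sn i (f t))).
have -> : \sum_(t <- J0) sn i (f t) + \sum_(t <- J) sn i (f t) =
    \sum_(t <- (J0 `|` J)%fset) sn i (f t).
  rewrite [RHS](big_fsetID _ (mem J0)) /=; congr (_ + _).
    by apply: eq_fbigl => x; rewrite !inE; do 2!case: (_ \in _).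
  apply: eq_fbigl => x; rewrite !inE.
  by case: (boolP (x \in J0)) => [/(fdisjointP dJ)/negbTE ->|_] //=; rewrite andbT.
rewrite -ltrBlDr; apply: le_lt_trans J0S.
by rewrite lerD2r; apply: ub_le_sup; [exact: supS.2|exists (J0 `|` J)%fset].
Qed.

Lemma abs_summable_cvg (T : countType) (f : T -> A) :
  abs_summable f -> exists s, sums_to f s.
Proof.
move=> fS; pose E n := [fset t in pmap (@pickle_inv T) (iota 0 n) : seq T]%fset.
pose u n := \sum_(t <- E n) f t.
have EP n t : (t \in E n) = (@choice.pickle T t < n)%N.
  rewrite !inE mem_pmap; apply/mapP/idP => [[m]|tn].
    rewrite mem_iota /= add0n => mn tm.
    by have := @pickle_invK T m; rewrite -tm /= => ->.
  by exists (choice.pickle t); rewrite ?mem_iota ?pickleK_inv.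
have EJ (J : {fset T}) : exists N, forall n, (N <= n)%N -> (J `<=` E n)%fset.
  exists (\max_(t <- J) (@choice.pickle T t).+1)%N => n Nn; apply/fsubsetP => t tJ.
  rewrite EP; apply: leq_trans Nn.
  by rewrite (big_fsetD1 t)//= leq_maxl.
have key i e J0 : (forall J, [disjoint J0 & J]%fset ->
      \sum_(t <- J) sn i (f t) < e) ->
    forall J J' : {fset T}, (J0 `<=` J)%fset -> (J0 `<=` J')%fset ->
      sn i (\sum_(t <- J) f t - \sum_(t <- J') f t) < e + e.
  move=> J0P J J' J0J J0J'.
  rewrite (big_fsetID _ (mem J')) /= [X in _ - X](big_fsetID _ (mem J)) /=.
  have -> : [fset x in J | x \in J']%fset = [fset x in J' | x \in J]%fset.
    by apply/fsetP => x; rewrite !inE andbC.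
  rewrite opprD addrACA subrr add0r; apply: le_lt_trans (ler_snB _ _ _) _.
  apply: ltrD; apply: le_lt_trans (ler_sn_sum _ _ _) (J0P _ _).
    apply/fdisjointP => x /(fsubsetP J0J') xJ'.
    by rewrite !inE xJ' andbF.
  apply/fdisjointP => x /(fsubsetP J0J) xJ.
  by rewrite !inE xJ andbF.
have [l ul] : exists l : A, u @ \oo --> l.
  apply: seq_complete => P; rewrite entourage_snE => -[[s e] /= e0 sP].
  have [N NP] : exists N, forall m n, (N <= m)%N -> (N <= n)%N ->
      all (fun i => sn i (u m - u n) < e) s.
    elim: s {sP} => [|i s [N NP]]; first by exists 0%N.
    have [J0 J0P] := abs_summable_tail i fS (divr_gt0 e0 (ltr0Sn R 1)).
    have [M MP] := EJ J0.
    exists (maxn N M) => m n; rewrite !geq_max => /andP[Nm Mm] /andP[Nn Mn] /=.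
    by rewrite NP// andbT [e]splitr; apply: key J0P _ _ _ _; exact: MP.
  pose Q := [set x | exists2 m, (N <= m)%N & u m = x].
  have uQ : (u @ \oo) Q by exists N => // m /= Nm; exists m.
  exists (Q, Q) => //= -[x y] /= [[m Nm <-] [n Nn <-]].
  by apply: sP; exact: NP.
exists l; apply/sums_toP => i e e0.
have [J0 J0P] := abs_summable_tail i fS (divr_gt0 e0 (ltr0Sn R 3)).
have [M MP] := EJ J0; exists J0 => J J0J.
move: ul => /cvg_snP/(_ i _ (divr_gt0 e0 (ltr0Sn R 1)))[N _ NP].
have /= uN := NP _ (leq_maxr M N).
have uJ := key i _ J0 J0P _ _ (MP _ (leq_maxl M N)) J0J.
rewrite -(subrKA (u (maxn M N))); apply: le_lt_trans (ler_snD _ _ _) _.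
by apply: lt_le_trans (ltrD uN uJ) _; lra.
Qed.

End CspTheory.

Arguments sums_toM {R A T f s} c _.

Definition poly_growth (R : realType) (T : Type) (sz : T -> nat)
    (g : T -> R) : Prop :=
  exists C k, forall t, `|g t| <= C * (sz t).+1%:R ^+ k.

Definition rapid (R : realType) (B : polymetricRingType R) (T : Type)
    (sz : T -> nat) (f : T -> B) : Prop :=
  forall i (g : T -> R), poly_growth sz g ->
    exists C, forall t, sn i (f t) * `|g t| <= C.

Definition rapid_seq (R : realType) (B : polymetricRingType R)
    (a : int -> B) : Prop := rapid absz a.

Section Rapid.
Variables (R : realType).

Lemma rapidP (B : polymetricRingType R) (T : Type) (sz : T -> nat)
    (f : T -> B) :
  rapid sz f <->
  forall i k, exists C, 0 <= C /\
    forall t, sn i (f t) * (sz t).+1%:R ^+ k <= C.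
Proof.
split=> [fr i k|fr i g [C [k gC]]].
  have [|C fC] := fr i (fun t => (sz t).+1%:R ^+ k).
    by exists 1, k => t; rewrite mul1r ger0_norm ?exprn_ge0.
  exists `|C|; split=> // t; apply: le_trans (ler_norm _).
  by have := fC t; rewrite ger0_norm ?exprn_ge0.
have [D [D0 fD]] := fr i k; exists (`|C| * D) => t.
apply: (@le_trans _ _ (sn i (f t) * (`|C| * (sz t).+1%:R ^+ k))).
  rewrite ler_wpM2l ?sn_ge0//; apply: le_trans (gC t) _.
  by rewrite ler_wpM2r ?exprn_ge0// ler_norm.
by rewrite mulrCA ler_wpM2l.
Qed.

Local Notation wt n := ((absz n).+1%:R : R).

Lemma wt_gt0 (n : int) : 0 < wt n. Proof. by []. Qed.

Lemma wtM (k n : int) : wt n <= wt k * wt (n - k).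
Proof.
rewrite -natrM ler_nat.
by have : (absz n <= absz k + absz (n - k)%R)%N; [lia|nia].
Qed.

Lemma sum_inv_sqr n : \sum_(m < n.+1) ((m.+1)%:R ^+ 2)^-1 <= 2 - n.+1%:R^-1 :> R.
Proof.
elim: n => [|n IH]; first by rewrite big_ord1 expr1n invr1; lra.
rewrite big_ord_recr /=; apply: le_trans (lerD IH (lexx _)) _.
have n0 : 0 < n.+1%:R :> R by [].
have n1 : 0 < n.+2%:R :> R by [].
suff : (n.+2%:R ^+ 2)^-1 <= n.+1%:R^-1 - n.+2%:R^-1 :> R.
  move: ((n.+2%:R ^+ 2)^-1) (n.+1%:R^-1) (n.+2%:R^-1) => a b c; lra.
have -> : n.+1%:R^-1 - n.+2%:R^-1 = (n.+1%:R * n.+2%:R)^-1 :> R.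
  have -> : n.+2%:R = n.+1%:R + 1 :> R by rewrite -natr1.
  move: n.+1%:R n0 => x x0; field.
  by rewrite !gt_eqF// addr_gt0.
by rewrite lef_pV2 ?posrE ?exprn_gt0 ?mulr_gt0// expr2 ler_pM2r// ler_nat.
Qed.

Lemma sum_uniq_sub (T : eqType) (r s : seq T) (F : T -> R) :
  (forall t, 0 <= F t) -> uniq r -> uniq s -> {subset r <= s} ->
  \sum_(t <- r) F t <= \sum_(t <- s) F t.
Proof.
move=> F0 ur us rs; have prs : perm_eq r [seq t <- s | t \in r].
  apply: uniq_perm; rewrite ?filter_uniq// => t; rewrite mem_filter /=.
  by case: (boolP (t \in r)) => //= /rs ->.
rewrite [leRHS](bigID (mem r)) /= (perm_big _ prs) /= big_filter.
by rewrite lerDl sumr_ge0.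
Qed.

Lemma sum_wt_le (J : {fset int}) : \sum_(n <- J) (wt n ^+ 2)^-1 <= 4.
Proof.
pose N := (\max_(n <- J) absz n)%N.
have JN n : n \in J -> (absz n <= N)%N.
  by move=> nJ; rewrite /N (big_fsetD1 n)//= leq_maxl.
pose h (m : 'I_N.+1) : R := (m.+1%:R ^+ 2)^-1.
have pos (P : pred int) (inj : {in [pred n | P n] &, injective absz}) :
    \sum_(n <- J | P n) (wt n ^+ 2)^-1 <= 2.
  apply: (@le_trans _ _ (\sum_(m < N.+1) h m)); last first.
    by apply: le_trans (sum_inv_sqr N) _; rewrite gerBl invr_ge0.
  rewrite -big_filter.
  have -> : \sum_(m < N.+1) h m =
      \sum_(m <- iota 0 N.+1) (m.+1%:R ^+ 2)^-1.
    by rewrite -(big_mkord xpredT (fun m => (m.+1%:R ^+ 2)^-1)) /index_iota subn0.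
  set s := [seq n <- J | P n].
  have -> : \sum_(n <- s) (wt n ^+ 2)^-1 =
      \sum_(m <- [seq absz n | n <- s]) (m.+1%:R ^+ 2)^-1 by rewrite big_map.
  apply: sum_uniq_sub => //.
  - by move=> m; rewrite invr_ge0 exprn_ge0.
  - rewrite map_inj_in_uniq ?filter_uniq ?fset_uniq// => m n.
    by rewrite !mem_filter => /andP[Pm _] /andP[Pn _]; exact: inj.
  - exact: iota_uniq.
  - move=> m /mapP[n]; rewrite mem_filter => /andP[_ nJ] ->.
    by rewrite mem_iota/= add0n ltnS JN.
rewrite (bigID (fun n : int => 0 <= n)) /=.
have -> : 4 = 2 + 2 :> R by lra.
by apply: lerD; apply: pos => m n; rewrite !unfold_in /=; lia.
Qed.

End Rapid.

Definition conv (R : realType) (A : polymetricRingType R) (a b : int -> A)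
    (n : int) : A :=
  lsum (fun k : int => a k * b (n - k)).

Definition single (R : realType) (A : polymetricRingType R) (n : int) (c : A)
    (m : int) : A :=
  if m == n then c else 0.

Section Conv.
Variables (R : realType) (A : cspRingType R).
Implicit Types (a b c : int -> A) (i : sn_index A).

Local Notation wt n := ((absz n).+1%:R : R).

Lemma sums_to_sn_le (T : choiceType) (f : T -> A) s i C :
  sums_to f s -> (forall J : {fset T}, \sum_(t <- J) sn i (f t) <= C) ->
  sn i s <= C.
Proof.
move=> /sums_toP fs fC; apply/ler_addgt0Pl => e e0.
have [J JP] := fs i e e0; rewrite -[s](subrK (\sum_(t <- J) f t)).
apply: le_trans (ler_snD _ _ _) _; apply: lerD; first exact/ltW/JP.
exact: le_trans (ler_sn_sum _ _ _) (fC J).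
Qed.

Lemma rapid_decay a i k : rapid_seq a ->
  exists C, 0 <= C /\
    forall n, sn i (a n) * wt n ^+ k <= C * (wt n ^+ 2)^-1.
Proof.
move=> /rapidP/(_ i (k + 2)%N)[C [C0 aC]]; exists C; split => // n.
by rewrite ler_pdivlMr ?exprn_gt0// -mulrA -exprD.
Qed.

Lemma conv_bound a b i K : rapid_seq a -> rapid_seq b ->
  exists C, forall n (J : {fset int}),
    (\sum_(k <- J) sn i (a k * b (n - k))) * wt n ^+ K <= C.
Proof.
move=> ra rb; have [j jP] := sn_mul i.
have [C [C0 aC]] := rapid_decay j K ra.
have /rapidP/(_ j K)[D [D0 bD]] := rb.
exists (C * D * 4) => n J.
apply: (@le_trans _ _ (\sum_(k <- J) C * D * (wt k ^+ 2)^-1)); last first.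
  by rewrite -mulr_sumr ler_wpM2l ?mulr_ge0// sum_wt_le.
rewrite mulr_suml; apply: ler_sum => k _.
apply: (@le_trans _ _ ((sn j (a k) * wt k ^+ K)
    * (sn j (b (n - k)) * wt (n - k) ^+ K))).
  rewrite mulrACA; apply: ler_pM; rewrite ?sn_ge0 ?exprn_ge0//.
  by rewrite -exprMn lerXn2r ?nnegrE ?mulr_ge0// wtM.
rewrite [leRHS]mulrAC; apply: ler_pM; rewrite ?aC ?bD ?mulr_ge0 ?sn_ge0 ?exprn_ge0//.
Qed.

Lemma conv_summable a b n : rapid_seq a -> rapid_seq b ->
  abs_summable (fun k : int => a k * b (n - k)).
Proof.
move=> ra rb i; have [C CP] := conv_bound i 0 ra rb; exists C => J.
by have := CP n J; rewrite mulr1.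
Qed.

Lemma convP a b n : rapid_seq a -> rapid_seq b ->
  sums_to (fun k : int => a k * b (n - k)) (conv a b n).
Proof.
move=> ra rb; have [s sP] := abs_summable_cvg (conv_summable n ra rb).
by rewrite /conv (lsumE sP).
Qed.

Arguments convP {a b} n _ _.

Lemma rapid_conv a b : rapid_seq a -> rapid_seq b -> rapid_seq (conv a b).
Proof.
move=> ra rb; apply/rapidP => i K; have [C CP] := conv_bound i K ra rb.
exists `|C|; split=> // n; apply: le_trans (ler_norm _).
rewrite -ler_pdivlMr ?exprn_gt0//.
apply: (sums_to_sn_le (f := fun k => a k * b (n - k))) => [|J].
  exact: convP.
by rewrite ler_pdivlMr ?exprn_gt0.
Qed.

Lemma rapidD a b : rapid_seq a -> rapid_seq b ->
  rapid_seq (fun n => a n + b n).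
Proof.
move=> /rapidP ra /rapidP rb; apply/rapidP => i k.
have [C [C0 aC]] := ra i k; have [D [D0 bD]] := rb i k.
exists (C + D); split=> [|n]; first exact: addr_ge0.
apply: le_trans (lerD (aC n) (bD n)); rewrite -mulrDl.
by rewrite ler_wpM2r ?exprn_ge0// ler_snD.
Qed.

Lemma rapidN a : rapid_seq a -> rapid_seq (fun n => - a n).
Proof.
move=> /rapidP ra; apply/rapidP => i k; have [C [C0 aC]] := ra i k.
by exists C; split=> // n; rewrite snN.
Qed.

Lemma rapid_single n x : rapid_seq (single n x : int -> A).
Proof.
apply/rapidP => i k; exists (sn i x * wt n ^+ k).
split=> [|m]; first by rewrite mulr_ge0 ?sn_ge0 ?exprn_ge0.
rewrite /single; case: eqP => [->//|_].
by rewrite sn0 mul0r mulr_ge0 ?sn_ge0 ?exprn_ge0.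
Qed.

Lemma rapid_cst0 : rapid_seq (fun _ => 0 : A).
Proof.
by apply/rapidP => i k; exists 0; split=> // n; rewrite sn0 mul0r.
Qed.

Lemma convC a b : rapid_seq a -> rapid_seq b -> conv a b = conv b a.
Proof.
move=> ra rb; apply/funext => n; apply: lsumE.
have hbij : bijective (fun k : int => n - k).
  by exists (fun k : int => n - k) => k; rewrite subKr.
apply: eq_sums_to (sums_to_bij hbij (convP n rb ra)) => k /=.
by rewrite subKr mulrC.
Qed.

Lemma conv1 b : rapid_seq b -> conv (single 0 1) b = b.
Proof.
move=> rb; apply/funext => n; apply: lsumE.
rewrite -[b n]mul1r -[X in b X]subr0.
pose f k := single 0 1 k * b (n - k).
apply: (@sums_to_delta _ _ _ f 0) => k k0.
by rewrite /f /single (negbTE k0) mul0r.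
Qed.

Lemma convDl a b c : rapid_seq a -> rapid_seq b -> rapid_seq c ->
  conv (fun n => a n + b n) c = (fun n => conv a c n + conv b c n).
Proof.
move=> ra rb rc; apply/funext => n; apply: lsumE.
apply: eq_sums_to (sums_toD (convP n ra rc) (convP n rb rc)) => k.
by rewrite mulrDl.
Qed.

Lemma convA a b c : rapid_seq a -> rapid_seq b -> rapid_seq c ->
  conv a (conv b c) = conv (conv a b) c.
Proof.
move=> ra rb rc; apply/funext => n.
pose F (kl : int * int) := a kl.2 * b (kl.1 - kl.2) * c (n - kl.1).
have FS : abs_summable F.
  move=> i; have [j jP] := sn_mul i; have [j' j'P] := sn_mul j.
  have [C [C0 aC]] := rapid_decay j' 0 ra.
  have /rapidP/(_ j' 0)[D [D0 bD]] := rb.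
  have [E [E0 cE]] := rapid_decay j 0 rc.
  exists (D * (C * 4) * (E * 4)) => J.
  pose K := (fst @` J)%fset; pose L := (snd @` J)%fset.
  pose u k := E * (wt (n - k) ^+ 2)^-1.
  pose v l := C * (wt l ^+ 2)^-1.
  have u0 k : 0 <= u k by rewrite mulr_ge0 ?invr_ge0 ?exprn_ge0.
  have v0 k : 0 <= v k by rewrite mulr_ge0 ?invr_ge0 ?exprn_ge0.
  apply: (@le_trans _ _ (\sum_(kl <- J) D * v kl.2 * u kl.1)).
    apply: ler_sum => -[k l] _ /=; rewrite /F /=.
    apply: le_trans (jP _ _) _; apply: ler_pM; rewrite ?sn_ge0//; last first.
      by have := cE (n - k); rewrite mulr1.
    apply: le_trans (j'P _ _) _; rewrite mulrC.
    apply: ler_pM; rewrite ?sn_ge0//.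
      by have := bD (k - l); rewrite mulr1.
    by have := aC l; rewrite mulr1.
  apply: (@le_trans _ _ (\sum_(k <- K) \sum_(l <- L) D * v l * u k)).
    rewrite pair_big_dep_cond /=.
    apply: sum_uniq_sub; rewrite ?fset_uniq//.
      by move=> t; apply: mulr_ge0 => //; exact: mulr_ge0.
    move=> [k l] klJ; apply/imfset2P; exists k.
      by rewrite !inE; apply/andP; split=> //; apply/imfsetP; exists (k, l).
    exists l => //; rewrite !inE; apply/andP; split=> //.
    by apply/imfsetP; exists (k, l).
  have -> : \sum_(k <- K) \sum_(l <- L) D * v l * u k =
      D * (\sum_(l <- L) v l) * (\sum_(k <- K) u k).
    rewrite [RHS]mulr_sumr; apply: eq_bigr => k _.
    by rewrite -mulr_suml -mulr_sumr.
  apply: ler_pM; rewrite ?mulr_ge0 ?sumr_ge0//.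
    by rewrite ler_wpM2l// -mulr_sumr ler_wpM2l// sum_wt_le.
  rewrite -mulr_sumr ler_wpM2l//.
  have -> : \sum_(k <- K) (wt (n - k) ^+ 2)^-1 =
      \sum_(k <- [fset (n - k)%R | k in K]%fset) (wt k ^+ 2)^-1.
    by rewrite [RHS]big_imfset//= => x y _ _ /addrI/oppr_inj.
  exact: sum_wt_le.
have [s Fs] := abs_summable_cvg FS.
transitivity s; last apply/esym; apply: lsumE.
- have sw : bijective (fun lk : int * int => (lk.2, lk.1)).
    by exists (fun lk : int * int => (lk.2, lk.1)); case.
  apply: (sums_to_fubini (sums_to_bij sw Fs)) => l.
  have sh : bijective (fun k : int => k - l).
    by exists (fun k : int => k + l) => k; rewrite (addrK, subrK).
  apply: eq_sums_to (sums_toM _ (sums_to_bij sh (convP (n - l) rb rc))) => k.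
  by rewrite /F /= mulrA opprB addrA subrK.
- apply: (sums_to_fubini Fs) => k.
  rewrite mulrC; apply: eq_sums_to (sums_toM _ (convP k ra rb)) => l.
  by rewrite /F /= mulrC.
Qed.

End Conv.

Arguments convP {R A a b} n _ _.

Record laurent (R : realType) (A : cspRingType R) := Laurent {
  lcoef :> int -> A;
  _ : `[< rapid_seq lcoef >]
}.

HB.instance Definition _ (R : realType) (A : cspRingType R) :=
  [isSub for @lcoef R A].
HB.instance Definition _ (R : realType) (A : cspRingType R) :=
  [Choice of laurent A by <:].

Section LaurentRing.
Variables (R : realType) (A : cspRingType R).
Implicit Types a b c : laurent A.

Lemma laurentP a : rapid_seq a.
Proof. by case: a => a /= /asboolP. Qed.

Lemma laurent_ext a b : (forall n, a n = b n) -> a = b.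
Proof. by move=> ab; apply/val_inj/funext. Qed.

Definition mk_laurent (f : int -> A) (fr : rapid_seq f) : laurent A :=
  Laurent (asboolT fr).

Definition lzero := mk_laurent (@rapid_cst0 R A).
Definition lopp a := mk_laurent (rapidN (laurentP a)).
Definition ladd a b := mk_laurent (rapidD (laurentP a) (laurentP b)).
Definition lmul a b := mk_laurent (rapid_conv (laurentP a) (laurentP b)).

(* c z^n *)
Definition lmono n (c : A) : laurent A := mk_laurent (@rapid_single R A n c).

Let laddA : associative ladd.
Proof. by move=> a b c; apply: laurent_ext => n /=; rewrite addrA. Qed.
Let laddC : commutative ladd.
Proof. by move=> a b; apply: laurent_ext => n /=; rewrite addrC. Qed.
Let ladd0 : left_id lzero ladd.
Proof. by move=> a; apply: laurent_ext => n /=; rewrite add0r. Qed.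
Let laddN : left_inverse lzero lopp ladd.
Proof. by move=> a; apply: laurent_ext => n /=; rewrite addNr. Qed.

HB.instance Definition _ :=
  GRing.isZmodule.Build (laurent A) laddA laddC ladd0 laddN.

Let lmulA : associative lmul.
Proof.
move=> a b c; apply: val_inj => /=; apply: convA; exact: laurentP.
Qed.
Let lmulC : commutative lmul.
Proof.
move=> a b; apply: val_inj => /=; apply: convC; exact: laurentP.
Qed.
Let lmul1 : left_id (lmono 0 1) lmul.
Proof. move=> a; apply: val_inj => /=; apply: conv1; exact: laurentP. Qed.
Let lmulDl : left_distributive lmul +%R.
Proof.
by move=> a b c; apply: val_inj => /=; apply: convDl; exact: laurentP.
Qed.

HB.instance Definition _ :=
  GRing.Zmodule_isComPzRing.Build (laurent A) lmulA lmulC lmul1 lmulDl.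

(* The seminorms of rapid decrease. Weights (2 + |n|)^k rather than
   (1 + |n|)^k give the same topology and the same rapidly decreasing
   families, and are submultiplicative enough for condition (b) of strong
   polymetric rings to hold for this very family. *)
Definition lsn_values (ik : sn_index A * nat) a : set R :=
  range (fun n => sn ik.1 (a n) * (absz n).+2%:R ^+ ik.2).

Definition lsn (ik : sn_index A * nat) a : R := sup (lsn_values ik a).

Lemma lsn_has_sup ik a : has_sup (lsn_values ik a).
Proof.
case: ik => i k; split; first by exists (sn i (a 0) * 2 ^+ k), 0.
have [|C CP] := laurentP a i (g := fun n => (absz n).+2%:R ^+ k).
  exists (2 ^+ k), k => n; rewrite ger0_norm ?exprn_ge0// -exprMn.
  by rewrite lerXn2r ?nnegrE ?mulr_ge0// -natrM ler_nat; lia.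
exists C => _ [n _ <-]; apply: le_trans (CP n).
by rewrite ger0_norm ?exprn_ge0.
Qed.

Lemma lsn_ub ik a n : sn ik.1 (a n) * (absz n).+2%:R ^+ ik.2 <= lsn ik a.
Proof. by apply: ub_le_sup; [exact: (lsn_has_sup _ _).2|exists n]. Qed.

Lemma lsn_le ik a C :
  (forall n, sn ik.1 (a n) * (absz n).+2%:R ^+ ik.2 <= C) -> lsn ik a <= C.
Proof.
move=> aC; apply: ge_sup; first exact: (lsn_has_sup _ _).1.
by move=> _ [n _ <-].
Qed.

Let lsn_ge0 ik a : 0 <= lsn ik a.
Proof.
by apply: le_trans (lsn_ub ik a 0); rewrite mulr_ge0 ?sn_ge0 ?exprn_ge0.
Qed.

Let lsn0 ik : lsn ik 0 = 0.
Proof.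
apply/eqP; rewrite eq_le lsn_ge0 andbT; apply: lsn_le => n.
by rewrite /= sn0 mul0r.
Qed.

Let lsnN ik a : lsn ik (- a) = lsn ik a.
Proof.
congr sup; rewrite /lsn_values; congr image; apply/funext => n /=.
by rewrite snN.
Qed.

Let ler_lsnD ik a b : lsn ik (a + b) <= lsn ik a + lsn ik b.
Proof.
apply: lsn_le => n; apply: le_trans (lerD (lsn_ub ik a n) (lsn_ub ik b n)).
by rewrite -mulrDl ler_wpM2r ?exprn_ge0// ler_snD.
Qed.

HB.instance Definition _ :=
  ComPzRing_isPolymetric.Build R (laurent A) lsn_ge0 lsn0 lsnN ler_lsnD.

End LaurentRing.

(* The unit group of the ring of Laurent series: pairs of mutually inverse
   series. *)

Record lunit (R : realType) (A : cspRingType R) := LUnit {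
  lunit_pair :> laurent A * laurent A;
  _ : lunit_pair.1 * lunit_pair.2 == 1
}.

Definition uval (R : realType) (A : cspRingType R) (u : lunit A) : laurent A :=
  (lunit_pair u).1.
Definition uinv (R : realType) (A : cspRingType R) (u : lunit A) : laurent A :=
  (lunit_pair u).2.

HB.instance Definition _ (R : realType) (A : cspRingType R) :=
  [isSub for @lunit_pair R A].
HB.instance Definition _ (R : realType) (A : cspRingType R) :=
  [Choice of lunit A by <:].

Section LUnitGroup.
Variables (R : realType) (A : cspRingType R).
Implicit Types u v : lunit A.

Lemma uvalV u : uval u * uinv u = 1.
Proof. by case: u => ab abP; exact/eqP. Qed.

Lemma lunit_ext u v : uval u = uval v -> u = v.
Proof.
move=> uv; apply: val_inj => /=.
suff uv' : uinv u = uinv v.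
  by case: u v uv uv' => [[? ?] ?] [[? ?] ?]; rewrite /uval /uinv /= => -> ->.
by rewrite -[uinv v]mul1r -(uvalV u) mulrAC uv uvalV mul1r.
Qed.

Let lunit1_subproof : (1 : laurent A) * 1 == 1. Proof. by rewrite mulr1. Qed.
Definition lunit1 : lunit A := @LUnit _ _ (1, 1) lunit1_subproof.

Let lunitV_subproof u : uinv u * uval u == 1.
Proof. by rewrite mulrC uvalV. Qed.
Definition lunitV u : lunit A := @LUnit _ _ (uinv u, uval u) (lunitV_subproof u).

Let lunitM_subproof u v : (uval u * uval v) * (uinv u * uinv v) == 1.
Proof. by rewrite mulrACA !uvalV mulr1. Qed.
Definition lunitM u v : lunit A :=
  @LUnit _ _ (uval u * uval v, uinv u * uinv v) (lunitM_subproof u v).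

Let lunitMA : associative lunitM.
Proof. by move=> u v w; apply: lunit_ext; rewrite /uval /= mulrA. Qed.
Let lunit1M : left_id lunit1 lunitM.
Proof. by move=> u; apply: lunit_ext; rewrite /uval /= mul1r. Qed.
Let lunitM1 : right_id lunit1 lunitM.
Proof. by move=> u; apply: lunit_ext; rewrite /uval /= mulr1. Qed.
Let lunitVM : left_inverse lunit1 lunitV lunitM.
Proof. by move=> u; apply: lunit_ext; rewrite /uval /= mulrC uvalV. Qed.
Let lunitMV : right_inverse lunit1 lunitV lunitM.
Proof. by move=> u; apply: lunit_ext; rewrite /uval /= uvalV. Qed.

HB.instance Definition _ :=
  isGroup.Build (lunit A) lunitMA lunit1M lunitM1 lunitVM lunitMV.

(* Initial topology for u |-> (u, u^-1). *)
HB.instance Definition _ := Uniform.copy (lunit A)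
  (initial_topology (@lunit_pair R A)).

End LUnitGroup.

Section Subgroups.
Variables (R : realType) (A : cspRingType R).

Definition strictly_holomorphic : {pred lunit A} := fun u =>
  `[< uval u 0 = 1 /\ uinv u 0 = 1 /\
      forall n : int, n < 0 -> uval u n = 0 /\ uinv u n = 0 >].

Definition strictly_antiholomorphic : {pred lunit A} := fun u =>
  `[< uval u 0 = 1 /\ uinv u 0 = 1 /\
      forall n : int, 0 < n -> uval u n = 0 /\ uinv u n = 0 >].

Definition orthogonal_series : {pred lunit A} := fun u =>
  `[< forall n m : int, n != m -> uval u n * uval u m = 0 >].

(* Inner direct product of (topological) groups, with projections p1, p2, p3.
   Continuity of the projections says that the bijection
   H1 x H2 x H3 -> G is a homeomorphism. *)
Record inner_direct_product (H1 H2 H3 : {pred lunit A})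
    (p1 p2 p3 : lunit A -> lunit A) : Prop := {
  idp_group1 : group_closed H1;
  idp_group2 : group_closed H2;
  idp_group3 : group_closed H3;
  idp_comm : forall x1 x2 x3, x1 \in H1 -> x2 \in H2 -> x3 \in H3 ->
    [/\ commute x1 x2, commute x1 x3 & commute x2 x3];
  idp_proj : forall x, [/\ p1 x \in H1, p2 x \in H2 & p3 x \in H3];
  idp_factor : forall x, x = (p1 x * p2 x * p3 x)%g;
  idp_unique : forall x1 x2 x3, x1 \in H1 -> x2 \in H2 -> x3 \in H3 ->
    [/\ p1 (x1 * x2 * x3)%g = x1, p2 (x1 * x2 * x3)%g = x2
      & p3 (x1 * x2 * x3)%g = x3];
  idp_cont : [/\ continuous p1, continuous p2 & continuous p3]
}.

End Subgroups.

Definition mat (B : Type) := int -> int -> B.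

Section Matrices.
Variables (R : realType) (B : polymetricRingType R).
Implicit Types (M N : mat B) (P Q F : nat -> mat B).

Definition diag1 (S : pred int) : mat B := fun n m => ((n == m) && S n)%:R.

Definition mat1 : mat B := diag1 predT.

Definition mulm M N : mat B := fun n m => lsum (fun k : int => M n k * N k m).

Definition Umx (a : int -> B) : mat B := fun n m => a (n - m).

Definition rapid_mat M : Prop :=
  rapid (fun nm : int * int => (absz nm.1 + absz nm.2)%N)
    (fun nm => M nm.1 nm.2).

Definition neg_int : pred int := fun s => s < 0.
Definition pos_int : pred int := fun s => 0 < s.

Definition toeplitz M : Prop :=
  exists an ap : int -> B, exists N : mat B,
    [/\ rapid_seq an, rapid_seq ap, rapid_mat N & forall n m,
      M n m = mulm (mulm (diag1 neg_int) (Umx an)) (diag1 neg_int) n m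
            + mulm (mulm (diag1 pos_int) (Umx ap)) (diag1 pos_int) n m
            + N n m].

(* Inverse among Toeplitz matrices; 0 if there is none. *)
Definition toeplitz_inv M : mat B :=
  xget (fun _ _ => 0)
    [set N | toeplitz N /\ mulm M N = mat1 /\ mulm N M = mat1].

(* Finite permutations of int, represented by their support K and their
   restriction to K, which has no fixed point. *)
Definition fperm := {s : {K : {fset int} & {perm K}} |
  [forall x, tagged s x != x]}.

Definition fperm_fun (s : fperm) (x : int) : int :=
  if insub x is Some y then val (tagged (val s) y) else x.

Definition fperm_odd (s : fperm) : bool := odd_perm (tagged (val s)).

Definition detm M : B :=
  lsum (fun s : fperm =>
    (-1) ^+ fperm_odd s * lprod (fun x : int => M x (fperm_fun s x))).

(* Formal power series in t whose coefficients are matrices: the coefficient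
   of t^d of P is P d. *)
Definition mulpm P Q : nat -> mat B := fun d n m =>
  \sum_(k < d.+1) mulm (P k) (Q (d - k)%N) n m.

Definition constpm M : nat -> mat B := fun d n m => if d == 0%N then M n m else 0.

Definition invpm P : nat -> mat B :=
  xget (fun _ _ _ => 0)
    [set Q | mulpm P Q = constpm mat1 /\ mulpm Q P = constpm mat1].

End Matrices.

Section Transformations.
Variables (R : realType) (A : cspRingType R).
Implicit Types (a : laurent A) (u : lunit A).

(* The matrices below have entries in A[w^-1, w], that is laurent A read with
   variable w; constants c of A are the series c w^0. *)
Local Notation B := (laurent A).

Definition cstw (c : A) : B := lmono 0 c.
Definition w_ : B := lmono 1 1.
Definition winv : B := lmono (-1) 1.

Definition zpow (n : int) : laurent A := lmono n 1.

Definition Uz a : mat B := Umx (fun n => cstw (a n)).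

(* 1 - t N *)
Definition one_sub_t (N : mat B) : nat -> mat B := fun d n m =>
  match d with
  | 0 => mat1 B n m
  | 1 => - N n m
  | _ => 0
  end.

Definition FRplus : nat -> mat B :=
  one_sub_t (fun n m => w_ * mulm (diag1 B neg_int) (Uz (zpow (-1))) n m).

Definition FRminus : nat -> mat B :=
  one_sub_t (fun n m => winv * mulm (diag1 B pos_int) (Uz (zpow 1)) n m).

Definition conjpm (F : nat -> mat B) a : nat -> mat B :=
  mulpm (mulpm F (constpm (Uz a))) (invpm F).

(* U^{+-}(a(z), 1, w) = \sum_k a_k U^{+-}(z^k, t, w) at t = 1; the inner sum
   is the value at t = 1 of an entry that is a polynomial in t. *)
Definition conjpm1 (F : nat -> mat B) a : mat B := fun n m =>
  lsum (fun k : int =>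
    cstw (a k) * lsum (fun d : nat => conjpm F (zpow k) d n m)).

Definition Uplus1 a : mat B := conjpm1 FRplus a.
Definition Uminus1 a : mat B := conjpm1 FRminus a.

Definition Utilde a : mat B := fun n m =>
  if ((0 < n) && (0 < m)) || ((n < 0) && (m < 0)) then cstw (a (n - m))
  else if (n < 0) && (0 < m) then - w_ * cstw (a (n - m + 1))
  else if (m < 0) && (0 < n) then - winv * cstw (a (n - m - 1))
  else if (n == 0) && (m == 0) then 1
  else 0.

(* Values in A[w^-1, w]; since A[w^-1, w] and A[z^-1, z] are both laurent A,
   replacing w by z is the identity. *)
Definition pi_minus a : laurent A :=
  detm (mulm (Uminus1 a) (toeplitz_inv (Uz a))).
Definition pi_tilde a : laurent A :=
  detm (mulm (Uz a) (toeplitz_inv (Utilde a))).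
Definition pi_plus a : laurent A :=
  detm (mulm (Uplus1 a) (toeplitz_inv (Uz a))).

End Transformations.

(* Main.v *)
Require Import Defs.
From mathcomp Require Import all_boot all_order all_algebra all_classical reals topology.
From HB Require Import structures.
From mathcomp Require Import all_fingroup finmap.
From mathcomp Require Import showcase.summability sequences exp.
From mathcomp Require Import ring lra zify.

Set Implicit Arguments.
Unset Strict Implicit.
Unset Printing Implicit Defensive.

Import Order.TTheory GRing.Theory Num.Theory.

Local Open Scope classical_set_scope.
Local Open Scope ring_scope.

(** Let [u] be a unit with inverse [v], and let [U], [V] be the multiplication
  matrices of [u], [v].

  All determinants are Fredholm determinants [fdet X] of [1 + X] with [X]
  rapidly decreasing. A uniform estimate on the terms of finite determinants
  ([det_terms_est]) shows that they are limits of finite minors ([detm_lim]).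
  Multiplicativity ([fdetM]), Sylvester's identity ([fdet_sylvester]),
  continuity ([fdet_est]) and naturality ([fdet_map]) pass to the limit. This
  applies over the Laurent series ring, and over Laurent series with Laurent
  series coefficients, because [laurent A] inherits the hypotheses on [A].

  The matrix conjugated by the half-line factor [F] (at [t = 1]) is [U + R]
  with [R] rapidly decreasing, and it satisfies [(U + R) F = F U]
  ([Uhalf_F]). Hence the outer projections are [fdet (R V)]. The entries of
  [R V] only involve positive (or only negative) powers, so the determinant is
  1 plus such powers ([pi_half_coef]). It is a unit: a rapidly decreasing
  matrix [X] with [X F = 0] vanishes ([F_inj]), so the matrices [U + R]
  belonging to [u] and to [v] are inverse to each other ([Uhalf_inv]).

  The heart is the factorization [laurent_factorization]: the product of the
  three determinants is [u]. Conjugating first by the negative half-line factor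
  and then by a shift of the positive one is conjugating by the product of
  these factors. This product is [(1 - w / z) T], where [T] identifies the
  nonzero integers with all integers, up to a scaling ([half_factors]), and
  conjugation by [T] is what gives the twisted matrix [W]. So the product of
  the two outer determinants compares [U] with the conjugate of [W] by
  [1 - w / z]. This factor is not invertible: [W - U] is divisible by it only
  up to a correction [rho] concentrated in the column of index 0
  ([twisted_quotient]), and evaluation at [z = w] shows that the corner entry of
  [rho] is [1 - u], read in [w] ([quotient_corner]). By Sylvester's identity
  the factor [1 - w / z] disappears from the determinant. What is left is
  [det (W V)], the inverse of the middle determinant, times the determinant of
  the correction, which is [u].

  The middle determinant is orthogonal because, as a function [D] of the scaling
  of [T], it satisfies [D(o p) D(1) = D(o) D(p)] ([twist_mul]). With two
  independent variables [w1], [w2], the coefficients of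
  [D(w1) D(w2) = D(w1 w2) D(1)] off the diagonal vanish, and these are the
  products of distinct coefficients ([pi_mid_orth]).

  Uniqueness of the decomposition is a comparison of supports
  ([factors_trivial]), and continuity follows from the determinant estimate,
  since [R] is bounded linearly by a seminorm of [u] ([Rhalf_bound]). *)

(** * The ring of Laurent series *)

Section StrongSeq.
Variables (R : realType) (C : cspRingType R).
Implicit Types (i : sn_index C).

Lemma sn_prod_seq i : exists j, forall s : seq C, (0 < size s)%N ->
  sn i (\prod_(x <- s) x) <= \prod_(x <- s) sn j x.
Proof.
have [j jP] := sn_strong i; exists j => -[//|x s] _.
have := jP (size s) (fun k => (x :: s)`_k).
by rewrite [in X in _ -> X](big_nth 0) [in X in _ -> _ <= X](big_nth 0) !big_mkord.
Qed.

End StrongSeq.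

Section LaurentCsp.
Variables (R : realType) (A : cspRingType R).
Local Notation L := (laurent A).

Lemma coef_laurentD (f g : L) k : (f + g) k = f k + g k. Proof. by []. Qed.
Lemma coef_laurentN (f : L) k : (- f) k = - f k. Proof. by []. Qed.
Lemma coef_laurentB (f g : L) k : (f - g) k = f k - g k. Proof. by []. Qed.
Lemma coef_laurent0 k : (0 : L) k = 0. Proof. by []. Qed.
Lemma coef_laurent1 k : (1 : L) k = (k == 0)%:R.
Proof. by rewrite /= /single; case: eqP. Qed.
Lemma coef_lmono n c k : (lmono n c : L) k = if k == n then c else 0.
Proof. by []. Qed.
Lemma coef_laurentM_cvg (f g : L) n :
  sums_to (fun k : int => f k * g (n - k)) ((f * g) n).
Proof. by apply: convP; exact: laurentP. Qed.
Arguments coef_laurentM_cvg : clear implicits.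

Lemma coef_laurent_sum (I : Type) (r : seq I) (P : pred I) (F : I -> L) k :
  (\sum_(x <- r | P x) F x) k = \sum_(x <- r | P x) F x k.
Proof.
by apply: (big_morph (fun f : L => f k)) => // f g; rewrite coef_laurentD.
Qed.

Lemma laurent_snP (p : sn_index A * nat) (f : L) n :
  sn p.1 (f n) * (absz n).+2%:R ^+ p.2 <= sn (p : sn_index L) f.
Proof. exact: lsn_ub. Qed.

Lemma laurent_sn_le (p : sn_index A * nat) (f : L) M :
  (forall n, sn p.1 (f n) * (absz n).+2%:R ^+ p.2 <= M) ->
  sn (p : sn_index L) f <= M.
Proof. exact: lsn_le. Qed.

Lemma sn_coef_le (i : sn_index A) k (f : L) n :
  sn i (f n) <= sn ((i, k) : sn_index L) f.
Proof.
apply: le_trans (laurent_snP (i, k) f n) => /=.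
by rewrite ler_peMr ?sn_ge0// exprn_ege1// ler1n.
Qed.

(** The exponent gains 4 because the weights [(2 + |n|)^-4] have sum at most
  1: each convolution then costs no constant, which is what makes the bound
  uniform in the number of factors. *)
Lemma sum_wt4_le (J : {fset int}) :
  \sum_(n <- J) ((absz n).+2%:R ^+ 4)^-1 <= 1 :> R.
Proof.
apply: (@le_trans _ _ (\sum_(n <- J) 4^-1 * ((absz n).+1%:R ^+ 2)^-1)); last first.
  rewrite -mulr_sumr; apply: (@le_trans _ _ (4^-1 * 4)); last by rewrite mulVf// pnatr_eq0.
  by rewrite ler_wpM2l ?invr_ge0 ?sum_wt_le.
apply: ler_sum => n _; rewrite -invfM lef_pV2 ?posrE ?mulr_gt0 ?exprn_gt0//.
rewrite (_ : 4 = 2 ^+ 2 :> R); last by rewrite -natrX.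
by rewrite -exprMn -natrM -!natrX ler_nat (expnM _ 2 2) leq_exp2r//; nia.
Qed.

(** Only whole products can be bounded uniformly in the number of factors, so
  the coefficients chosen so far are collected in [c] and the bound on [A] is
  applied once, to the complete product. *)
Lemma laurent_strong_aux (i j : sn_index A) k (s : seq L) (c : seq A) n :
  (forall s : seq A, (0 < size s)%N ->
    sn i (\prod_(x <- s) x) <= \prod_(x <- s) sn j x) ->
  (0 < size s)%N ->
  sn i ((\prod_(x <- c) x) * (\prod_(f <- s) f) n) * (absz n).+2%:R ^+ k <=
  \prod_(x <- c) sn j x * \prod_(f <- s) sn ((j, (k + 4)%N) : sn_index L) f.
Proof.
move=> jP; elim: s c n => [//|f s IH] c n _.
have fb l : sn j (f l) * (absz l).+2%:R ^+ k <=
    sn ((j, (k + 4)%N) : sn_index L) f * ((absz l).+2%:R ^+ 4)^-1.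
  rewrite ler_pdivlMr ?exprn_gt0// -mulrA -exprD.
  exact: (laurent_snP (j, (k + 4)%N)).
have c0 : 0 <= \prod_(x <- c) sn j x by apply: prodr_ge0 => x _; exact: sn_ge0.
case: s IH => [|g s] IH.
  rewrite !big_seq1; apply: (@le_trans _ _ (\prod_(x <- c) sn j x *
      (sn j (f n) * (absz n).+2%:R ^+ k))).
    rewrite mulrA ler_wpM2r ?exprn_ge0//.
    have := jP (rcons c (f n)); rewrite size_rcons => /(_ isT).
    by rewrite !big_rcons.
  apply: ler_wpM2l => //; apply: le_trans (fb n) _.
  by rewrite ler_piMr ?sn_ge0// invf_le1 ?exprn_gt0// exprn_ege1// ler1n.
rewrite big_cons [in leRHS]big_cons.
set Q := \prod_(h <- g :: s) h; set q := \prod_(h <- g :: s) sn _ h.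
have q0 : 0 <= q by apply: prodr_ge0 => x _; exact: sn_ge0.
have fQ := sums_toM (\prod_(x <- c) x) (coef_laurentM_cvg f Q n).
rewrite -ler_pdivlMr ?exprn_gt0//; apply: (sums_to_sn_le fQ) => J.
rewrite ler_pdivlMr ?exprn_gt0// mulr_suml.
set F := sn _ f.
apply: (@le_trans _ _ (\sum_(l <- J) (\prod_(x <- c) sn j x * (F * q)) *
    ((absz l).+2%:R ^+ 4)^-1)); last first.
  rewrite -mulr_sumr ler_piMr ?sum_wt4_le// mulr_ge0// mulr_ge0 ?sn_ge0//.
apply: ler_sum => l _.
have wl : (absz n).+2%:R ^+ k <=
    (absz l).+2%:R ^+ k * (absz (n - l)).+2%:R ^+ k :> R.
  rewrite -exprMn lerXn2r ?nnegrE ?mulr_ge0// -natrM ler_nat.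
  have : (absz n <= absz l + absz (n - l)%R)%N by lia.
  by nia.
apply: le_trans (ler_wpM2l (sn_ge0 _ _) wl) _.
have := IH (rcons c (f l)) (n - l) isT; rewrite !big_rcons.
rewrite -/Q -/q -!mulrA => h.
rewrite mulrCA [leLHS]mulrC; apply: le_trans (ler_wpM2r _ h) _.
  by rewrite exprn_ge0.
rewrite -!mulrA; apply: ler_wpM2l => //.
rewrite mulrCA [leRHS]mulrCA; apply: ler_wpM2l => //; exact: fb.
Qed.

Lemma laurent_sn_strong (p : sn_index L) : exists q : sn_index L,
  forall n (X : 'I_n.+1 -> L), sn p (\prod_k X k) <= \prod_k sn q (X k).
Proof.
case: p => i k; have [j jP] := sn_prod_seq i.
exists (j, (k + 4)%N) => n X; apply: (laurent_sn_le (p := (i, k))) => m /=.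
have := @laurent_strong_aux i j k (codom X) [::] m jP.
by rewrite size_codom card_ord => /(_ isT); rewrite !big_nil !mul1r !big_map /= -!big_enum.
Qed.

Lemma laurent_separated : hausdorff_space L.
Proof.
move=> f g fg; apply: laurent_ext => n; apply: sn_eq => i e e0.
have e20 : 0 < e / 2 by rewrite divr_gt0.
pose E := [set xy : L * L | sn ((i, 0%N) : sn_index L) (xy.1 - xy.2) < e / 2].
have Ee : entourage E by exact: entourage_sn.
have [h []] := fg _ _ (nbhs_entourage f Ee) (nbhs_entourage g Ee).
move=> /xsectionP; rewrite /E /= => fh /xsectionP /= gh.
rewrite -coef_laurentB; apply: le_lt_trans (sn_coef_le i 0 _ n) _.
rewrite -(subrKA h) [e]splitr; apply: le_lt_trans (ler_snD _ _ _) _.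
by rewrite ltrD// -opprB snN.
Qed.

(** The limit is taken coefficientwise; the Cauchy estimate in a weighted
  supremum seminorm holds for each coefficient and so survives in the limit. *)
Lemma laurent_seq_complete (u : nat -> L) :
  cauchy (u @ \oo) -> exists l : L, u @ \oo --> l.
Proof.
move=> uc.
have cau (p : sn_index L) e : 0 < e -> exists N, forall m n, (N <= m)%N -> (N <= n)%N ->
    sn p (u m - u n) < e.
  move=> e0; have := uc _ (entourage_sn p e0) => -[[P Q] /=] [[N _ NP] [M _ MQ]] PQ.
  exists (maxn N M) => m n; rewrite !geq_max => /andP[Nm _] /andP[_ Mn].
  exact: (PQ (u m, u n) (conj (NP _ Nm) (MQ _ Mn))).
have /choice[l lP] : forall k, exists l : A, (fun n => u n k) @ \oo --> l.
  move=> k; apply: seq_complete => P; rewrite entourage_snE => -[[s e] /= e0 sP].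
  have [N NP] : exists N, forall m n, (N <= m)%N -> (N <= n)%N ->
      all (fun i => sn i (u m k - u n k) < e) s.
    elim: s {sP} => [|i s [N NP]] /=; first by exists 0%N.
    have [M MP] := cau ((i, 0%N) : sn_index L) e e0; exists (maxn N M) => m n.
    rewrite !geq_max => /andP[Nm Mm] /andP[Nn Mn]; rewrite NP// andbT.
    by rewrite -coef_laurentB; apply: le_lt_trans (sn_coef_le i 0 _ k) (MP _ _ Mm Mn).
  exists ((fun n => u n k) @` [set n | (N <= n)%N], (fun n => u n k) @` [set n | (N <= n)%N]) => /=.
    by split; exists N => // n /= Nn; exists n.
  by move=> [x y] [[m /= Nm <-] [n /= Nn <-]]; apply: sP; exact: NP.
have lim (i : sn_index A) (e : R) k N w : 0 <= w ->
    (forall m, (N <= m)%N -> sn i (u N k - u m k) * w <= e) ->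
    sn i (u N k - l k) * w <= e.
  move=> w0 H; apply/ler_addgt0Pl => d d0.
  have w1 : 0 < w + 1 by rewrite ltr_wpDl.
  have := lP k; rewrite cvg_snP => /(_ i _ (divr_gt0 d0 w1)) [M _ MP].
  have /= hM := MP _ (leq_maxl M N); have hN := H _ (leq_maxr M N).
  rewrite [leRHS]addrC.
  apply: le_trans (lerD hN (lexx d)).
  rewrite -(subrKA (u (maxn M N) k)).
  apply: le_trans (ler_wpM2r w0 (ler_snD _ _ _)) _; rewrite mulrDl lerD2l.
  rewrite -snN opprB; move: hM; rewrite ltr_pdivlMr// => /ltW; apply: le_trans.
  by rewrite ler_wpM2l ?sn_ge0// lerDl.
have lr : rapid_seq l.
  apply/rapidP => i k; have [N NP] := cau ((i, k) : sn_index L) 1 ltr01.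
  have /rapidP/(_ i k)[D [D0 uD]] := laurentP (u N).
  exists (D + 1); split; first by rewrite addr_ge0.
  move=> n; have w0 : 0 <= (absz n).+1%:R ^+ k :> R by rewrite exprn_ge0.
  rewrite -[l n](subKr (u N n)); apply: le_trans (ler_wpM2r w0 (ler_snB _ _ _)) _.
  rewrite mulrDl; apply: lerD => //; apply: lim => // m Nm.
  apply: le_trans (_ : sn i ((u N - u m) n) * (absz n).+2%:R ^+ k <= _).
    by rewrite ler_wpM2l ?sn_ge0// lerXn2r ?nnegrE// ler_nat.
  by apply: le_trans (laurent_snP (i, k) _ n) _; exact/ltW/NP.
exists (mk_laurent lr); apply/cvg_snP => -[i k] e e0.
have e20 : 0 < e / 2 by rewrite divr_gt0.
have [N NP] := cau ((i, k) : sn_index L) _ e20; exists N => // n /= Nn.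
rewrite -snN opprB; apply: le_lt_trans (_ : e / 2 < e); last by rewrite ltr_pdivrMr// ltr_pMr// ltr1n.
apply: (laurent_sn_le (p := (i, k))) => m /=; apply: lim; first by rewrite exprn_ge0.
move=> m' nm'; apply: le_trans (laurent_snP (i, k) (u n - u m') m) _.
by apply/ltW/NP => //; exact: leq_trans nm'.
Qed.

End LaurentCsp.
Arguments coef_laurentM_cvg {R A} f g n.

HB.instance Definition _ (R : realType) (A : cspRingType R) :=
  Polymetric_isStrong.Build R (laurent A) (@laurent_sn_strong R A).
HB.instance Definition _ (R : realType) (A : cspRingType R) :=
  isSeparatedSeqComplete.Build (laurent A) (@laurent_separated R A)
    (@laurent_seq_complete R A).

(** * Extension of permutations along an injection *)

Section PermExtension.
Variables (T T' : finType) (f : T -> T').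
Hypothesis f_inj : injective f.
Implicit Types s t : {perm T}.

Definition ext_fun s (y : T') : T' :=
  if [pick x | f x == y] is Some x then f (s x) else y.

Lemma ext_funE s x : ext_fun s (f x) = f (s x).
Proof.
by rewrite /ext_fun; case: pickP => [x' /eqP/f_inj -> //|/(_ x)]; rewrite eqxx.
Qed.

Lemma ext_fun_out s y : (forall x, f x != y) -> ext_fun s y = y.
Proof. by rewrite /ext_fun => yf; case: pickP => // x; rewrite (negbTE (yf x)). Qed.

Lemma ext_domP y : (exists x, y = f x) \/ (forall x, f x != y).
Proof.
case: (pickP (fun x => f x == y)) => [x /eqP <-|yf]; first by left; exists x.
by right=> x; rewrite yf.
Qed.

Lemma ext_funK s : cancel (ext_fun s) (ext_fun s^-1%g).
Proof.
move=> y; case: (ext_domP y) => [[x ->]|yf]; first by rewrite !ext_funE permK.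
by rewrite !ext_fun_out// => x; rewrite ext_fun_out.
Qed.

Definition ext_perm s : {perm T'} := perm (can_inj (ext_funK s)).

Lemma ext_permE s x : ext_perm s (f x) = f (s x).
Proof. by rewrite permE ext_funE. Qed.

Lemma ext_perm_out s y : (forall x, f x != y) -> ext_perm s y = y.
Proof. by move=> yf; rewrite permE ext_fun_out. Qed.

Lemma ext_permM s t : ext_perm (s * t)%g = (ext_perm s * ext_perm t)%g.
Proof.
apply/permP => y; rewrite permM; case: (ext_domP y) => [[x ->]|yf].
  by rewrite !ext_permE permM.
by rewrite !ext_perm_out.
Qed.

(** Transpositions extend to transpositions. *)
Lemma odd_ext_perm s : odd_perm (ext_perm s) = odd_perm s.
Proof.
have [ts -> _] := prod_tpermP s; elim: ts => [|[x y] ts IH].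
  rewrite !big_nil odd_perm1 (_ : ext_perm 1 = 1%g) ?odd_perm1//.
  by apply: (mulgI (ext_perm 1)); rewrite -ext_permM !mulg1.
rewrite !big_cons ext_permM !odd_permM IH; congr (_ (+) _) => /=.
rewrite (_ : ext_perm (tperm x y) = tperm (f x) (f y)) ?odd_tperm ?(inj_eq f_inj)//.
apply/permP => z; case: (ext_domP z) => [[x' ->]|zf].
  by rewrite ext_permE inj_tperm.
by rewrite ext_perm_out// tpermD.
Qed.

Lemma ext_permP (p : {perm T'}) :
  (forall y, (forall x, f x != y) -> p y = y) -> exists s, p = ext_perm s.
Proof.
move=> pf; have pE x : exists x', f x' == p (f x).
  case: (ext_domP (p (f x))) => [[x' ->]|pfx]; first by exists x'.
  by exists x; rewrite -(inj_eq (@perm_inj _ p)) (pf _ pfx).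
pose g x := xchoose (pE x); have gE x : f (g x) = p (f x).
  exact/eqP/(xchooseP (pE x)).
have g_inj : injective g.
  by move=> x y xy; apply/f_inj/(@perm_inj _ p); rewrite -!gE xy.
exists (perm g_inj); apply/permP => y; case: (ext_domP y) => [[x ->]|yf].
  by rewrite ext_permE permE gE.
by rewrite ext_perm_out// pf.
Qed.

End PermExtension.

(** * Finite permutations of the integers and finite minors *)

Section FpermWindows.
Implicit Types (J : {fset int}) (s : fperm).

Lemma fperm_fun_tag s (k : tag (val s)) :
  fperm_fun s (val k) = val (tagged (val s) k).
Proof. by rewrite /fperm_fun valK. Qed.

Lemma fperm_fun_out s x : x \notin tag (val s) -> fperm_fun s x = x.
Proof. by rewrite /fperm_fun => xs; rewrite insubF//; exact: negbTE. Qed.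

Lemma fperm_fun_moved s x : (x \in tag (val s)) = (fperm_fun s x != x).
Proof.
apply/idP/idP => [xs|]; last by apply: contraR => /fperm_fun_out ->.
rewrite (fperm_fun_tag (s := s) [` xs]%fset) -[X in _ != X]/(val [` xs]%fset).
rewrite (inj_eq val_inj).
by case: s xs => s /= /forallP sP xs; exact: sP.
Qed.

Lemma fperm_fun_inj : injective fperm_fun.
Proof.
move=> s s' ss'; have ss'x x : fperm_fun s x = fperm_fun s' x by rewrite ss'.
have tt' : tag (val s) = tag (val s').
  by apply/fsetP => x; rewrite !fperm_fun_moved ss'x.
apply: val_inj => {ss'}; move: tt' (fperm_fun_tag (s := s)) (fperm_fun_tag (s := s')).
move: (fperm_fun s) (fperm_fun s') ss'x => g g' gg'.
case: (val s) (val s') => [K p] [K' p'] /= KK'; move: p' p; rewrite -KK' => p' p gp gp'.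
by congr existT; apply/permP => k; apply: val_inj; rewrite /= -gp -gp'.
Qed.

Definition fset_nth J (i : 'I_#|{: J}|) : int := val (enum_val i).

Lemma fset_nth_in J (i : 'I_#|{: J}|) : fset_nth i \in J.
Proof. exact: valP. Qed.

Lemma fset_nth_inj J : injective (@fset_nth J).
Proof. by move=> i j /val_inj/enum_val_inj. Qed.

Lemma fset_nth_rank J (x : J) : fset_nth (enum_rank x) = val x.
Proof. by rewrite /fset_nth enum_rankK. Qed.

Lemma fset_nth_onto J x : x \in J -> exists i, x = @fset_nth J i.
Proof. by move=> xJ; exists (enum_rank [` xJ]%fset); rewrite fset_nth_rank. Qed.

Lemma big_fset_nth (S : Type) (idx : S) (op : Monoid.com_law idx) J (F : int -> S) :
  \big[op/idx]_(x <- J) F x = \big[op/idx]_i F (@fset_nth J i).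
Proof.
rewrite big_seq_fsetE /= (reindex (@enum_val J predT))//.
exact/onW_bij/enum_val_bij.
Qed.

(** Both ways, a permutation of the rank set of [J] and its finite
  permutation of the integers have the same support up to [fset_nth], and
  restriction to the support does not change the parity. *)
Lemma fperm_of_perm J (p : 'S_#|{: J}|) : exists s : fperm,
  [/\ forall i, fperm_fun s (fset_nth i) = fset_nth (p i),
      forall x, x \notin J -> fperm_fun s x = x
    & fperm_odd s = odd_perm p].
Proof.
pose K := [fset fset_nth i | i : 'I_#|{: J}| & p i != i]%fset.
have KJ : (K `<=` J)%fset.
  by apply/fsubsetP => x /imfsetP[i _ ->]; exact: fset_nth_in.
pose f (k : K) := enum_rank (fincl KJ k).
have fE k : fset_nth (f k) = val k by rewrite fset_nth_rank.
have f_inj : injective f.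
  by move=> k l /(congr1 (@fset_nth J)); rewrite !fE => /val_inj.
have [y yf|s ps] := ext_permP f_inj (p := p).
  apply/eqP; apply/negPn/negP => py.
  have yK : fset_nth y \in K by apply/imfsetP; exists y.
  have := yf [` yK]%fset; rewrite -(inj_eq (@fset_nth_inj J)) fE eqxx //.
have sfix : [forall k, s k != k].
  apply/forallP => k; rewrite -(inj_eq f_inj) -(ext_permE f_inj) -ps.
  have /imfsetP[i /=] := valP k; rewrite inE => pi /= ki.
  by rewrite (_ : f k = i)//; apply: (@fset_nth_inj J); rewrite fE.
pose S : fperm := exist _ (existT _ K s) sfix.
exists S; split.
- move=> i; case: (ext_domP f i) => [[k ->]|fi].
    rewrite fE (fperm_fun_tag (s := S)) /= ps ext_permE fE //.
  rewrite ps ext_perm_out// fperm_fun_out//=; apply/negP => iK.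
  by have := fi [` iK]%fset; rewrite -(inj_eq (@fset_nth_inj J)) fE eqxx.
- by move=> x xJ; rewrite fperm_fun_out//=; apply: contra xJ; exact: fsubsetP.
- by rewrite /fperm_odd /= ps odd_ext_perm.
Qed.

Lemma perm_of_fperm J s : (forall x, x \notin J -> fperm_fun s x = x) ->
  exists p : 'S_#|{: J}|, forall i, fperm_fun s (fset_nth i) = fset_nth (p i).
Proof.
move=> sJ; have KJ : (tag (val s) `<=` J)%fset.
  apply/fsubsetP => x; rewrite fperm_fun_moved; apply: contraR => xJ.
  by rewrite sJ.
pose f (k : tag (val s)) := enum_rank (fincl KJ k).
have fE k : fset_nth (f k) = val k by rewrite fset_nth_rank.
have f_inj : injective f.
  by move=> k l /(congr1 (@fset_nth J)); rewrite !fE => /val_inj.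
exists (ext_perm f_inj (tagged (val s))) => i.
case: (ext_domP f i) => [[k ->]|fi].
  by rewrite ext_permE !fE fperm_fun_tag.
rewrite ext_perm_out// fperm_fun_out//; apply/negP => iK.
by have := fi [` iK]%fset; rewrite -(inj_eq (@fset_nth_inj J)) fE eqxx.
Qed.

Definition fperm_of J (p : 'S_#|{: J}|) : fperm := sval (cid (fperm_of_perm p)).

Lemma fperm_ofP J (p : 'S_#|{: J}|) :
  [/\ forall i, fperm_fun (fperm_of p) (fset_nth i) = fset_nth (p i),
      forall x, x \notin J -> fperm_fun (fperm_of p) x = x
    & fperm_odd (fperm_of p) = odd_perm p].
Proof. exact: (svalP (cid (fperm_of_perm p))). Qed.

Lemma fperm_of_inj J : injective (@fperm_of J).
Proof.
move=> p q pq; apply/permP => i; apply: (@fset_nth_inj J).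
have [<- _ _] := fperm_ofP p; have [<- _ _] := fperm_ofP q.
by rewrite pq.
Qed.

(** The finite permutations supported in [J] form a finite set: they are
  enumerated by the permutations of the ranks of the elements of [J]. *)
Definition fperms J : {fset fperm} :=
  [fset fperm_of p | p in index_enum {perm 'I_#|{: J}|}]%fset.

Lemma in_fperms J s :
  (s \in fperms J) = `[< forall x, x \notin J -> fperm_fun s x = x >].
Proof.
apply/imfsetP/asboolP => [[p _ ->]|sJ]; first by have [_ pJ _] := fperm_ofP p.
have [p pP] := perm_of_fperm sJ; exists p; first exact: mem_index_enum.
apply/fperm_fun_inj/funext => x; have [pE pJ _] := fperm_ofP p.
case: (boolP (x \in J)) => [/fset_nth_onto[i ->]|xJ]; first by rewrite pP pE.
by rewrite sJ ?pJ.
Qed.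

Lemma big_fperms (S : Type) (idx : S) (op : Monoid.com_law idx) J (F : fperm -> S) :
  \big[op/idx]_(s <- fperms J) F s =
  \big[op/idx]_(p : 'S_#|{: J}|) F (fperm_of p).
Proof.
rewrite big_imfset/= => [|p q _ _]; last exact: fperm_of_inj.
by rewrite undup_id// index_enum_uniq.
Qed.

Lemma fperms_sub J J' : (J `<=` J')%fset -> (fperms J `<=` fperms J')%fset.
Proof.
move=> /fsubsetP JJ'; apply/fsubsetP => s; rewrite !in_fperms => /asboolP sJ.
by apply/asboolP => x xJ'; apply: sJ; apply: contra xJ'; exact: JJ'.
Qed.

Lemma fperms_tag s J : (tag (val s) `<=` J)%fset -> s \in fperms J.
Proof.
move=> /fsubsetP sJ; rewrite in_fperms; apply/asboolP => x xJ.
by apply: fperm_fun_out; apply: contra xJ; exact: sJ.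
Qed.

Definition winmx (T : Type) J (M : int -> int -> T) : 'M[T]_#|{: J}| :=
  \matrix_(i, j) M (fset_nth i) (fset_nth j).

Lemma det_winmx (B : comPzRingType) J (M : int -> int -> B) :
  \det (winmx J M) =
  \sum_(s <- fperms J) (-1) ^+ fperm_odd s * \prod_(x <- J) M x (fperm_fun s x).
Proof.
rewrite big_fperms; apply: eq_bigr => p _; have [pE _ ->] := fperm_ofP p.
congr (_ * _); rewrite big_fset_nth; apply: eq_bigr => i _.
by rewrite mxE pE.
Qed.

End FpermWindows.

(** * Convergence along finite sets of integers *)

Section Windows.
Variables (R : realType) (C : cspRingType R).
Implicit Types (i : sn_index C) (J : {fset int}) (f g : {fset int} -> C).

Definition win N : {fset int} :=
  [fset (k%:Z - N%:Z)%R | k in iota 0 N.*2.+1]%fset.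

Lemma in_win N x : (x \in win N) = (absz x <= N)%N.
Proof.
apply/imfsetP/idP => [[k + ->]|xN]; first by rewrite inE mem_iota; lia.
by exists (absz (x + N%:Z)); rewrite ?inE ?mem_iota; lia.
Qed.

Lemma win_sub N M : (N <= M)%N -> (win N `<=` win M)%fset.
Proof. by move=> NM; apply/fsubsetP => x; rewrite !in_win => /leq_trans; exact. Qed.

Lemma fset_sub_win J : exists N, (J `<=` win N)%fset.
Proof.
exists (\max_(x <- J) absz x)%N; apply/fsubsetP => x xJ; rewrite in_win.
by rewrite (big_fsetD1 x)//= leq_maxl.
Qed.

(** Convergence at the rate [O(1/N)] along the sets containing all integers
  of absolute value at most [N]. All the nets below converge at this rate,
  and a rate is easier to propagate than a bare limit. *)
Definition net_eq f g : Prop :=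
  forall i, exists c : R, forall N J, (win N `<=` J)%fset ->
    sn i (f J - g J) <= c / N.+1%:R.

Definition net_lim f (l : C) : Prop := net_eq (fun=> l) f.

Lemma net_eq_sym f g : net_eq f g -> net_eq g f.
Proof.
move=> fg i; have [c cP] := fg i; exists c => N J NJ.
by rewrite sn_distC; exact: cP.
Qed.

Lemma net_eq_trans f g h : net_eq f g -> net_eq g h -> net_eq f h.
Proof.
move=> fg gh i; have [c cP] := fg i; have [d dP] := gh i; exists (c + d) => N J NJ.
rewrite -(subrKA (g J)) mulrDl; apply: le_trans (ler_snD _ _ _) _.
by apply: lerD; [exact: cP|exact: dP].
Qed.

Lemma net_limM f g (l l' : C) : net_lim f l -> net_lim g l' ->
  net_lim (fun J => f J * g J) (l * l').
Proof.
move=> fl gl; apply: net_eq_sym => i; have [j jP] := sn_mul i.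
have [c cP] := fl j; have [d dP] := gl j.
have c0 : 0 <= c by have := cP 0%N _ (fsubset_refl _); rewrite divr1; apply: le_trans; exact: sn_ge0.
have d0 : 0 <= d by have := dP 0%N _ (fsubset_refl _); rewrite divr1; apply: le_trans; exact: sn_ge0.
exists (c * (sn j l' + d) + sn j l * d) => N J NJ.
have -> : f J * g J - l * l' = - ((l - f J) * (l' - (l' - g J)) + l * (l' - g J)).
  by ring.
rewrite snN; apply: le_trans (ler_snD _ _ _) _; rewrite [leRHS]mulrDl; apply: lerD.
  apply: le_trans (jP _ _) _; rewrite mulrAC; apply: ler_pM; rewrite ?sn_ge0 ?cP//.
  apply: le_trans (ler_snB _ _ _) _; rewrite lerD2l; apply: le_trans (dP _ _ NJ) _.
  by rewrite ler_pdivrMr// ler_peMr// ler1n.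
apply: le_trans (jP _ _) _; rewrite -mulrA; apply: ler_wpM2l; rewrite ?sn_ge0//.
exact: dP.
Qed.

Lemma ler_addharm (x a b : R) M0 :
  (forall M, (M0 <= M)%N -> x <= a + b / M.+1%:R) -> x <= a.
Proof.
move=> H; apply/ler_addgt0Pl => e e0; rewrite addrC.
pose K := maxn M0 (Num.bound (`|b| / e)).
apply: le_trans (H K (leq_maxl _ _)) _; rewrite lerD2l.
rewrite ler_pdivrMr//; apply: le_trans (ler_norm b) _.
rewrite -ler_pdivrMl// mulrC.
apply: (le_trans (ltW (archi_boundP _))); first by rewrite divr_ge0// ltW.
by rewrite ler_nat (leq_trans _ (leqnSn _))// leq_maxr.
Qed.

Lemma net_lim_unique f l l' : net_lim f l -> net_lim f l' -> l = l'.
Proof.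
move=> fl fl'; apply/eqP; rewrite -subr_eq0; apply/eqP/sn_eq0 => i.
have [c cP] := net_eq_trans fl (net_eq_sym fl') i.
apply/eqP; rewrite eq_le sn_ge0 andbT; apply: (@ler_addharm _ 0 c 0%N) => M _.
by rewrite add0r; apply: (cP M (win M)); exact: fsubset_refl.
Qed.

(** The windows form a Cauchy sequence whose limit is that of the net, so
  sequential completeness is enough. *)
Lemma net_complete f :
  (forall i, exists c : R, forall N J, (win N `<=` J)%fset ->
    sn i (f J - f (win N)) <= c / N.+1%:R) ->
  exists l, net_lim f l.
Proof.
move=> fc; have [l ul] : exists l : C, (fun N => f (win N)) @ \oo --> l.
  apply: seq_complete => P; rewrite entourage_snE => -[[s e] /= e0 sP].
  have [N NP] : exists N, forall n, (N <= n)%N ->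
      all (fun i => sn i (f (win n) - f (win N)) < e / 2) s.
    have : exists N, forall M n, (N <= M)%N -> (M <= n)%N ->
      all (fun i => sn i (f (win n) - f (win M)) < e / 2) s.
      elim: s {sP} => [|i s [N NP]] /=; first by exists 0%N.
      have [c cP] := fc i.
      pose K := Num.bound (`|c| / (e / 2)).
      exists (maxn N K) => M n; rewrite geq_max => /andP[NM KM] Mn.
      rewrite NP// andbT; apply: le_lt_trans (cP _ _ (win_sub Mn)) _.
      rewrite ltr_pdivrMr//; apply: le_lt_trans (ler_norm c) _.
      rewrite -ltr_pdivrMl ?divr_gt0// mulrC.
      apply: (lt_le_trans (archi_boundP _)); first by rewrite !divr_ge0// ltW.
      by rewrite ler_nat (leq_trans KM).
    by move=> [N NP]; exists N => n; exact: NP.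
  exists ((fun n => f (win n)) @` [set n | (N <= n)%N], (fun n => f (win n)) @` [set n | (N <= n)%N]) => /=.
    by split; exists N => // n /= Nn; exists n.
  move=> [x y] [[m /= Nm <-] [n /= Nn <-]]; apply: sP => /=.
  move: (NP _ Nm) (NP _ Nn); elim: s {NP} => //= i s IH /andP[hm ms] /andP[hn ns].
  rewrite IH// andbT.
  rewrite -(subrKA (f (win N))) [e]splitr; apply: le_lt_trans (ler_snD _ _ _) _.
  by rewrite ltrD// sn_distC.
exists l => i; have [c cP] := fc i.
exists (c + c) => N J NJ.
have lN : sn i (l - f (win N)) <= c / N.+1%:R.
  apply/ler_addgt0Pl => e e0.
  move: ul => /cvg_snP/(_ i e e0)[M _ MP].
  have /= hM := MP _ (leq_maxl M N).
  rewrite -(subrKA (f (win (maxn M N)))); apply: le_trans (ler_snD _ _ _) _.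
  by apply: lerD; [exact: ltW|apply: cP; exact/win_sub/leq_maxr].
rewrite -(subrKA (f (win N))) mulrDl; apply: le_trans (ler_snD _ _ _) _.
by apply: lerD => //; rewrite sn_distC; exact: cP.
Qed.

Lemma net_lim_totally f l : net_lim f l -> f @ totally --> l.
Proof.
move=> fl; apply/cvg_snP => i e e0; apply/totallyP; have [c cP] := fl i.
pose K := Num.bound (`|c| / e); exists (win K) => J /cP.
move/le_lt_trans; apply; rewrite ltr_pdivrMr//; apply: le_lt_trans (ler_norm c) _.
rewrite -ltr_pdivrMl// mulrC.
apply: (lt_le_trans (archi_boundP _)); first by rewrite divr_ge0// ltW.
by rewrite ler_nat.
Qed.

End Windows.

(** * Fredholm determinants *)

Section FiniteSylvester.
Variables (B : comPzRingType) (n : nat).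
Implicit Types X Y : 'M[B]_n.

(** Both determinants are that of a block matrix with diagonal blocks 1. *)
Lemma det_sylvester X Y : \det (1%:M + X *m Y) = \det (1%:M + Y *m X).
Proof.
pose P := block_mx 1%:M X (- Y) 1%:M; pose Q := block_mx 1%:M (- X) 0 1%:M.
have dQ : \det Q = 1 by rewrite det_ublock !det1 mulr1.
transitivity (\det P).
  rewrite (_ : \det P = \det Q * \det P); last by rewrite dQ mul1r.
  rewrite -det_mulmx mulmx_block !mul1mx !mul0mx mulmx1 mulNmx.
  by rewrite mulmxN opprK subrr !add0r det_lblock det1 mulr1.
rewrite (_ : \det P = \det P * \det Q); last by rewrite dQ mulr1.
rewrite -det_mulmx mulmx_block !mulmx1 !mulmx0 mul1mx addr0 addNr.
by rewrite mulmxN mulNmx opprK det_lblock det1 mul1r addrC.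
Qed.

End FiniteSylvester.

Lemma prod_rcons (B : pzSemiRingType) (T : Type) (F : T -> B) c x :
  \prod_(y <- rcons c x) F y = \prod_(y <- c) F y * F x.
Proof. by rewrite big_rcons. Qed.

Definition oneD (B : pzRingType) (X : int -> int -> B) (n m : int) : B :=
  (n == m)%:R + X n m.

Notation wt R n := ((absz n).+1%:R : R).
Notation vt R n := ((wt R n ^+ 2)^-1).

Section Fredholm.
Variables (R : realType) (C : cspRingType R).
Implicit Types (i j : sn_index C) (J : {fset int}) (X Y : mat C) (s : fperm).

Definition strong_pair i j := forall s : seq C, (0 < size s)%N ->
  sn i (\prod_(x <- s) x) <= \prod_(x <- s) sn j x.

Lemma sn_signM i (b : bool) (x : C) : sn i ((-1) ^+ b * x) = sn i x.
Proof. by case: b; rewrite ?expr1 ?expr0 ?mulN1r ?mul1r ?snN. Qed.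

Lemma vt_gt0 n : 0 < vt R n. Proof. by rewrite invr_gt0 exprn_gt0. Qed.
Lemma vt_ge0 n : 0 <= vt R n. Proof. exact/ltW/vt_gt0. Qed.

(** The factors [1] of a determinant term must not be estimated by a
  seminorm, since their number is unbounded and the seminorm of 1 may exceed
  1; they are kept apart as [b x], and the estimate applies once at least one
  genuine factor (here those in [c]) is present. *)
Lemma prod_maj (T : Type) i j (c : seq C) (r : seq T) (b : T -> bool)
    (X : T -> C) (z : T -> R) :
  strong_pair i j -> (forall x, sn j (X x) <= z x) -> (0 < size c)%N ->
  sn i (\prod_(x <- c) x * \prod_(x <- r) ((b x)%:R + X x)) <=
  \prod_(x <- c) sn j x * \prod_(x <- r) ((b x)%:R + z x).
Proof.
move=> ij Xz; have z0 x : 0 <= z x by apply: le_trans (Xz x); exact: sn_ge0.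
elim: r c => [|x r IH] c c0; first by rewrite !big_nil !mulr1 ij.
rewrite !big_cons.
have q0 : 0 <= \prod_(x <- r) ((b x)%:R + z x).
  by apply: prodr_ge0 => y _; rewrite addr_ge0.
have := IH (rcons c (X x)); rewrite size_rcons => /(_ isT).
rewrite !prod_rcons -!mulrA mulrDl mulrDr => h.
apply: le_trans (ler_snD _ _ _) _; rewrite [in leRHS]mulrDl [in leRHS]mulrDr; apply: lerD.
  by case: (b x); rewrite ?mul1r ?IH// !mul0r !mulr0 sn0.
apply: le_trans h _; apply: ler_wpM2l; first by apply: prodr_ge0 => *; exact: sn_ge0.
by apply: ler_wpM2r.
Qed.

(** Telescoping over the factors. The weight [2 * z x] accounts for the two ways
  in which the factor at [x] enters: as a common factor, or as the difference. *)
Lemma prod_diff_maj (T : Type) i j (c : seq C) (r : seq T) (b : T -> bool)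
    (X Y : T -> C) (z : T -> R) e :
  strong_pair i j -> 0 <= e ->
  (forall x, sn j (X x) <= z x) -> (forall x, sn j (Y x) <= z x) ->
  (forall x, sn j (X x - Y x) <= e * z x) ->
  sn i (\prod_(x <- c) x *
    (\prod_(x <- r) ((b x)%:R + X x) - \prod_(x <- r) ((b x)%:R + Y x))) <=
  e * (\prod_(x <- c) sn j x * \prod_(x <- r) ((b x)%:R + 2 * z x)).
Proof.
move=> ij e0 Xz Yz XY; have z0 x : 0 <= z x by apply: le_trans (Xz x); exact: sn_ge0.
have c0 (c' : seq C) : 0 <= \prod_(x <- c') sn j x.
  by apply: prodr_ge0 => *; exact: sn_ge0.
have q0 (r' : seq T) : 0 <= \prod_(x <- r') ((b x)%:R + 2 * z x).
  by apply: prodr_ge0 => y _; rewrite addr_ge0// mulr_ge0.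
elim: r c => [|x r IH] c.
  by rewrite !big_nil subrr mulr0 sn0 !mulr1 mulr_ge0.
rewrite !big_cons.
set PX := \prod_(_ <- r) (_ + X _); set PY := \prod_(_ <- r) (_ + Y _).
have -> : \prod_(x <- c) x * (((b x)%:R + X x) * PX - ((b x)%:R + Y x) * PY) =
    (b x)%:R * (\prod_(x <- c) x * (PX - PY)) +
    (\prod_(y <- rcons c (X x)) y * (PX - PY) +
     \prod_(y <- rcons c (X x - Y x)) y * PY).
  by rewrite !prod_rcons; ring.
set q := \prod_(_ <- r) _.
have -> : e * (\prod_(x <- c) sn j x * (((b x)%:R + 2 * z x) * q)) =
    (b x)%:R * (e * (\prod_(x <- c) sn j x * q)) +
    (e * ((\prod_(x <- c) sn j x * z x) * q) +
     (\prod_(x <- c) sn j x * (e * z x)) * q) by ring.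
apply: le_trans (ler_snD _ _ _) _; apply: lerD.
  by case: (b x); rewrite ?mul1r ?mul0r ?sn0// IH.
apply: le_trans (ler_snD _ _ _) _; apply: lerD.
  apply: le_trans (IH _) _; apply: ler_wpM2l => //; apply: ler_wpM2r; first exact: q0.
  by rewrite prod_rcons; apply: ler_wpM2l.
apply: le_trans (prod_maj (c := rcons c _) r b ij Yz _) _; first by rewrite size_rcons.
apply: ler_pM => //.
- by apply: prodr_ge0 => y _; rewrite addr_ge0.
- by rewrite prod_rcons; apply: ler_wpM2l.
apply: ler_prod => y _; rewrite addr_ge0//= lerD2l ler_peMl//.
by rewrite ler1n.
Qed.

Lemma sum_perm_le_ffun (T : finType) (G : T -> T -> R) :
  (forall x y, 0 <= G x y) ->
  \sum_(p : {perm T}) \prod_x G x (p x) <= \prod_x \sum_y G x y.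
Proof.
move=> G0; rewrite bigA_distr_bigA /=.
have -> : \sum_(p : {perm T}) \prod_x G x (p x) =
    \sum_(f <- [seq pval p | p <- index_enum {perm T}]) \prod_x G x (f x).
  by rewrite big_map; apply: eq_bigr => p _; apply: eq_bigr => x _; rewrite pvalE.
apply: sum_uniq_sub.
- by move=> f; apply: prodr_ge0.
- by rewrite map_inj_uniq ?index_enum_uniq//; exact: val_inj.
- exact: index_enum_uniq.
- by move=> f _; exact: mem_index_enum.
Qed.

(** Dropping injectivity bounds the sum over permutations by a product of row
  sums [1 + 8 c vt n], each at most [expR (8 c vt n)]; the weights have sum
  at most 4. The bound does not depend on [J]. *)
Lemma sum_fperms_maj (c : R) J : 0 <= c ->
  \sum_(s <- fperms J) \prod_(x <- J) ((x == fperm_fun s x)%:R +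
     2 * (c * (vt R x * vt R (fperm_fun s x)))) <= expR (32 * c).
Proof.
move=> c0; rewrite big_fperms.
pose G (k l : 'I_#|{: J}|) : R :=
  (k == l)%:R + 2 * (c * (vt R (fset_nth k) * vt R (fset_nth l))).
have G0 k l : 0 <= G k l by rewrite addr_ge0// !mulr_ge0 ?vt_ge0.
rewrite (eq_bigr (fun p : {perm _} => \prod_k G k (p k))); last first.
  move=> p _; rewrite big_fset_nth; apply: eq_bigr => k _.
  by have [-> _ _] := fperm_ofP p; rewrite (inj_eq (@fset_nth_inj J)).
apply: le_trans (sum_perm_le_ffun G0) _.
apply: (@le_trans _ _ (\prod_k expR (8 * c * vt R (@fset_nth J k)))).
  apply: ler_prod => k _; rewrite sumr_ge0//=; apply: le_trans (expR_ge1Dx _).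
  rewrite /G big_split /= (bigD1 k)//= eqxx big1 ?addr0; last first.
    by move=> l lk; rewrite eq_sym (negbTE lk).
  rewrite lerD2l -mulr_sumr -mulr_sumr -mulr_sumr.
  rewrite -(big_fset_nth _ J (fun x => vt R x)).
  rewrite [leLHS](_ : _ = 2 * c * vt R (fset_nth k) * \sum_(x <- J) vt R x); last by ring.
  rewrite [leRHS](_ : _ = 2 * c * vt R (fset_nth k) * 4); last by ring.
  by apply: ler_wpM2l; rewrite ?sum_wt_le// !mulr_ge0 ?vt_ge0.
rewrite -expR_sum ler_expR -mulr_sumr -(big_fset_nth _ J (fun x => vt R x)).
rewrite [leRHS](_ : _ = 8 * c * 4); last by ring.
by apply: ler_wpM2l; rewrite ?sum_wt_le// mulr_ge0.
Qed.

Definition det_term J X s : C :=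
  \prod_(x <- J) oneD X x (fperm_fun s x).

Lemma det_oneD J X : \det (winmx J (oneD X)) =
  \sum_(s <- fperms J) (-1) ^+ fperm_odd s * det_term J X s.
Proof. exact: det_winmx. Qed.

(** The weights [vt R n] are summable, so matrices bounded in this way have
  determinants bounded independently of their size. *)
Definition sq_bound j X (c : R) := forall n m, sn j (X n m) <= c * (vt R n * vt R m).

(** The sum of the seminorms of the terms is controlled, not only the seminorm
  of their sum: this gives the unconditional convergence of the expansion over
  all finite permutations. *)
Lemma det_terms_est i j J X Y (c e : R) :
  strong_pair i j -> 0 <= c -> 0 <= e ->
  sq_bound j X c -> sq_bound j Y c ->
  sq_bound j (fun n m => X n m - Y n m) (e * c) ->
  \sum_(s <- fperms J) sn i (det_term J X s - det_term J Y s) <= e * expR (32 * c).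
Proof.
move=> ij c0 e0 Xc Yc XYc; apply: le_trans (ler_wpM2l e0 (sum_fperms_maj J c0)).
rewrite mulr_sumr; apply: ler_sum => s _.
have := @prod_diff_maj int i j [::] J (fun x => x == fperm_fun s x)
  (fun x => X x (fperm_fun s x)) (fun x => Y x (fperm_fun s x))
  (fun x => c * (vt R x * vt R (fperm_fun s x))) e ij e0.
rewrite !big_nil !mul1r; apply => x //.
by rewrite mulrA; exact: XYc.
Qed.

Lemma det_est i j J X Y (c e : R) :
  strong_pair i j -> 0 <= c -> 0 <= e ->
  sq_bound j X c -> sq_bound j Y c ->
  sq_bound j (fun n m => X n m - Y n m) (e * c) ->
  sn i (\det (winmx J (oneD X)) - \det (winmx J (oneD Y))) <= e * expR (32 * c).
Proof.
move=> ij c0 e0 Xc Yc XYc; apply: le_trans (det_terms_est J ij c0 e0 Xc Yc XYc).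
rewrite !det_oneD -sumrB; apply: le_trans (ler_sn_sum _ _ _) _.
by apply: ler_sum => s _; rewrite -mulrBr sn_signM.
Qed.

(** Equivalent to [rapid_mat], with a weight that factors over the two
  indices. *)
Definition rapidm X := forall i k, exists c : R, 0 <= c /\
  forall n m, sn i (X n m) * (wt R n * wt R m) ^+ k <= c.

Lemma rapidm_sq i X k : rapidm X -> exists c : R, 0 <= c /\ forall n m,
  sn i (X n m) <= c * (vt R n * vt R m) / (wt R n * wt R m) ^+ k.
Proof.
move=> /(_ i (k + 2)%N)[c [c0 cP]]; exists c; split=> // n m.
rewrite [leRHS](_ : _ = c / (wt R n * wt R m) ^+ (k + 2)).
  by rewrite ler_pdivlMr ?exprn_gt0 ?mulr_gt0.
by rewrite exprD [(_ * _) ^+ 2]exprMn !invfM; ring.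
Qed.

Lemma rapidm_sq0 i X : rapidm X -> exists c : R, 0 <= c /\ sq_bound i X c.
Proof.
move=> /(rapidm_sq i 0)[c [c0 cP]]; exists c; split=> // n m.
by have := cP n m; rewrite expr0 divr1.
Qed.

(** With the rows outside a window replaced by those of the identity, a larger
  minor has the same expansion as the minor of the window. This turns the
  comparison of two minors into a perturbation estimate of a single one. *)
Definition trunc_rows N X : mat C := fun n m => if (absz n <= N)%N then X n m else 0.

Lemma det_term_trunc N J X s : (win N `<=` J)%fset -> s \in fperms J ->
  det_term J (trunc_rows N X) s =
  if s \in fperms (win N) then det_term (win N) X s else 0.
Proof.
move=> NJ sJ; rewrite in_fperms; case: asboolP => [sN|sN].
  rewrite /det_term -(big_fset_incl _ NJ).
    by apply: eq_big_seq => x; rewrite in_win /oneD /trunc_rows => ->.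
  move=> x _ xN; rewrite sN//; move: xN; rewrite in_win /oneD /trunc_rows eqxx.
  by move=> /negbTE ->; rewrite addr0.
move/existsNP: sN => [x /not_implyP[xN /eqP sx]].
have xJ : x \in J.
  by apply: contraT => xJ; move: sJ; rewrite in_fperms => /asboolP/(_ x xJ)/eqP; rewrite (negbTE sx).
rewrite /det_term (big_fsetD1 x)//= /oneD /trunc_rows eq_sym (negbTE sx).
by rewrite in_win in xN; rewrite (negbTE xN) addr0 mul0r.
Qed.

Lemma fredholm_terms X i : rapidm X -> exists c : R, 0 <= c /\
  forall N J, (win N `<=` J)%fset ->
  \sum_(s <- fperms J) sn i (det_term J X s -
     (if s \in fperms (win N) then det_term (win N) X s else 0)) <= c / N.+1%:R.
Proof.
move=> Xr; have [j ij] := sn_prod_seq i; have [c [c0 cP]] := rapidm_sq j 1 Xr.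
exists (expR (32 * c)); split=> [|N J NJ]; first exact: expR_ge0.
have vv n m : 0 <= vt R n * vt R m by rewrite mulr_ge0 ?vt_ge0.
have cvv n m : 0 <= c * (vt R n * vt R m) by exact: mulr_ge0.
have Xc : sq_bound j X c.
  move=> n m; apply: le_trans (cP n m) _; rewrite ler_piMr// expr1.
  by rewrite invf_le1 -?natrM ?ler1n// ltr0n.
rewrite [leRHS]mulrC; apply: le_trans (det_terms_est (Y := trunc_rows N X) J ij c0 _ Xc _ _).
- rewrite le_eqVlt; apply/orP; left; apply/eqP; apply: eq_big_seq => s sJ.
  by rewrite det_term_trunc.
- by rewrite invr_ge0.
- by move=> n m; rewrite /trunc_rows; case: ifP => _; [exact: Xc|rewrite sn0].
- move=> n m; rewrite /trunc_rows -mulrA; case: ifPn => nN.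
    by rewrite subrr sn0; apply: mulr_ge0 => //; rewrite invr_ge0.
  rewrite subr0; apply: le_trans (cP n m) _; rewrite mulrC expr1; apply: ler_wpM2r => //.
  rewrite lef_pV2 ?posrE ?mulr_gt0// -natrM ler_nat.
  by rewrite -ltnNge in nN; nia.
Qed.

(** While [J] does not contain the support of [s], no term of the minor belongs
  to [s]; with the value 0 there, [fredholm_terms] compares any two stages. *)
Definition fperm_term X s J : C := if s \in fperms J then det_term J X s else 0.

Lemma fperm_term_cvg X s : rapidm X -> exists l, net_lim (fperm_term X s) l.
Proof.
move=> Xr; apply: net_complete => i; have [c [c0 cP]] := fredholm_terms i Xr.
exists c => N J NJ; rewrite {1}/fperm_term; case: ifPn => sJ.
  apply: le_trans (cP N J NJ); rewrite (big_fsetD1 s)//= lerDl.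
  by apply: sumr_ge0 => *; exact: sn_ge0.
rewrite /fperm_term ifN ?subr0 ?sn0 ?divr_ge0//.
by apply: contra sJ; apply: fsubsetP; exact: fperms_sub.
Qed.

Lemma prods_to_unique (T : choiceType) (f : T -> C) l l' :
  prods_to f l -> prods_to f l' -> l = l'.
Proof.
move=> /cvg_snP fl /cvg_snP fl'; apply: sn_eq => i e e0.
have e20 : 0 < e / 2 by rewrite divr_gt0.
have /totallyP[J1 J1P] := fl i _ e20; have /totallyP[J2 J2P] := fl' i _ e20.
have /= h1 := J1P _ (fsubsetUl J1 J2); have /= h2 := J2P _ (fsubsetUr J1 J2).
rewrite -(subrKA (\prod_(t <- (J1 `|` J2)%fset) f t)) [e]splitr.
by apply: le_lt_trans (ler_snD _ _ _) _; rewrite ltrD// sn_distC.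
Qed.

Lemma lprod_fperm_term X s : rapidm X ->
  net_lim (fperm_term X s) (lprod (fun x => oneD X x (fperm_fun s x))).
Proof.
move=> Xr; have [l ll] := fperm_term_cvg s Xr.
suff pl : prods_to (fun x => oneD X x (fperm_fun s x)) l.
  rewrite /lprod; case: xgetP => [l' _ pl'|/(_ l)//].
  by rewrite (prods_to_unique pl' pl).
apply/cvg_snP => i e e0; apply/totallyP.
have /cvg_snP/(_ i e e0)/totallyP[J0 J0P] := net_lim_totally ll.
exists (J0 `|` tag (val s))%fset => J; rewrite fsubUset => /andP[/J0P + sJ].
by rewrite /= /fperm_term (fperms_tag sJ).
Qed.

Lemma net_lim_det X : rapidm X ->
  exists l, net_lim (fun J => \det (winmx J (oneD X))) l.
Proof.
move=> Xr; apply: net_complete => i; have [c [c0 cP]] := fredholm_terms i Xr.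
exists c => N J NJ; apply: le_trans (cP N J NJ).
rewrite !det_oneD.
have -> : \sum_(s <- fperms (win N)) (-1) ^+ fperm_odd s * det_term (win N) X s =
    \sum_(s <- fperms J) (-1) ^+ fperm_odd s * fperm_term X s (win N).
  rewrite -(big_fset_incl _ (fperms_sub NJ)) /=.
    by apply: eq_big_seq => s sN; rewrite /fperm_term sN.
  by move=> s _ sN; rewrite /fperm_term (negbTE sN) mulr0.
rewrite -sumrB; apply: le_trans (ler_sn_sum _ _ _) _.
by apply: ler_sum => s _; rewrite -mulrBr sn_signM.
Qed.

(** The alternating sum over finite permutations is the limit of the finite
  minors: the terms whose support is not in a window are the difference
  between the determinant of a larger window and that of the given one, and
  they are uniformly small in total. *)
Theorem detm_lim X : rapidm X ->
  net_lim (fun J => \det (winmx J (oneD X))) (detm (oneD X)).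
Proof.
move=> Xr; have [D DP] := net_lim_det Xr.
suff -> : detm (oneD X) = D by [].
apply: lsumE; apply/sums_toP => i e e0.
have [c [c0 cP]] := fredholm_terms i Xr; have [d dP] := DP i.
pose P s := lprod (fun x => oneD X x (fperm_fun s x)).
have /choice[b bP] : forall s, exists b : R, forall N J, (win N `<=` J)%fset ->
    sn i (P s - fperm_term X s J) <= b / N.+1%:R.
  by move=> s; exact: (lprod_fperm_term s Xr i).
pose N := Num.bound (c / e); exists (fperms (win N)) => F NF.
apply: (@le_lt_trans _ _ (c / N.+1%:R)); last first.
  rewrite ltr_pdivrMr// -ltr_pdivrMl// mulrC.
  by apply: (lt_le_trans (archi_boundP _)); rewrite ?divr_ge0 ?ler_nat// ltW.
have [M0 M0P] : exists M0, forall s, s \in F -> (tag (val s) `<=` win M0)%fset.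
  have [M MP] := fset_sub_win (\bigcup_(s <- F) tag (val s))%fset.
  exists M => s sF; apply: fsubset_trans MP; apply/fsubsetP => x xs.
  by apply/bigfcupP; exists s; rewrite ?sF.
apply: (@ler_addharm _ _ _ (d + \sum_(s <- F) b s) (maxn N M0)) => M.
rewrite geq_max => /andP[NM M0M].
have sM s : s \in F -> s \in fperms (win M).
  by move=> /M0P sM0; apply/fperms_tag/(fsubset_trans sM0)/win_sub.
set S := \sum_(s <- F) _.
pose SM := \sum_(s <- F) (-1) ^+ fperm_odd s * fperm_term X s (win M).
have -> : D - S = (\det (winmx (win M) (oneD X)) - SM) +
    ((D - \det (winmx (win M) (oneD X))) + (SM - S)) by ring.
apply: le_trans (ler_snD _ _ _) _; apply: lerD.
  apply: le_trans (cP N _ (win_sub NM)).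
  have FM : (F `<=` fperms (win M))%fset by apply/fsubsetP.
  have -> : SM = \sum_(s <- fperms (win M)) (-1) ^+ fperm_odd s *
      (if s \in F then det_term (win M) X s else 0).
    rewrite -(big_fset_incl _ FM) => [|s _ /negbTE ->]; last by rewrite mulr0.
    by apply: eq_big_seq => s sF; rewrite /fperm_term sM ?sF.
  rewrite det_oneD -sumrB; apply: le_trans (ler_sn_sum _ _ _) _.
  apply: ler_sum => s _; rewrite -mulrBr sn_signM; case: ifPn => sF.
    by rewrite subrr sn0 sn_ge0.
  by rewrite ifN//; apply: contra sF; exact: fsubsetP.
rewrite mulrDl; apply: le_trans (ler_snD _ _ _) _; apply: lerD.
  by apply: dP.
rewrite /SM /S -sumrB mulr_suml; apply: le_trans (ler_sn_sum _ _ _) _.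
apply: ler_sum => s _; rewrite -mulrBr sn_signM sn_distC; exact: bP.
Qed.

End Fredholm.

(** * The ring of matrices with rapid off-diagonal decay *)

Lemma lsum_single (R : realType) (C : cspRingType R) (T : choiceType)
    (f : T -> C) t0 : (forall t, t != t0 -> f t = 0) -> lsum f = f t0.
Proof. by move=> f0; apply: lsumE; exact: sums_to_delta. Qed.

Section Decay.
Variables (R : realType) (C : cspRingType R).
Implicit Types (i j : sn_index C) (J : {fset int}) (M N P X Y : mat C).

(** The matrices decreasing rapidly away from the diagonal form a ring that
  contains the multiplication matrices, the half-line factors and the rapidly
  decreasing matrices; all products below are taken in it. *)
Definition decaying M := forall i k, exists c : R, 0 <= c /\
  forall n m, sn i (M n m) * wt R (n - m) ^+ k <= c.

Lemma wt_ge1 n : 1 <= wt R n. Proof. by rewrite ler1n. Qed.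
Lemma wtX_ge1 n k : 1 <= wt R n ^+ k. Proof. by rewrite exprn_ege1// wt_ge1. Qed.
Lemma wtX_ge0 n k : 0 <= wt R n ^+ k. Proof. by rewrite exprn_ge0. Qed.
Lemma wtB n m : wt R (n - m) = wt R (m - n).
Proof. by congr (_%:R); lia. Qed.
Lemma wtXM n k m K : wt R (n - m) ^+ K <= wt R (n - k) ^+ K * wt R (k - m) ^+ K.
Proof.
rewrite -exprMn lerXn2r ?nnegrE ?mulr_ge0// mulrC.
by have := wtM R (k - m) (n - m); rewrite opprB addrA subrK addrC.
Qed.

Lemma decaying_vt M i k : decaying M -> exists c : R, 0 <= c /\
  forall n m, sn i (M n m) * wt R (n - m) ^+ k <= c * vt R (n - m).
Proof.
move=> /(_ i (k + 2)%N)[c [c0 cP]]; exists c; split=> // n m.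
by rewrite ler_pdivlMr ?exprn_gt0// -mulrA -exprD.
Qed.

Lemma sum_vt_shift n J : \sum_(k <- J) vt R (n - k) <= 4.
Proof.
have -> : \sum_(k <- J) vt R (n - k) = \sum_(k <- [fset (n - k)%R | k in J]%fset) vt R k.
  by rewrite [RHS]big_imfset//= => x y _ _ /addrI/oppr_inj.
exact: sum_wt_le.
Qed.

Lemma abs_summable_le (T : choiceType) (f : T -> C) (c : sn_index C -> R) (g : T -> R) d :
  (forall i, 0 <= c i) -> (forall i t, sn i (f t) <= c i * g t) ->
  (forall J : {fset T}, \sum_(t <- J) g t <= d) -> abs_summable f.
Proof.
move=> c0 fc gd i; exists (c i * d) => J.
apply: (@le_trans _ _ (\sum_(t <- J) c i * g t)); first exact: ler_sum.
by rewrite -mulr_sumr ler_wpM2l.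
Qed.

Lemma sums_to_sn_le4 (T : choiceType) (f : T -> C) s i (c d : R) (g : T -> R) :
  sums_to f s -> 0 <= c -> (forall t, sn i (f t) <= c * g t) ->
  (forall J : {fset T}, \sum_(t <- J) g t <= d) -> sn i s <= c * d.
Proof.
move=> fs c0 fc gd; apply: (sums_to_sn_le fs) => J.
apply: (@le_trans _ _ (\sum_(t <- J) c * g t)); first exact: ler_sum.
by rewrite -mulr_sumr ler_wpM2l.
Qed.

Lemma sum_pair_le (g h : int -> R) (d : R) (J : {fset int * int}) :
  0 <= d -> (forall k, 0 <= g k) -> (forall k, 0 <= h k) ->
  (forall K : {fset int}, \sum_(k <- K) g k <= d) ->
  (forall K : {fset int}, \sum_(k <- K) h k <= d) ->
  \sum_(kl <- J) g kl.1 * h kl.2 <= d * d.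
Proof.
move=> d0 g0 h0 gd hd; pose K := (fst @` J)%fset; pose L := (snd @` J)%fset.
apply: (@le_trans _ _ (\sum_(k <- K) \sum_(l <- L) g k * h l)).
  rewrite pair_big_dep_cond /=; apply: sum_uniq_sub; rewrite ?fset_uniq//.
    by move=> t; exact: mulr_ge0.
  move=> [k l] klJ; apply/imfset2P; exists k.
    by rewrite !inE; apply/andP; split=> //; apply/imfsetP; exists (k, l).
  exists l => //; rewrite !inE; apply/andP; split=> //.
  by apply/imfsetP; exists (k, l).
have -> : \sum_(k <- K) \sum_(l <- L) g k * h l = (\sum_(k <- K) g k) * (\sum_(l <- L) h l).
  by rewrite [RHS]mulr_suml; apply: eq_bigr => k _; rewrite mulr_sumr.
by apply: ler_pM; rewrite ?sumr_ge0.
Qed.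

Lemma mulm_cvg M N n m : decaying M -> decaying N ->
  sums_to (fun k => M n k * N k m) (mulm M N n m).
Proof.
move=> Md Nd; suff [s sP] : exists s, sums_to (fun k => M n k * N k m) s.
  by rewrite /mulm (lsumE sP).
apply: abs_summable_cvg.
have /choice[c cP] : forall i, exists c : R, 0 <= c /\
    forall k, sn i (M n k * N k m) <= c * vt R (n - k).
  move=> i; have [j jP] := sn_mul i.
  have [c [c0 cP]] := decaying_vt j 0 Md; have [d [d0 dP]] := Nd j 0%N.
  exists (c * d); split=> [|k]; first exact: mulr_ge0.
  apply: le_trans (jP _ _) _; rewrite mulrAC.
  have := cP n k; have := dP k m; rewrite !mulr1 => h1 h2.
  by apply: ler_pM; rewrite ?sn_ge0.
apply: (@abs_summable_le _ _ c (fun k => vt R (n - k)) 4) => [i|i k|J].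
- exact: (cP i).1.
- exact: (cP i).2.
- exact: sum_vt_shift.
Qed.

Arguments mulm_cvg {M N} n m _ _.

Lemma decaying_mul M N : decaying M -> decaying N -> decaying (mulm M N).
Proof.
move=> Md Nd i K; have [j jP] := sn_mul i.
have [c [c0 cP]] := decaying_vt j K Md; have [d [d0 dP]] := Nd j K.
exists (c * d * 4); split=> [|n m]; first by rewrite !mulr_ge0.
rewrite -ler_pdivlMr ?exprn_gt0// mulrAC.
apply: (sums_to_sn_le4 (mulm_cvg n m Md Nd) (g := fun k => vt R (n - k))).
- by rewrite !mulr_ge0// invr_ge0 wtX_ge0.
- move=> k; rewrite mulrAC ler_pdivlMr ?exprn_gt0//.
  apply: (@le_trans _ _ ((sn j (M n k) * wt R (n - k) ^+ K)
    * (sn j (N k m) * wt R (k - m) ^+ K))); last first.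
    by rewrite [leRHS]mulrAC; apply: ler_pM; rewrite ?mulr_ge0 ?sn_ge0 ?wtX_ge0 ?cP ?dP.
  by rewrite mulrACA; apply: ler_pM; rewrite ?sn_ge0 ?wtX_ge0 ?wtXM.
- by move=> J; exact: sum_vt_shift.
Qed.

(** The triple products are absolutely summable over both inner indices, and
  the two associations sum this double family in the two orders. *)
Lemma mulm_assoc M N P : decaying M -> decaying N -> decaying P ->
  mulm M (mulm N P) = mulm (mulm M N) P.
Proof.
move=> Md Nd Pd; apply/funext => n; apply/funext => m.
pose F (kl : int * int) := M n kl.2 * N kl.2 kl.1 * P kl.1 m.
have /choice[c cP] : forall i, exists c : R, 0 <= c /\
    forall kl, sn i (F kl) <= c * (vt R (m - kl.1) * vt R (n - kl.2)).
  move=> i; have [j jP] := sn_mul i; have [j' j'P] := sn_mul j.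
  have [c [c0 cP]] := decaying_vt j' 0 Md; have [d [d0 dP]] := Nd j' 0%N.
  have [e [e0 eP]] := decaying_vt j 0 Pd.
  exists (c * d * e); split=> [|[k l]]; first by rewrite !mulr_ge0.
  rewrite [leRHS](_ : _ = (c * vt R (n - l) * d) * (e * vt R (m - k))); last by ring.
  have := cP n l; have := dP l k; have := eP k m; rewrite !mulr1 wtB => h1 h2 h3.
  apply: le_trans (jP _ _) _; apply: ler_pM; rewrite ?sn_ge0//.
  by apply: le_trans (j'P _ _) _; apply: ler_pM; rewrite ?sn_ge0.
have FS : abs_summable F.
  apply: (@abs_summable_le _ _ c
    (fun kl : int * int => vt R (m - kl.1) * vt R (n - kl.2)) (4 * 4)) => [i|i kl|J].
  - exact: (cP i).1.
  - exact: (cP i).2.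
  apply: (@sum_pair_le (fun k => vt R (m - k)) (fun k => vt R (n - k)) 4 J) => //.
  - by move=> k; exact: vt_ge0.
  - by move=> k; exact: vt_ge0.
  - exact: sum_vt_shift.
  - exact: sum_vt_shift.
have [s Fs] := abs_summable_cvg FS.
transitivity s; last apply/esym; apply: lsumE.
- have sw : bijective (fun lk : int * int => (lk.2, lk.1)).
    by exists (fun lk : int * int => (lk.2, lk.1)); case.
  apply: (sums_to_fubini (sums_to_bij sw Fs)) => l.
  by apply: eq_sums_to (sums_toM (M n l) (mulm_cvg l m Nd Pd)) => k; rewrite /F /= mulrA.
- apply: (sums_to_fubini Fs) => k.
  rewrite mulrC; apply: eq_sums_to (sums_toM _ (mulm_cvg n k Md Nd)) => l.
  by rewrite /F /= mulrC.
Qed.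

Lemma decaying0 : decaying (fun _ _ => 0).
Proof. by move=> i k; exists 0; split=> // n m; rewrite sn0 mul0r. Qed.

Lemma decayingN M : decaying M -> decaying (fun n m => - M n m).
Proof. by move=> Md i k; have [c cP] := Md i k; exists c; split=> [|n m]; rewrite ?snN; apply cP. Qed.

Lemma decayingD M N : decaying M -> decaying N -> decaying (fun n m => M n m + N n m).
Proof.
move=> Md Nd i k; have [c [c0 cP]] := Md i k; have [d [d0 dP]] := Nd i k.
exists (c + d); split=> [|n m]; first exact: addr_ge0.
apply: le_trans (lerD (cP n m) (dP n m)); rewrite -mulrDl.
by rewrite ler_wpM2r ?exprn_ge0// ler_snD.
Qed.

(** Such a matrix has finitely many nonzero diagonals and bounded entries. *)
Lemma decaying_banded (b : nat) (r : seq C) M :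
  (forall n m, (b < absz (n - m)%R)%N -> M n m = 0) ->
  (forall n m, M n m \in r) -> decaying M.
Proof.
move=> Mb Mr i k; exists ((\sum_(x <- r) sn i x) * b.+1%:R ^+ k).
have r0 : 0 <= \sum_(x <- r) sn i x by apply: sumr_ge0 => *; exact: sn_ge0.
split=> [|n m]; first by rewrite mulr_ge0 ?exprn_ge0.
case: (ltnP b (absz (n - m)%R)) => [/Mb ->|nm].
  by rewrite sn0 mul0r mulr_ge0 ?exprn_ge0.
apply: ler_pM; rewrite ?sn_ge0 ?wtX_ge0//; last by rewrite lerXn2r ?nnegrE// ler_nat.
move: (Mr n m) r0 => {nm}; elim: r {Mr} => // x r IH; rewrite inE big_cons => /orP[/eqP ->|xr] _.
  by rewrite lerDl; apply: sumr_ge0 => *; exact: sn_ge0.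
apply: le_trans (IH xr _) _; first by apply: sumr_ge0 => *; exact: sn_ge0.
by rewrite lerDr sn_ge0.
Qed.

Lemma decaying_mat1 : decaying (mat1 C).
Proof.
apply: (@decaying_banded 0 [:: 0; 1]) => n m.
  by rewrite /mat1 /diag1; case: eqP => //= ->; rewrite subrr.
by rewrite /mat1 /diag1 !inE; case: (_ && _); rewrite /= ?eqxx ?orbT.
Qed.

Lemma mulm1 M : mulm M (mat1 C) = M.
Proof.
apply/funext => n; apply/funext => m; rewrite /mulm (@lsum_single _ _ _ _ m).
  by rewrite /mat1 /diag1 eqxx mulr1.
by move=> k km; rewrite /mat1 /diag1 (negbTE km) mulr0.
Qed.

Lemma mul1m M : mulm (mat1 C) M = M.
Proof.
apply/funext => n; apply/funext => m; rewrite /mulm (@lsum_single _ _ _ _ n).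
  by rewrite /mat1 /diag1 eqxx mul1r.
by move=> k; rewrite eq_sym => kn; rewrite /mat1 /diag1 (negbTE kn) mul0r.
Qed.

Lemma mulmDl M N P : decaying M -> decaying N -> decaying P ->
  mulm (fun n m => M n m + N n m) P = (fun n m => mulm M P n m + mulm N P n m).
Proof.
move=> Md Nd Pd; apply/funext => n; apply/funext => m; apply: lsumE.
by apply: eq_sums_to (sums_toD (mulm_cvg n m Md Pd) (mulm_cvg n m Nd Pd)) => k; rewrite mulrDl.
Qed.

Lemma mulmDr M N P : decaying M -> decaying N -> decaying P ->
  mulm P (fun n m => M n m + N n m) = (fun n m => mulm P M n m + mulm P N n m).
Proof.
move=> Md Nd Pd; apply/funext => n; apply/funext => m; apply: lsumE.
by apply: eq_sums_to (sums_toD (mulm_cvg n m Pd Md) (mulm_cvg n m Pd Nd)) => k; rewrite mulrDr.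
Qed.

End Decay.
Arguments mulm_cvg {R C M N} n m _ _.

Record lmat (R : realType) (C : cspRingType R) := Lmat {
  lent :> int -> int -> C;
  _ : `[< decaying lent >]
}.

HB.instance Definition _ (R : realType) (C : cspRingType R) :=
  [isSub for @lent R C].
HB.instance Definition _ (R : realType) (C : cspRingType R) :=
  [Choice of lmat C by <:].

Section LmatRing.
Variables (R : realType) (C : cspRingType R).
Implicit Types (M N P : lmat C).

Lemma lmatP M : decaying (lent M). Proof. by case: M => M /= /asboolP. Qed.

Lemma lmat_ext M N : (forall n m, M n m = N n m) -> M = N.
Proof. by move=> MN; apply/val_inj/funext => n; apply/funext => m; exact: MN. Qed.

Definition mk_lmat (M : mat C) (Md : decaying M) : lmat C := Lmat (asboolT Md).

Definition mzero := mk_lmat (@decaying0 R C).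
Definition mopp M := mk_lmat (decayingN (lmatP M)).
Definition madd M N := mk_lmat (decayingD (lmatP M) (lmatP N)).
Definition mmul M N := mk_lmat (decaying_mul (lmatP M) (lmatP N)).
Definition mone := mk_lmat (@decaying_mat1 R C).

Let maddA : associative madd.
Proof. by move=> a b c; apply: lmat_ext => n m /=; rewrite addrA. Qed.
Let maddC : commutative madd.
Proof. by move=> a b; apply: lmat_ext => n m /=; rewrite addrC. Qed.
Let madd0 : left_id mzero madd.
Proof. by move=> a; apply: lmat_ext => n m /=; rewrite add0r. Qed.
Let maddN : left_inverse mzero mopp madd.
Proof. by move=> a; apply: lmat_ext => n m /=; rewrite addNr. Qed.

HB.instance Definition _ :=
  GRing.isZmodule.Build (lmat C) maddA maddC madd0 maddN.

Let mmulA : associative mmul.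
Proof. by move=> a b c; apply: val_inj => /=; apply: mulm_assoc; exact: lmatP. Qed.
Let mmul1 : left_id mone mmul.
Proof. by move=> a; apply: val_inj; exact: mul1m. Qed.
Let mmul1r : right_id mone mmul.
Proof. by move=> a; apply: val_inj; exact: mulm1. Qed.
Let mmulDl : left_distributive mmul +%R.
Proof. by move=> a b c; apply: val_inj => /=; apply: mulmDl; exact: lmatP. Qed.
Let mmulDr : right_distributive mmul +%R.
Proof. by move=> a b c; apply: val_inj => /=; apply: mulmDr; exact: lmatP. Qed.

HB.instance Definition _ :=
  GRing.Zmodule_isPzRing.Build (lmat C) mmulA mmul1 mmul1r mmulDl mmulDr.

Lemma lmatD M N n m : (M + N) n m = M n m + N n m. Proof. by []. Qed.
Lemma lmatN M n m : (- M) n m = - M n m. Proof. by []. Qed.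
Lemma lmatB M N n m : (M - N) n m = M n m - N n m. Proof. by []. Qed.
Lemma lmat0 n m : (0 : lmat C) n m = 0. Proof. by []. Qed.
Lemma lmat1 n m : (1 : lmat C) n m = (n == m)%:R.
Proof. by rewrite /= /mat1 /diag1 andbT. Qed.
Lemma lmatM M N n m : (M * N) n m = mulm (lent M) (lent N) n m. Proof. by []. Qed.
Lemma lent_mul M N : lent (M * N) = mulm (lent M) (lent N). Proof. by []. Qed.

Lemma lmatM_cvg M N n m : sums_to (fun k => M n k * N k m) ((M * N) n m).
Proof. by apply: mulm_cvg; exact: lmatP. Qed.

Lemma lmatM_single M N n m k : (forall l, l != k -> M n l * N l m = 0) ->
  (M * N) n m = M n k * N k m.
Proof. by move=> H; rewrite lmatM /mulm (@lsum_single _ _ _ _ k). Qed.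

Lemma lmat_oneD M : lent (1 + M) = oneD (lent M).
Proof.
by apply/funext => n; apply/funext => m; rewrite lmatD lmat1.
Qed.

End LmatRing.
Arguments lmatM_cvg {R C} M N n m.

(** * Rapidly decreasing matrices and the Fredholm determinant *)

Section RapidIdeal.
Variables (R : realType) (C : cspRingType R).
Implicit Types (i j : sn_index C) (J : {fset int}) (M N T X Y Z : lmat C).

(** The estimate shared by [T * X] and [X * T]: the terms of the product sums
  decrease rapidly in all three indices. *)
Definition triple_rapid M N := forall i K, exists c : R, 0 <= c /\
  forall n k m, sn i (M n k * N k m) * (wt R n * wt R m * wt R k) ^+ K <= c.

Lemma triple_rapidl T X : rapidm (lent X) -> triple_rapid T X.
Proof.
move=> Xr i K; have [j jP] := sn_mul i.
have [c [c0 cP]] := lmatP T j K; have [d [d0 dP]] := Xr j (K + K)%N.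
exists (c * d); split=> [|n k m]; first exact: mulr_ge0.
apply: (@le_trans _ _ ((sn j (T n k) * wt R (n - k) ^+ K) *
    (sn j (X k m) * (wt R k * wt R m) ^+ (K + K)))); last first.
  by apply: ler_pM; rewrite ?mulr_ge0 ?sn_ge0 ?exprn_ge0 ?mulr_ge0 ?cP ?dP.
rewrite mulrACA; apply: ler_pM; rewrite ?sn_ge0 ?exprn_ge0 ?mulr_ge0//.
rewrite exprD !exprMn.
have h : wt R n ^+ K <= wt R (n - k) ^+ K * wt R k ^+ K.
  by have := wtXM R n k 0 K; rewrite !subr0.
rewrite [leRHS](_ : _ = (wt R (n - k) ^+ K * wt R k ^+ K) * wt R m ^+ K * wt R k ^+ K * wt R m ^+ K); last by ring.
rewrite -[leLHS]mulr1; apply: ler_pM; rewrite ?mulr_ge0 ?wtX_ge0 ?wtX_ge1//.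
by apply: ler_wpM2r; [exact: wtX_ge0|apply: ler_wpM2r => //; exact: wtX_ge0].
Qed.

Lemma triple_rapidr T X : rapidm (lent X) -> triple_rapid X T.
Proof.
move=> Xr i K; have [j jP] := sn_mul i.
have [c [c0 cP]] := lmatP T j K; have [d [d0 dP]] := Xr j (K + K)%N.
exists (d * c); split=> [|n k m]; first exact: mulr_ge0.
apply: (@le_trans _ _ ((sn j (X n k) * (wt R n * wt R k) ^+ (K + K)) *
    (sn j (T k m) * wt R (k - m) ^+ K))); last first.
  by apply: ler_pM; rewrite ?mulr_ge0 ?sn_ge0 ?exprn_ge0 ?mulr_ge0 ?cP ?dP.
rewrite mulrACA; apply: ler_pM; rewrite ?sn_ge0 ?exprn_ge0 ?mulr_ge0//.
rewrite exprD !exprMn.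
have h : wt R m ^+ K <= wt R (k - m) ^+ K * wt R k ^+ K.
  by have := wtXM R m k 0 K; rewrite !subr0 wtB.
rewrite [leLHS](_ : _ = wt R m ^+ K * (wt R n ^+ K * wt R k ^+ K)); last by ring.
rewrite [leRHS](_ : _ = (wt R (k - m) ^+ K * wt R k ^+ K) * (wt R n ^+ K * wt R k ^+ K) * wt R n ^+ K); last by ring.
rewrite -[leLHS]mulr1; apply: ler_pM; rewrite ?mulr_ge0 ?wtX_ge0 ?wtX_ge1//.
by apply: ler_wpM2r => //; rewrite mulr_ge0 ?wtX_ge0.
Qed.

Lemma triple_rapid_vt M N i K : triple_rapid M N -> exists c : R, 0 <= c /\
  forall n k m, sn i (M n k * N k m) <= c / (wt R n * wt R m * wt R k) ^+ K * vt R k.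
Proof.
move=> /(_ i (K + 2)%N)[c [c0 cP]]; exists c; split=> // n k m.
rewrite -mulrA -invfM ler_pdivlMr ?mulr_gt0 ?exprn_gt0 ?mulr_gt0//.
apply: le_trans (cP n k m); apply: ler_wpM2l; first exact: sn_ge0.
rewrite exprD; apply: ler_wpM2l; first by rewrite exprn_ge0 ?mulr_ge0.
rewrite lerXn2r ?nnegrE ?mulr_ge0// ler_peMl// -natrM.
by rewrite ler1n.
Qed.

Lemma rapidm_triple M N : triple_rapid M N -> rapidm (lent (M * N)).
Proof.
move=> MN i K; have [c [c0 cP]] := triple_rapid_vt i K MN.
exists (c * 4); split=> [|n m]; first by rewrite mulr_ge0.
have h0 : 0 <= c / (wt R n * wt R m) ^+ K by rewrite divr_ge0 ?exprn_ge0 ?mulr_ge0.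
rewrite -ler_pdivlMr ?exprn_gt0 ?mulr_gt0// mulrAC.
apply: (sums_to_sn_le4 (g := fun k => vt R k) (lmatM_cvg M N n m)) => // [k|J]; last exact: sum_wt_le.
apply: le_trans (cP n k m) _; apply: ler_wpM2r; first exact: vt_ge0.
apply: ler_wpM2l => //; rewrite lef_pV2 ?posrE ?exprn_gt0 ?mulr_gt0//.
by rewrite lerXn2r ?nnegrE ?mulr_ge0// ler_peMr ?mulr_ge0// wt_ge1.
Qed.

Lemma rapidm_mull T X : rapidm (lent X) -> rapidm (lent (T * X)).
Proof. by move=> Xr; exact/rapidm_triple/triple_rapidl. Qed.

Lemma rapidm_mulr T X : rapidm (lent X) -> rapidm (lent (X * T)).
Proof. by move=> Xr; exact/rapidm_triple/triple_rapidr. Qed.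

Lemma rapidmD X Y : rapidm (lent X) -> rapidm (lent Y) -> rapidm (lent (X + Y)).
Proof.
move=> Xr Yr i k; have [c [c0 cP]] := Xr i k; have [d [d0 dP]] := Yr i k.
exists (c + d); split=> [|n m]; first exact: addr_ge0.
apply: le_trans (lerD (cP n m) (dP n m)); rewrite -mulrDl.
by rewrite ler_wpM2r ?exprn_ge0 ?mulr_ge0// ler_snD.
Qed.

Lemma rapidmN X : rapidm (lent X) -> rapidm (lent (- X)).
Proof.
move=> Xr i k; have [c [c0 cP]] := Xr i k.
by exists c; split=> // n m; rewrite lmatN snN.
Qed.

Lemma rapidmB X Y : rapidm (lent X) -> rapidm (lent Y) -> rapidm (lent (X - Y)).
Proof. by move=> Xr Yr; apply: rapidmD => //; exact: rapidmN. Qed.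

Lemma rapidm0 : rapidm (lent (0 : lmat C)).
Proof. by move=> i k; exists 0; split=> // n m; rewrite lmat0 sn0 mul0r. Qed.

Lemma decaying_rapidm (X : mat C) : rapidm X -> decaying X.
Proof.
move=> Xr i k; have [c [c0 cP]] := Xr i k; exists c; split=> // n m.
apply: le_trans (cP n m); rewrite ler_wpM2l ?sn_ge0// lerXn2r ?nnegrE ?mulr_ge0//.
by rewrite -natrM ler_nat; nia.
Qed.

(** Finite minors are not multiplicative; the truncated product differs from
  the full one by this tail, at the rate required by [net_eq]. *)
Lemma mul_tail M N i : triple_rapid M N -> exists c : R, 0 <= c /\
  forall P J n m, (win P `<=` J)%fset ->
  sn i (\sum_(k <- J) M n k * N k m - (M * N) n m) <=
    c / P.+1%:R * (vt R n * vt R m).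
Proof.
move=> MN; have [c [c0 cP]] := triple_rapid_vt i 2 MN.
exists (c * 4); split=> [|P J n m PJ]; first by rewrite mulr_ge0.
rewrite sn_distC.
have fs : sums_to (fun k => if k \in J then 0 else M n k * N k m)
    ((M * N) n m - \sum_(k <- J) M n k * N k m).
  apply/sums_toP => i' e e0.
  have /sums_toP/(_ i' e e0)[J0 J0P] := lmatM_cvg M N n m.
  exists (J0 `|` J)%fset => K; rewrite fsubUset => /andP[/J0P + JK].
  rewrite [in X in X -> _](big_fsetID _ (mem J)) /= => h.
  have <- : (M * N) n m - (\sum_(k <- [fset x in K | x \in J]%fset) M n k * N k m +
      \sum_(k <- [fset x in K | x \notin J]%fset) M n k * N k m) =
      (M * N) n m - \sum_(k <- J) M n k * N k m -
      \sum_(k <- K) (if k \in J then 0 else M n k * N k m); last exact: h.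
  rewrite [in RHS](big_fsetID _ (mem J) K) /=.
  rewrite [X in _ = _ - (X + _)]big_seq [X in _ = _ - (X + _)]big1 ?add0r; last first.
    by move=> k; rewrite !inE => /andP[_ ->].
  have -> : \sum_(k <- [fset x in K | x \in J]%fset) M n k * N k m = \sum_(k <- J) M n k * N k m.
    apply: eq_fbigl => k; rewrite !inE andbC; case: (boolP (k \in J)) => //= kJ.
    exact: (fsubsetP JK).
  rewrite opprD addrA; congr (_ - _); apply: eq_big_seq => k.
  by rewrite !inE => /andP[_ /negbTE ->].
rewrite [leRHS](_ : _ = c / P.+1%:R * (vt R n * vt R m) * 4); last by ring.
apply: (sums_to_sn_le4 (g := fun k => vt R k) fs).
- by rewrite !mulr_ge0 ?invr_ge0 ?exprn_ge0.
- move=> k; case: ifPn => kJ.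
    by rewrite sn0 !mulr_ge0 ?invr_ge0 ?exprn_ge0.
  apply: le_trans (cP n k m) _; apply: ler_wpM2r; first exact: vt_ge0.
  rewrite -[leRHS]mulrA; apply: ler_wpM2l => //; rewrite -!invfM lef_pV2 ?posrE ?mulr_gt0 ?exprn_gt0 ?mulr_gt0//.
  rewrite !exprMn [leLHS]mulrC; apply: ler_wpM2l; first by rewrite mulr_ge0 ?wtX_ge0.
  rewrite -natrX ler_nat.
  have : (P < absz k)%N by rewrite ltnNge -in_win; apply: contra kJ; exact: fsubsetP.
  by nia.
- exact: sum_wt_le.
Qed.

(** Determinants over [J] may be computed with matrices depending on [J] that
  approach the given one. *)
Lemma det_net_eq (ZJ : {fset int} -> mat C) (Z : mat C) : rapidm Z ->
  (forall i, exists c : R, 0 <= c /\ forall (K : nat) J n m, (win K `<=` J)%fset ->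
    sn i (ZJ J n m - Z n m) <= c / K.+1%:R * (vt R n * vt R m)) ->
  net_eq (fun J => \det (winmx J (oneD (ZJ J)))) (fun J => \det (winmx J (oneD Z))).
Proof.
move=> Zr ZJP i; have [j ij] := sn_prod_seq i.
have [c [c0 cP]] := ZJP j; have [d [d0 dP]] := rapidm_sq0 j Zr.
have vv n m : 0 <= vt R n * vt R m by rewrite mulr_ge0 ?vt_ge0.
exists (expR (32 * (c + d + 1))) => K J KJ; rewrite mulrC.
have K1 : (K.+1%:R)^-1 <= 1 :> R by rewrite invf_le1 ?ltr0n// ler1n.
apply: (det_est J ij).
- by rewrite !addr_ge0.
- by rewrite invr_ge0.
- move=> n m; rewrite -[ZJ J n m](subrK (Z n m)).
  apply: le_trans (ler_snD _ _ _) _; rewrite !mulrDl mul1r -addrA.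
  apply: lerD; last by rewrite ler_wpDr// dP.
  by apply: le_trans (cP _ _ n m KJ) _; apply: ler_wpM2r => //; rewrite ler_piMr.
- move=> n m; apply: le_trans (dP n m) _; apply: ler_wpM2r => //.
  by rewrite addrAC lerDr addr_ge0.
- move=> n m; apply: le_trans (cP _ _ n m KJ) _; apply: ler_wpM2r => //.
  by rewrite mulrC ler_wpM2l ?invr_ge0// -addrA lerDl addr_ge0.
Qed.

Lemma winmx_mul M N J : winmx J (lent M) *m winmx J (lent N) =
  winmx J (fun n m => \sum_(k <- J) M n k * N k m).
Proof.
apply/matrixP => p q; rewrite !mxE big_fset_nth.
by apply: eq_bigr => r _; rewrite !mxE.
Qed.

Lemma winmx_oneD J (X : mat C) : winmx J (oneD X) = 1%:M + winmx J X.
Proof.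
by apply/matrixP => p q; rewrite !mxE /oneD (inj_eq (@fset_nth_inj J)).
Qed.

Definition fdet X : C := detm (lent (1 + X)).

Lemma fdet_lim X : rapidm (lent X) ->
  net_lim (fun J => \det (winmx J (oneD (lent X)))) (fdet X).
Proof. by move=> Xr; rewrite /fdet lmat_oneD; exact: detm_lim. Qed.

Lemma fdetM X Y : rapidm (lent X) -> rapidm (lent Y) ->
  fdet (X + Y + X * Y) = fdet X * fdet Y.
Proof.
move=> Xr Yr; have XYr := rapidm_mull X Yr.
have Zr : rapidm (lent (X + Y + X * Y)) by do 2!apply: rapidmD => //.
apply: (net_lim_unique (fdet_lim Zr)).
apply: net_eq_trans (net_limM (fdet_lim Xr) (fdet_lim Yr)) _.
pose ZJ J : mat C := fun n m => X n m + Y n m + \sum_(k <- J) X n k * Y k m.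
have -> : (fun J => \det (winmx J (oneD (lent X))) * \det (winmx J (oneD (lent Y)))) =
    (fun J => \det (winmx J (oneD (ZJ J)))).
  apply/funext => J; rewrite -det_mulmx !winmx_oneD mulmxDl !mulmxDr !mul1mx mulmx1.
  rewrite winmx_mul; congr (\det _); rewrite -!addrA; congr (_ + _).
  by rewrite addrCA; apply/matrixP => p q; rewrite !mxE /ZJ addrA.
apply: det_net_eq => // i; have [c [c0 cP]] := mul_tail i (triple_rapidl X Yr).
exists c; split=> // N J n m NJ; apply: le_trans (cP N J n m NJ).
by rewrite /ZJ !lmatD opprD addrACA subrr add0r.
Qed.

(** Sylvester's identity holds for each [J] with products truncated to
  [J], and the truncation disappears in the limit. *)
Lemma fdet_sylvester T X : rapidm (lent X) -> fdet (T * X) = fdet (X * T).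
Proof.
move=> Xr; have TXr := rapidm_mull T Xr; have XTr := rapidm_mulr T Xr.
have aux M N : triple_rapid M N -> net_eq (fun J => \det (1%:M + winmx J (lent M) *m winmx J (lent N)))
    (fun J => \det (winmx J (oneD (lent (M * N))))).
  move=> MN; pose ZJ J : mat C := fun n m => \sum_(k <- J) M n k * N k m.
  have -> : (fun J => \det (1%:M + winmx J (lent M) *m winmx J (lent N))) =
      (fun J => \det (winmx J (oneD (ZJ J)))).
    by apply/funext => J; rewrite winmx_oneD winmx_mul.
  apply: det_net_eq; first exact: rapidm_triple.
  by move=> i; have [c [c0 cP]] := mul_tail i MN; exists c; split.
apply: (net_lim_unique (fdet_lim TXr)).
apply: net_eq_trans (fdet_lim XTr) _.
apply: net_eq_trans (net_eq_sym (aux _ _ (triple_rapidr T Xr))) _.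
under eq_fun do rewrite det_sylvester.
exact: aux (triple_rapidl T Xr).
Qed.

Lemma fdet_conj M N X : rapidm (lent X) -> N * M = 1 -> fdet (M * X * N) = fdet X.
Proof.
by move=> Xr NM; rewrite -mulrA fdet_sylvester -?mulrA ?NM ?mulr1//; exact: rapidm_mulr.
Qed.

Lemma fdet0 : fdet 0 = 1.
Proof.
apply: (net_lim_unique (fdet_lim rapidm0)) => i; exists 0 => N J _.
rewrite winmx_oneD (_ : winmx J _ = 0) ?addr0 ?det1 ?subrr ?sn0 ?mul0r//.
by apply/matrixP => p q; rewrite !mxE.
Qed.

End RapidIdeal.

Section FdetProperties.
Variables (R : realType) (C : cspRingType R).
Implicit Types (i j : sn_index C) (J : {fset int}) (X Y : lmat C).

Lemma fdet_est i j X Y (c e : R) :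
  strong_pair i j -> rapidm (lent X) -> rapidm (lent Y) -> 0 <= c -> 0 <= e ->
  sq_bound j (lent X) c -> sq_bound j (lent Y) c ->
  sq_bound j (lent (X - Y)) (e * c) ->
  sn i (fdet X - fdet Y) <= e * expR (32 * c).
Proof.
move=> ij Xr Yr c0 e0 Xc Yc XYc.
have [a aP] := fdet_lim Xr i; have [b bP] := fdet_lim Yr i.
apply: (@ler_addharm _ _ _ (a + b) 0%N) => K _.
have h := det_est (win K) ij c0 e0 Xc Yc XYc.
set dX := \det _ in h; set dY := \det _ in h.
have -> : fdet X - fdet Y = (dX - dY) + ((fdet X - dX) - (fdet Y - dY)) by ring.
apply: le_trans (ler_snD _ _ _) _; apply: lerD => //.
rewrite mulrDl; apply: le_trans (ler_snB _ _ _) _.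
by apply: lerD; [exact: aP|exact: bP].
Qed.

Lemma fdet_diag0 X : (forall n m, ~~ ((n == 0) && (m == 0)) -> X n m = 0) ->
  rapidm (lent X) -> fdet X = 1 + X 0 0.
Proof.
move=> X0 Xr; apply: (net_lim_unique (fdet_lim Xr)) => i.
exists (sn i (1 + X 0 0) + sn i 1) => K J KJ.
have J0 : 0 \in J by apply: (fsubsetP KJ); rewrite in_win.
suff -> : \det (winmx J (oneD (lent X))) = 1 + X 0 0.
  by rewrite subrr sn0 divr_ge0// addr_ge0 ?sn_ge0.
have -> : winmx J (oneD (lent X)) =
    diag_mx (\row_p oneD (lent X) (fset_nth p) (@fset_nth J p)).
  apply/matrixP => p q; rewrite !mxE; case: eqVneq => [->|pq]; first by rewrite mulr1n.
  rewrite mulr0n /oneD (inj_eq (@fset_nth_inj J)) (negbTE pq) add0r X0//.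
  by apply: contra pq => /andP[/eqP p0 /eqP q0]; rewrite -(inj_eq (@fset_nth_inj J)) p0 q0.
rewrite det_diag; under eq_bigr do rewrite mxE.
rewrite -(big_fset_nth _ J (fun x => oneD (lent X) x x)) (big_fsetD1 0)//=.
rewrite /oneD eqxx big_seq big1 ?mulr1// => x; rewrite !inE => /andP[x0 _].
by rewrite eqxx X0 ?addr0// (negbTE x0).
Qed.

(** With [E] the elementary matrix at 0 one has [X = X * E], so Sylvester's
  identity replaces [X] by [E * X], which has a single nonzero entry. *)
Lemma fdet_col0 X : (forall n m, m != 0 -> X n m = 0) -> rapidm (lent X) ->
  fdet X = 1 + X 0 0.
Proof.
move=> X0 Xr; have ed : decaying (fun n m : int => ((n == 0) && (m == 0))%:R : C).
  apply: (@decaying_banded _ _ 0 [:: 0; 1]) => n m.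
    by case: eqP => [->|//]; case: eqP => [->|]; rewrite ?subrr.
  by rewrite !inE; case: (_ && _); rewrite /= ?eqxx ?orbT.
pose E := mk_lmat ed.
have XE : X * E = X.
  apply: lmat_ext => n m; rewrite (lmatM_single (k := 0)) /=.
    by case: eqVneq => [->|/X0 ->]; rewrite ?mulr1 ?mulr0.
  by move=> l l0; rewrite (X0 _ _ l0) mul0r.
have EX n m : (E * X) n m = if (n == 0) && (m == 0) then X 0 0 else 0.
  rewrite (lmatM_single (k := 0)) /=; last by move=> l /negbTE ->; rewrite andbF mul0r.
  rewrite andbT; case: eqVneq => _; rewrite /= ?mul0r//.
  by case: eqVneq => [->|/X0 ->]; rewrite ?mul1r ?mulr0.
rewrite -{1}XE -fdet_sylvester// fdet_diag0 ?EX//; last exact: rapidm_mull.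
by move=> n m /negbTE nm; rewrite EX nm.
Qed.

(** Determinants of perturbations with entries in a closed non-unital subring
  [I] are congruent to 1. This locates the coefficients of the determinants
  that define the projections. *)
Lemma fdet_subring (I : C -> Prop) X : rapidm (lent X) ->
  I 0 -> (forall x y, I x -> I y -> I (x + y)) -> (forall x, I x -> I (- x)) ->
  (forall x y, I x -> I y -> I (x * y)) ->
  (forall f l, net_lim f l -> (forall J, I (f J)) -> I l) ->
  (forall n m, I (X n m)) -> I (fdet X - 1).
Proof.
move=> Xr I0 ID IN IM Icl IX.
apply: (Icl (fun J => \det (winmx J (oneD (lent X))) - 1)) => [i|J].
  have [c cP] := fdet_lim Xr i; exists c => K J KJ.
  by rewrite opprB addrA subrK; exact: cP.
have -> : 1 = \det (winmx J (oneD (lent (0 : lmat C)))) :> C.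
  rewrite winmx_oneD (_ : winmx J _ = 0) ?addr0 ?det1//.
  by apply/matrixP => p q; rewrite !mxE.
rewrite !det_oneD -sumrB; elim/big_ind: _ => [//|x y|s _]; first exact: ID.
rewrite -mulrBr.
have IS (b : bool) x : I x -> I ((-1) ^+ b * x).
  by case: b => Ix; rewrite ?expr1 ?mulN1r ?expr0 ?mul1r//; exact: IN.
apply: IS; rewrite /det_term; suff [b [_ //]] : exists b : bool,
    \prod_(x <- J) oneD (lent (0 : lmat C)) x (fperm_fun s x) = b%:R /\
    I (\prod_(x <- J) oneD (lent X) x (fperm_fun s x) -
       \prod_(x <- J) oneD (lent (0 : lmat C)) x (fperm_fun s x)).
elim: (enum_fset J) => [|x r [b [bE Ir]]]; first by exists true; rewrite !big_nil subrr.
exists ((x == fperm_fun s x) && b); rewrite !big_cons bE /oneD lmat0 addr0 mulr_natl mulrb.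
split; first by case: (_ == _).
rewrite -bE; set P := \prod_(_ <- r) _; set Q := \prod_(_ <- r) _ in bE Ir *.
have IXP : I (X x (fperm_fun s x) * P).
  rewrite -(subrK Q P) mulrDr; apply: ID; first exact: IM.
  by rewrite bE; case: (b); rewrite ?mulr1 ?mulr0.
rewrite mulrDl mulr_natl mulrb; case: eqP => _; last by rewrite add0r subr0.
by rewrite addrAC; apply: ID.
Qed.

End FdetProperties.

Section ContinuousMorphisms.
Variables (R : realType) (C C' : cspRingType R).

Definition sn_bounded (f : C -> C') := forall i, exists j, exists c : R,
  0 <= c /\ forall x, sn i (f x) <= c * sn j x.

Variable f : {rmorphism C -> C'}.
Hypothesis fb : sn_bounded f.

Lemma sums_to_map (T : choiceType) (g : T -> C) s :
  sums_to g s -> sums_to (f \o g) (f s).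
Proof.
move=> /sums_toP gs; apply/sums_toP => i e e0; have [j [c [c0 cP]]] := fb i.
have c1 : 0 < c + 1 by rewrite ltr_wpDl.
have [J0 J0P] := gs j (e / (c + 1)) (divr_gt0 e0 c1).
exists J0 => J /J0P; rewrite -rmorph_sum -rmorphB ltr_pdivlMr// mulrC.
apply: le_lt_trans; apply: le_trans (cP _) _.
by rewrite ler_wpM2r ?sn_ge0// lerDl.
Qed.

(** Finite determinants commute with ring morphisms, and a bounded one commutes
  with the limit. *)
Lemma fdet_map (X : lmat C) (Y : lmat C') : rapidm (lent X) -> rapidm (lent Y) ->
  (forall n m, Y n m = f (X n m)) -> f (fdet X) = fdet Y.
Proof.
move=> Xr Yr YX; apply: net_lim_unique (fdet_lim Yr) => i.
have [j [c [c0 cP]]] := fb i; have [d dP] := fdet_lim Xr j; exists (c * d) => K J KJ.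
have -> : winmx J (oneD (lent Y)) = map_mx f (winmx J (oneD (lent X))).
  by apply/matrixP => p q; rewrite !mxE /oneD rmorphD rmorph_nat YX.
rewrite det_map_mx -rmorphB; apply: le_trans (cP _) _.
by rewrite -mulrA; apply: ler_wpM2l => //; exact: dP.
Qed.

End ContinuousMorphisms.

(** * Constants and coefficientwise constants *)

Section Constants.
Variables (R : realType) (A : cspRingType R).
Local Notation L := (laurent A).

Lemma cstw_zmod_morphism : zmod_morphism (@cstw R A).
Proof.
move=> x y; apply: laurent_ext => n; rewrite coef_laurentB !coef_lmono.
by case: ifP; rewrite ?subr0.
Qed.

Lemma coef_lmonoM m c (g : L) n : (lmono m c * g) n = c * g (n - m).
Proof.
apply: (sums_to_unique (coef_laurentM_cvg (lmono m c) g n)).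
have -> : c * g (n - m) = (fun k => lmono m c k * g (n - k)) m.
  by rewrite coef_lmono eqxx.
by apply: sums_to_delta => k km; rewrite coef_lmono (negbTE km) mul0r.
Qed.

Lemma lmonoM m n (c d : A) : lmono m c * lmono n d = lmono (m + n) (c * d).
Proof.
apply: laurent_ext => k; rewrite coef_lmonoM !coef_lmono subr_eq addrC.
by rewrite addrC [n + m]addrC; case: ifP; rewrite ?mulr0.
Qed.

Lemma lmono0_1 : lmono 0 1 = 1 :> L. Proof. by []. Qed.

Lemma cstw_monoid_morphism : monoid_morphism (@cstw R A).
Proof. by split=> // x y; rewrite /cstw lmonoM addr0. Qed.

HB.instance Definition _ := GRing.isZmodMorphism.Build A L (@cstw R A) cstw_zmod_morphism.
HB.instance Definition _ := GRing.isMonoidMorphism.Build A L (@cstw R A) cstw_monoid_morphism.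

Lemma sn_cstw (i : sn_index A) k x : sn ((i, k) : sn_index L) (cstw x) <= 2 ^+ k * sn i x.
Proof.
apply: (laurent_sn_le (p := (i, k))) => n /=; rewrite /single.
case: eqVneq => [->|_]; first by rewrite mulrC.
by rewrite sn0 mul0r mulr_ge0 ?sn_ge0 ?exprn_ge0.
Qed.

Lemma cstw_bounded : sn_bounded (@cstw R A).
Proof.
move=> [i k]; exists i, (2 ^+ k); split; first by rewrite exprn_ge0.
by move=> x; exact: sn_cstw.
Qed.

Lemma rapid_seq_cst (a : L) : rapid_seq (fun n => cstw (a n)).
Proof.
apply/rapidP => -[i k] K; have /rapidP/(_ i K)[c [c0 cP]] := laurentP a.
exists (2 ^+ k * c); split=> [|n]; first by rewrite mulr_ge0 ?exprn_ge0.
apply: le_trans (ler_wpM2r (wtX_ge0 _ _ _) (sn_cstw i k _)) _.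
by rewrite -mulrA ler_wpM2l ?exprn_ge0.
Qed.

(** A series in [z] over [A], read as a series in [z] with coefficients that
  are constant in [w]. Together with [cstw], which reads a series in [w], it gives
  the two embeddings of [laurent A] into the series in two variables. *)
Definition cst_coefs (a : L) : laurent L := mk_laurent (rapid_seq_cst a).

Lemma coef_cst_coefs a n : cst_coefs a n = cstw (a n). Proof. by []. Qed.

Lemma cst_coefs_zmod_morphism : zmod_morphism cst_coefs.
Proof.
by move=> x y; apply: laurent_ext => n; rewrite coef_laurentB !coef_cst_coefs coef_laurentB rmorphB.
Qed.

Lemma cst_coefs_monoid_morphism : monoid_morphism cst_coefs.
Proof.
split=> [|a b]; apply: laurent_ext => n; rewrite coef_cst_coefs.
  by rewrite !coef_laurent1 rmorph_nat.
have h := sums_to_map cstw_bounded (coef_laurentM_cvg a b n).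
apply: (sums_to_unique h); apply: eq_sums_to (coef_laurentM_cvg _ _ n) => k /=.
by rewrite -rmorphM.
Qed.

HB.instance Definition _ := GRing.isZmodMorphism.Build L (laurent L) cst_coefs cst_coefs_zmod_morphism.
HB.instance Definition _ := GRing.isMonoidMorphism.Build L (laurent L) cst_coefs cst_coefs_monoid_morphism.

Lemma cst_coefs_bounded : sn_bounded cst_coefs.
Proof.
move=> [[i k] l]; exists ((i, l) : sn_index L), (2 ^+ k); split; first by rewrite exprn_ge0.
move=> x; apply: (@laurent_sn_le _ (laurent A) ((i, k), l)) => n /=.
apply: le_trans (ler_wpM2r _ (sn_cstw i k _)) _; first by rewrite exprn_ge0.
by rewrite -mulrA ler_wpM2l ?exprn_ge0//; exact: (laurent_snP (i, l)).
Qed.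

End Constants.

(** * Multiplication matrices *)

Section Multiplication.
Variables (R : realType) (C : cspRingType R).
Implicit Types (a b : laurent C) (om : C).

Lemma decaying_Umx a : decaying (Umx a).
Proof.
move=> i k; have /rapidP/(_ i k)[c [c0 cP]] := laurentP a.
by exists c; split=> // n m; exact: cP.
Qed.

Definition Um a : lmat C := mk_lmat (decaying_Umx a).

Lemma UmE a n m : Um a n m = a (n - m). Proof. by []. Qed.

Lemma Um1 : Um 1 = 1.
Proof. by apply: lmat_ext => n m; rewrite UmE lmat1 coef_laurent1 subr_eq0. Qed.

Lemma UmM a b : Um (a * b) = Um a * Um b.
Proof.
apply: lmat_ext => n m; rewrite UmE.
have h : bijective (fun k : int => n - k) by exists (fun k : int => n - k) => k; rewrite subKr.
apply: (sums_to_unique (sums_to_bij h (coef_laurentM_cvg a b (n - m)))).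
apply: eq_sums_to (lmatM_cvg (Um a) (Um b) n m) => k /=.
by rewrite /Umx; congr (_ * b _); ring.
Qed.

Lemma Um_comm a b : Um a * Um b = Um b * Um a.
Proof. by rewrite -!UmM mulrC. Qed.

(** [th om'] and [thr om] identify the nonzero integers with all integers by
  closing the gap at 0, up to the scalings by which the twisted matrix differs
  from the plain one. When [om * om' = 1], they are inverse to each other up to
  the elementary matrix [e00]. *)
Definition e00_mat : mat C := fun n m => ((n == 0) && (m == 0))%:R.
Definition th_mat om' : mat C := fun n m =>
  if n < 0 then (m == n)%:R else if 0 < n then (if m == n - 1 then - om' else 0) else 0.
Definition thr_mat om : mat C := fun m n =>
  if m < 0 then (n == m)%:R else (if n == m + 1 then - om else 0).

Lemma decaying_e00 : decaying e00_mat.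
Proof.
apply: (@decaying_banded _ _ 0 [:: 0; 1]) => n m; rewrite /e00_mat.
  by case: eqP => [->|//]; case: eqP => [->|]; rewrite ?subrr.
by rewrite !inE; case: (_ && _); rewrite /= ?eqxx ?orbT.
Qed.

Lemma decaying_th om' : decaying (th_mat om').
Proof.
apply: (@decaying_banded _ _ 1 [:: 0; 1; - om']) => n m; rewrite /th_mat.
  by move=> nm; do 3?case: ifP => //; case: eqP => // *; exfalso; lia.
by do 3?case: ifP => _; try case: (_ == _); rewrite /= !inE ?eqxx ?orbT.
Qed.

Lemma decaying_thr om : decaying (thr_mat om).
Proof.
apply: (@decaying_banded _ _ 1 [:: 0; 1; - om]) => n m; rewrite /thr_mat.
  by move=> nm; do 2?case: ifP => //; case: eqP => // *; exfalso; lia.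
by do 2?case: ifP => _; try case: (_ == _); rewrite /= !inE ?eqxx ?orbT.
Qed.

Definition e00 : lmat C := mk_lmat decaying_e00.
Definition th om' : lmat C := mk_lmat (decaying_th om').
Definition thr om : lmat C := mk_lmat (decaying_thr om).

Lemma e00M X n m : (e00 * X) n m = if n == 0 then X 0 m else 0.
Proof.
rewrite (lmatM_single (k := 0)) /= /e00_mat; last by move=> l /negbTE ->; rewrite andbF mul0r.
by rewrite andbT; case: ifP; rewrite ?mul1r ?mul0r.
Qed.

Lemma Me00 X n m : (X * e00) n m = if m == 0 then X n 0 else 0.
Proof.
rewrite (lmatM_single (k := 0)) /= /e00_mat; last by move=> l /negbTE ->; rewrite mulr0.
by rewrite eqxx /=; case: ifP; rewrite ?mulr1 ?mulr0.
Qed.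

Lemma thM om' X n m : (th om' * X) n m =
  if n < 0 then X n m else if 0 < n then - om' * X (n - 1) m else 0.
Proof.
rewrite (lmatM_single (k := if n < 0 then n else n - 1)) /= /th_mat => [|l].
  by case: (ltgtP n 0) => _; rewrite ?eqxx ?mul1r ?mul0r.
by do 2?case: ifP => // _; rewrite ?mul0r// => /negbTE ->; rewrite mul0r.
Qed.

Lemma Mthr om X n m : (X * thr om) n m =
  if m < 0 then X n m else if 0 < m then - om * X n (m - 1) else 0.
Proof.
rewrite (lmatM_single (k := if m < 0 then m else m - 1)) /= /thr_mat => [|l].
  case: (ltgtP m 0) => [m0|m0|->]; first by rewrite m0 eqxx mulr1.
    by rewrite ifN ?subrK ?eqxx 1?mulrC//; lia.
  by rewrite /= mulr0.
case: (ltgtP m 0) => [m0|m0|->] lm; case: (ltP l 0) => l0; (case: eqP => [ml|_]; last by rewrite mulr0);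
  by exfalso; move: lm => /eqP; apply; lia.
Qed.

Lemma thr_th om om' : om * om' = 1 -> thr om * th om' = 1.
Proof.
move=> oo; apply: lmat_ext => n m; rewrite lmat1.
rewrite (lmatM_single (k := if n < 0 then n else n + 1)) /= /thr_mat /th_mat => [|l].
  case: (ltP n 0) => n0; first by rewrite eqxx mul1r eq_sym n0.
  rewrite eqxx ifN; last by lia.
  rewrite ifT; last by lia.
  rewrite addrK eq_sym; case: ifP => _; last by rewrite mulr0.
  by rewrite mulrNN oo.
by case: ifP => n0 /negbTE ->; rewrite mul0r.
Qed.

Lemma th_thr om om' : om * om' = 1 -> th om' * thr om = 1 - e00.
Proof.
move=> oo; apply: lmat_ext => n m; rewrite thM lmatB lmat1 /= /thr_mat /e00_mat.
case: (ltgtP n 0) => n0 /=.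
- by rewrite subr0 eq_sym.
- rewrite subr0 ifN; last by lia.
  by rewrite subrK eq_sym; case: ifP; rewrite ?mulr0// mulrNN mulrC oo.
- by rewrite n0 eq_sym; case: eqP; rewrite subrr.
Qed.

Lemma e00_th om' : e00 * th om' = 0.
Proof. by apply: lmat_ext => n m; rewrite e00M lmat0 /= /th_mat ltxx; case: ifP. Qed.

Lemma thr_e00 om : thr om * e00 = 0.
Proof.
apply: lmat_ext => n m; rewrite Me00 lmat0 /= /thr_mat; case: ifP => // _.
by case: ifP => n0; case: eqP => // h; exfalso; lia.
Qed.

Lemma e00e00 : e00 * e00 = e00.
Proof.
apply: lmat_ext => n m; rewrite e00M /= /e00_mat eqxx.
by case: (n == 0).
Qed.

(** Conjugation by [th], completed by 1 at the index 0. This is the twisted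
  matrix, see [UtE]; multiplicativity in [a] is visible in this form. *)
Definition Ut om om' a : lmat C := th om' * Um a * thr om + e00.

Lemma UtM om om' a b : om * om' = 1 -> Ut om om' a * Ut om om' b = Ut om om' (a * b).
Proof.
move=> oo; rewrite /Ut mulrDl !mulrDr e00e00 -!mulrA thr_e00 !mulr0 addr0.
rewrite [e00 * _]mulrA e00_th mul0r add0r; congr (_ + _).
by rewrite UmM !mulrA -[_ * thr om * th om']mulrA (thr_th oo) mulr1.
Qed.

Lemma Ut1 om om' : om * om' = 1 -> Ut om om' 1 = 1.
Proof. by move=> oo; rewrite /Ut Um1 mulr1 (th_thr oo) subrK. Qed.

Lemma Ut_th om om' a : om * om' = 1 -> Ut om om' a * th om' = th om' * Um a.
Proof. by move=> oo; rewrite /Ut mulrDl e00_th addr0 -mulrA (thr_th oo) mulr1. Qed.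

Lemma e00_Ut om om' a : e00 * Ut om om' a = e00.
Proof. by rewrite /Ut mulrDr !mulrA e00_th !mul0r add0r e00e00. Qed.

Lemma UtE om om' a n m : om * om' = 1 -> Ut om om' a n m =
  if ((0 < n) && (0 < m)) || ((n < 0) && (m < 0)) then a (n - m)
  else if (n < 0) && (0 < m) then - om * a (n - m + 1)
  else if (m < 0) && (0 < n) then - om' * a (n - m - 1)
  else if (n == 0) && (m == 0) then 1
  else 0.
Proof.
move=> oo; rewrite lmatD Mthr !thM !UmE /= /e00_mat.
case: (ltgtP n 0) => n0 /=; case: (ltgtP m 0) => m0 /=; rewrite ?addr0 ?add0r ?mulr0//.
- by congr (_ * a _); ring.
- by congr (_ * a _); ring.
- by rewrite mulrA mulrNN oo mul1r; congr (a _); ring.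
Qed.

(** Outside the two diagonal blocks, [1 + |n| + |m|] is [1 + |n - m|] up to a
  shift by one, so a matrix with entries [a (n - m)] and its neighbours there
  decreases rapidly. *)
Lemma rapidm_coef a (r : seq C) (X : mat C) :
  (forall n m, X n m = 0 \/ exists c l, [/\ c \in r, X n m = c * a l
     & (absz n + absz m <= (absz l).+1)%N]) -> rapidm X.
Proof.
move=> Xa i k; have [j jP] := sn_mul i.
have /rapidP/(_ j (k + k)%N)[d [d0 dP]] := laurentP a.
pose s := \sum_(x <- r) sn j x.
have s0 : 0 <= s by apply: sumr_ge0 => *; exact: sn_ge0.
exists (s * (d * 2 ^+ (k + k))); split=> [|n m]; first by rewrite !mulr_ge0 ?exprn_ge0.
case: (Xa n m) => [->|[c [l [cr -> nml]]]]; first by rewrite sn0 mul0r !mulr_ge0 ?exprn_ge0.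
apply: le_trans (ler_wpM2r _ (jP _ _)) _; first by rewrite exprn_ge0 ?mulr_ge0.
rewrite -mulrA; apply: ler_pM; rewrite ?sn_ge0 ?mulr_ge0 ?sn_ge0 ?exprn_ge0 ?mulr_ge0//.
  rewrite /s; elim: r cr {Xa s s0} => // x r IH; rewrite inE big_cons => /orP[/eqP ->|xr].
    by rewrite lerDl; apply: sumr_ge0 => *; exact: sn_ge0.
  by apply: le_trans (IH xr) _; rewrite lerDr sn_ge0.
apply: le_trans (_ : sn j (a l) * (wt R l ^+ (k + k) * 2 ^+ (k + k)) <= _); last first.
  by rewrite mulrA ler_wpM2r ?exprn_ge0.
apply: ler_wpM2l; first exact: sn_ge0.
rewrite -exprMn exprD -exprMn; apply: lerXn2r; rewrite ?nnegrE ?mulr_ge0//.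
rewrite -!natrM ler_nat.
by move: nml; nia.
Qed.

Lemma rapidm_ext (X Y : mat C) : (forall n m, X n m = Y n m) -> rapidm X -> rapidm Y.
Proof. by move=> XY; rewrite (_ : Y = X)//; apply/funext => n; apply/funext => m. Qed.

Lemma rapidm_matD (X Y : mat C) : rapidm X -> rapidm Y -> rapidm (fun n m => X n m + Y n m).
Proof.
move=> Xr Yr; exact: (rapidmD (X := mk_lmat (decaying_rapidm Xr)) (Y := mk_lmat (decaying_rapidm Yr))).
Qed.

Lemma rapidm_e00 : rapidm e00_mat.
Proof.
move=> i k; exists (sn i 1); split=> [|n m]; first exact: sn_ge0.
rewrite /e00_mat; case: eqP => [->|_]; last by rewrite sn0 mul0r sn_ge0.
case: eqP => [->|_]; last by rewrite sn0 mul0r sn_ge0.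
by rewrite mulr1 expr1n mulr1.
Qed.

Lemma rapidm_Ut om om' a : om * om' = 1 -> rapidm (lent (Ut om om' a - Um a)).
Proof.
move=> oo; pose S (n m : int) := ((0 < n) && (0 < m)) || ((n < 0) && (m < 0)).
pose X1 n m := if S n m then 0 else - a (n - m).
pose X2 n m := if S n m then 0 else if (n < 0) && (0 < m) then - om * a (n - m + 1)
  else if (m < 0) && (0 < n) then - om' * a (n - m - 1) else 0.
apply: (@rapidm_ext (fun n m => (X1 n m + X2 n m) + e00_mat n m)).
  move=> n m; rewrite lmatB UtE// UmE /X1 /X2 /S /e00_mat.
  case: (ltgtP n 0) => n0; case: (ltgtP m 0) => m0 /=; rewrite ?addr0 ?add0r ?subrr ?sub0r//.
  - by rewrite addrC.
  - by rewrite addrC.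
  - by rewrite addrC.
apply: rapidm_matD; last exact: rapidm_e00.
apply: rapidm_matD.
- apply: (@rapidm_coef a [:: - 1]) => n m; rewrite /X1 /S; case: ifPn => nm; first by left.
  right; exists (- 1), (n - m); split; rewrite ?mem_head ?mulN1r//; move: nm; clear; lia.
- apply: (@rapidm_coef a [:: - om; - om']) => n m; rewrite /X2 /S; case: ifPn => nm; first by left.
  case: ifPn => nm'; first by right; exists (- om), (n - m + 1); split; rewrite ?mem_head//; move: nm'; clear; lia.
  case: ifPn => nm''; last by left.
  by right; exists (- om'), (n - m - 1); split; rewrite ?inE ?eqxx ?orbT//; move: nm''; clear; lia.
Qed.

End Multiplication.

(** * The perturbation of the multiplication matrix by one half-line factor *)

Section LaurentBasis.
Variables (R : realType) (A : cspRingType R).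
Local Notation L := (laurent A).

Lemma sums_to_lmono (f : L) : sums_to (fun k => lmono k (f k)) f.
Proof.
apply/sums_toP => -[i q] e e0.
pose c := sn ((i, q.+1) : sn_index L) f; have c0 : 0 <= c by exact: sn_ge0.
pose K := Num.bound (c / e); exists (win K) => J KJ.
have cE n : (f - \sum_(k <- J) lmono k (f k)) n = if n \in J then 0 else f n.
  rewrite coef_laurentB coef_laurent_sum; case: ifPn => nJ.
    rewrite (big_fsetD1 n)//= {1}/single eqxx big_seq big1 ?addr0 ?subrr// => k.
    by rewrite !inE eq_sym /single => /andP[/negbTE ->].
  rewrite big_seq big1 ?subr0// => k kJ; rewrite coef_lmono.
  by case: eqP => // nk; rewrite nk kJ in nJ.
apply: (@le_lt_trans _ _ (c / K.+1%:R)); last first.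
  rewrite ltr_pdivrMr// -ltr_pdivrMl// mulrC.
  by apply: (lt_le_trans (archi_boundP _)); rewrite ?divr_ge0 ?ler_nat// ltW.
apply: (laurent_sn_le (p := (i, q))) => n; rewrite cE /=; case: ifPn => nJ.
  by rewrite sn0 mul0r divr_ge0.
have Kn : (K < absz n)%N by rewrite ltnNge -in_win; apply: contra nJ; exact: fsubsetP.
rewrite ler_pdivlMr//; apply: le_trans (laurent_snP (i, q.+1) f n) => /=.
rewrite exprSr mulrA ler_wpM2l ?mulr_ge0 ?sn_ge0 ?exprn_ge0//.
by rewrite ler_nat; lia.
Qed.

Lemma sn_lmonoM (i : sn_index A) q m (f : L) :
  sn ((i, q) : sn_index L) (lmono m 1 * f) <= wt R m ^+ q * sn ((i, q) : sn_index L) f.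
Proof.
apply: (laurent_sn_le (p := (i, q))) => n; rewrite coef_lmonoM mul1r /=.
apply: (@le_trans _ _ (wt R m ^+ q * (sn i (f (n - m)) * (absz (n - m)).+2%:R ^+ q))).
  rewrite mulrCA; apply: ler_wpM2l; first exact: sn_ge0.
  rewrite -exprMn lerXn2r ?nnegrE ?mulr_ge0// -natrM ler_nat.
  by have : (absz n <= absz (n - m)%R + absz m)%N; [lia|nia].
by apply: ler_wpM2l; [exact: wtX_ge0|exact: (laurent_snP (i, q))].
Qed.

End LaurentBasis.
Arguments sums_to_lmono {R A} f.

(** The two half-line constructions are mirror images of each other; [p] is
  true for the one on negative indices, and [sgi p] is the direction in which
  it shifts. *)
Definition sgi (p : bool) : int := if p then 1 else -1.

Section Halfline.
Variables (R : realType) (A : cspRingType R) (p : bool).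
Local Notation L := (laurent A).
Local Notation s := (sgi p).
Implicit Types (a : L) (X Y : lmat L).

Lemma rapid_tail a d :
  rapid_seq (fun k : int => if 0 < s * k then a (d + k) else 0).
Proof.
apply/rapidP => i q; have /rapidP/(_ i q)[c [c0 cP]] := laurentP a.
exists (c * wt R d ^+ q); split=> [|k]; first by rewrite mulr_ge0 ?wtX_ge0.
case: ifP => _; last by rewrite sn0 mul0r mulr_ge0 ?wtX_ge0.
apply: le_trans (ler_wpM2r (wtX_ge0 R d q) (cP (d + k))).
rewrite -mulrA; apply: ler_wpM2l; first exact: sn_ge0.
rewrite -exprMn lerXn2r ?nnegrE ?mulr_ge0// -natrM ler_nat.
by have : (absz k <= absz (d + k)%R + absz d)%N; [lia|nia].
Qed.

(** The part of [a z^(-d)] with exponents in the direction [s], read in [w]. It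
  is the sum of the contributions of all powers of [N_mat] to an entry of the
  conjugated matrix. *)
Definition tail a d : L := mk_laurent (rapid_tail a d).

Lemma coef_tail a d k : tail a d k = if 0 < s * k then a (d + k) else 0.
Proof. by []. Qed.

Lemma tail_bound (i : sn_index A) q a K d : 0 <= s * d ->
  sn ((i, q) : sn_index L) (tail a d) * wt R d ^+ K <=
  2 ^+ q * sn ((i, (q + K)%N) : sn_index L) a.
Proof.
move=> sd; rewrite -ler_pdivlMr ?exprn_gt0//; apply: (laurent_sn_le (p := (i, q))) => k /=.
have a0 : 0 <= 2 ^+ q * sn ((i, (q + K)%N) : sn_index L) a.
  by rewrite mulr_ge0 ?sn_ge0 ?exprn_ge0.
rewrite ler_pdivlMr ?exprn_gt0//; case: ifP => sk; last by rewrite sn0 !mul0r.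
apply: (@le_trans _ _ (2 ^+ q * (sn i (a (d + k)) * (absz (d + k)%R).+2%:R ^+ (q + K)))); last first.
  by apply: ler_wpM2l; [rewrite exprn_ge0|exact: (laurent_snP (i, (q + K)%N))].
rewrite -mulrA [leRHS]mulrCA; apply: ler_wpM2l; first exact: sn_ge0.
rewrite exprD mulrA -exprMn.
have dk : absz (d + k) = (absz d + absz k)%N.
  by move: sd sk; case: (p) => /=; lia.
apply: ler_pM; rewrite ?exprn_ge0//; apply: lerXn2r; rewrite ?nnegrE ?mulr_ge0//.
  by rewrite -natrM ler_nat; lia.
by rewrite ler_nat; lia.
Qed.

(** [N_mat] is [w 1_(Z^-) U(z^-1)] for [p] true and [w^-1 1_(Z^+) U(z)] for [p]
  false. *)
Definition N_mat : mat L := fun n m =>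
  if (s * n < 0) && (m == n + s) then lmono s 1 else 0.

Lemma decaying_N : decaying N_mat.
Proof.
apply: (@decaying_banded _ _ 1 [:: 0; lmono s 1]) => n m; rewrite /N_mat.
  move=> nm; case: ifP => // /andP[_ /eqP mn]; exfalso.
  by move: mn nm; case: (p) => /=; lia.
by case: ifP; rewrite !inE eqxx ?orbT.
Qed.

Definition Nm : lmat L := mk_lmat decaying_N.
Definition Fm : lmat L := 1 - Nm.

Lemma NM X n m : (Nm * X) n m = if s * n < 0 then lmono s 1 * X (n + s) m else 0.
Proof.
rewrite (lmatM_single (k := n + s)) /= /N_mat => [|l /negbTE ->].
  by rewrite eqxx andbT; case: ifP; rewrite ?mul0r.
by rewrite andbF mul0r.
Qed.

Lemma MN X n m : (X * Nm) n m = if s * m <= 0 then lmono s 1 * X n (m - s) else 0.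
Proof.
rewrite (lmatM_single (k := m - s)) /= /N_mat => [|l lm].
  rewrite subrK eqxx andbT mulrC.
  have -> : (s * (m - s) < 0) = (s * m <= 0) by case: (p) => /=; lia.
  by case: ifP; rewrite ?mul0r.
case: ifP => [/andP[_ /eqP ml]|]; last by rewrite mulr0.
by move/negP: lm; rewrite ml addrK eqxx.
Qed.

Definition Rhalf_mat a : mat L := fun n m =>
  if (s * n < 0) && (0 < s * m) then - lmono s 1 * cstw (a (n + s - m))
  else if (0 <= s * n) && (s * m <= 0) then tail a (n - m) else 0.

(** The bound is linear in a seminorm of the series, which makes the
  determinants below continuous in it. *)
Lemma Rhalf_bound (i : sn_index L) K : exists (c : R) (j : sn_index L), 0 <= c /\
  forall a n m, sn i (Rhalf_mat a n m) * (wt R n * wt R m) ^+ K <= c * sn j a.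
Proof.
case: i => i q; exists (2 ^+ q * (2 ^+ q * 2 ^+ (K + K))), (i, (q + (K + K))%N).
split=> [|a n m]; first by rewrite !mulr_ge0 ?exprn_ge0.
pose j := (i, (q + (K + K))%N); rewrite -/j.
have j0 : 0 <= 2 ^+ q * (2 ^+ q * 2 ^+ (K + K)) * sn (j : sn_index L) a.
  by rewrite !mulr_ge0 ?sn_ge0 ?exprn_ge0.
rewrite /Rhalf_mat; case: ifPn => [nm|_]; last case: ifPn => [nm|_].
- set l := n + s - m; rewrite mulNr snN.
  have l1 : (absz n + absz m <= (absz l).+1)%N by rewrite /l; case: (p) nm => /=; lia.
  apply: le_trans (ler_wpM2r _ (sn_lmonoM i q s _)) _; first by rewrite exprn_ge0 ?mulr_ge0.
  have -> : wt R s = 2 by case: (p).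
  rewrite -!mulrA; apply: ler_wpM2l; first by rewrite exprn_ge0.
  apply: le_trans (ler_wpM2r _ (sn_cstw i q _)) _; first by rewrite exprn_ge0 ?mulr_ge0.
  rewrite -!mulrA; apply: ler_wpM2l; first by rewrite exprn_ge0.
  apply: (@le_trans _ _ (2 ^+ (K + K) * (sn i (a l) * (absz l).+2%:R ^+ (q + (K + K))))); last first.
    by apply: ler_wpM2l; [rewrite exprn_ge0|exact: (laurent_snP j)].
  rewrite [leRHS]mulrCA; apply: ler_wpM2l; first exact: sn_ge0.
  apply: (@le_trans _ _ (2 ^+ (K + K) * (absz l).+2%:R ^+ (K + K))); last first.
    apply: ler_wpM2l; first by rewrite exprn_ge0.
    by rewrite [in leRHS]exprD ler_peMl ?exprn_ge0// exprn_ege1// ler1n.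
  rewrite -exprMn [in leRHS]exprD -exprMn; apply: lerXn2r; rewrite ?nnegrE ?mulr_ge0//.
  by rewrite -!natrM ler_nat; move: l1; nia.
- have sd : 0 <= s * (n - m) by move: nm; case: (p) => /=; lia.
  apply: (@le_trans _ _ (2 ^+ q * sn (j : sn_index L) a)); last first.
    apply: ler_wpM2r; first exact: sn_ge0.
    by rewrite ler_peMr ?exprn_ge0// -exprD exprn_ege1// ler1n.
  apply: le_trans (tail_bound i q a (K + K) sd); apply: ler_wpM2l; first exact: sn_ge0.
  rewrite exprD -exprMn; apply: lerXn2r; rewrite ?nnegrE ?mulr_ge0// -!natrM ler_nat.
  have -> : absz (n - m) = (absz n + absz m)%N by move: nm; case: (p) => /=; lia.
  nia.
- by rewrite sn0 mul0r.
Qed.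

Lemma rapidm_Rhalf a : rapidm (Rhalf_mat a).
Proof.
move=> i K; have [c [j [c0 cP]]] := Rhalf_bound i K.
by exists (c * sn j a); split=> [|n m]; rewrite ?mulr_ge0 ?sn_ge0.
Qed.

Definition Rhalf a : lmat L := mk_lmat (decaying_rapidm (rapidm_Rhalf a)).
Lemma RhalfE a n m : Rhalf a n m = Rhalf_mat a n m. Proof. by []. Qed.

Definition Uhalf a : lmat L := Um (cst_coefs a) + Rhalf a.

Lemma UhalfE a n m : Uhalf a n m = cstw (a (n - m)) + Rhalf_mat a n m.
Proof. by []. Qed.

Lemma MF X n m : (X * Fm) n m = X n m - (if s * m <= 0 then lmono s 1 * X n (m - s) else 0).
Proof. by rewrite /Fm mulrBr mulr1 lmatB MN. Qed.

Lemma FM X n m : (Fm * X) n m = X n m - (if s * n < 0 then lmono s 1 * X (n + s) m else 0).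
Proof. by rewrite /Fm mulrBl mul1r lmatB NM. Qed.

(** The intertwining relation: formally [Uhalf a] is the conjugate of the
  multiplication matrix by [Fm]. *)
Lemma Uhalf_F a : Uhalf a * Fm = Fm * Um (cst_coefs a).
Proof.
apply: lmat_ext => n m; rewrite MF FM !UhalfE !UmE !coef_cst_coefs /Rhalf_mat.
have -> : n + s - m = n - (m - s) by ring.
rewrite -addrA; congr (_ + _).
case: (ltP (s * n) 0) => n0; case: (ltP 0 (s * m)) => m0; rewrite ?andTb ?andFb.
- by rewrite subr0 mulNr.
- have -> : (0 < s * (m - s)) = false by case: (p) m0 => /=; lia.
  by rewrite addr0 add0r.
- by rewrite subr0 oppr0.
have -> : (s * (m - s) <= 0) by case: (p) m0 n0 => /=; lia.
rewrite oppr0; apply: laurent_ext => k.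
rewrite coef_laurentB coef_laurent0 coef_lmonoM mul1r coef_laurentD !coef_tail.
rewrite /cstw coef_lmono.
case: (ltP 0 (s * k)) => k0; case: (ltP 0 (s * (k - s))) => k1.
- have -> : (k - s == 0) = false by case: (p) k0 k1 => /=; lia.
  by rewrite add0r; apply/eqP; rewrite subr_eq0; apply/eqP; congr (a _); ring.
- have ks : k = s by case: (p) k0 k1 => /=; lia.
  by rewrite ks subrr eqxx addr0; apply/eqP; rewrite subr_eq0; apply/eqP; congr (a _); ring.
- by exfalso; case: (p) k0 k1 => /=; lia.
- have -> : (k - s == 0) = false by case: (p) k0 k1 => /=; lia.
  by rewrite addr0 subrr.
Qed.

(** Division by [Fm] on the right: the column recursion is solved by a
  geometric sum running away from the origin, along which rapid decrease
  wins over the growth of the powers of the variable. *)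
Lemma div_F X : rapidm (lent X) -> exists2 Y, rapidm (lent Y) & Y * Fm = X.
Proof.
move=> Xr.
pose f n m k : L := if s * k <= s * m then lmono (m - k) 1 * X n k else 0.
have fb (i : sn_index L) K : exists c : R, 0 <= c /\ forall n m k, s * m <= 0 ->
    sn i (f n m k) <= c / (wt R n * wt R m) ^+ K * vt R k.
  case: i => i q; have [c [c0 cP]] := Xr ((i, q) : sn_index L) (q + (K + 2))%N.
  exists c; split=> // n m k m0; rewrite /f; case: ifP => km; last first.
    by rewrite sn0 mulr_ge0 ?vt_ge0// divr_ge0 ?exprn_ge0 ?mulr_ge0.
  rewrite -mulrA -invfM ler_pdivlMr ?mulr_gt0 ?exprn_gt0 ?mulr_gt0//.
  apply: le_trans (ler_wpM2r _ (sn_lmonoM i q (m - k) _)) _.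
    by rewrite mulr_ge0 ?exprn_ge0 ?mulr_ge0.
  apply: le_trans (cP n k); rewrite [X in X * _]mulrC -mulrA.
  apply: ler_wpM2l; first exact: sn_ge0.
  have [h1 h2] : (absz m <= absz k)%N /\ (absz (m - k) <= absz k)%N.
    by move: m0 km; case: (p) => /=; lia.
  have mk : wt R (m - k) <= wt R n * wt R k.
    apply: le_trans (_ : wt R k <= _); first by rewrite ler_nat.
    by rewrite ler_peMl// wt_ge1.
  rewrite !exprD; apply: ler_pM; rewrite ?mulr_ge0 ?exprn_ge0 ?mulr_ge0//.
    by apply: lerXn2r; rewrite ?nnegrE ?mulr_ge0.
  apply: ler_pM; rewrite ?mulr_ge0 ?exprn_ge0 ?mulr_ge0//; apply: lerXn2r; rewrite ?nnegrE ?mulr_ge0//.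
    by rewrite ler_wpM2l// ler_nat.
  by rewrite ler_peMl// wt_ge1.
have fs n m : s * m <= 0 -> sums_to (f n m) (lsum (f n m)).
  move=> m0; suff [l lP] : exists l, sums_to (f n m) l by rewrite (lsumE lP).
  apply: abs_summable_cvg => i; have [c [c0 cP]] := fb i 0%N.
  exists (c * 4) => J; apply: (@le_trans _ _ (\sum_(k <- J) c * vt R k)).
    by apply: ler_sum => k _; apply: le_trans (cP n m k m0) _; rewrite expr0 divr1.
  by rewrite -mulr_sumr ler_wpM2l ?sum_wt_le.
pose Y : mat L := fun n m => if s * m <= 0 then lsum (f n m) else X n m.
have Yr : rapidm Y.
  move=> i K; have [c [c0 cP]] := fb i K; have [d [d0 dP]] := Xr i K.
  exists (c * 4 + d); split=> [|n m]; first by rewrite addr_ge0 ?mulr_ge0.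
  rewrite /Y; case: ifP => m0; last first.
    by apply: le_trans (dP n m) _; rewrite lerDr mulr_ge0.
  apply: (@le_trans _ _ (c * 4)); last by rewrite lerDl.
  rewrite -ler_pdivlMr ?exprn_gt0 ?mulr_gt0// mulrAC.
  apply: (sums_to_sn_le4 (g := fun k => vt R k) (fs n m m0)).
  - by rewrite divr_ge0 ?exprn_ge0 ?mulr_ge0.
  - by move=> k; exact: cP.
  - exact: sum_wt_le.
exists (mk_lmat (decaying_rapidm Yr)); first exact: Yr.
apply: lmat_ext => n m; rewrite MF /= /Y; case: ifP => m0; last by rewrite subr0.
have m1 : s * (m - s) <= 0 by case: (p) m0 => /=; lia.
rewrite m1; apply/eqP; rewrite subr_eq; apply/eqP.
apply: (sums_to_unique (fs n m m0)).
have h := sums_toD (sums_to_delta (f := fun k => if k == m then X n m else 0) (t0 := m) _)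
  (sums_toM (lmono s 1) (fs n (m - s) m1)).
rewrite eqxx in h; apply: eq_sums_to (h _) => [k|k /negbTE -> //].
rewrite /f; case: eqVneq => [->|km].
  rewrite lexx subrr lmono0_1 mul1r ifF ?mulr0 ?addr0//.
  by case: (p) => /=; lia.
rewrite add0r.
have -> : (s * k <= s * (m - s)) = (s * k <= s * m).
  by move: km => /eqP; case: (p) => /=; lia.
case: ifP => _; last by rewrite mulr0.
by rewrite mulrA lmonoM mulr1; congr (lmono _ _ * _); ring.
Qed.

(** By the column recursion [X n m] is [w^(s j)] times [X n (m - s j)], which
  tends to 0 as [j] grows. *)
Lemma F_inj X : rapidm (lent X) -> X * Fm = 0 -> X = 0.
Proof.
move=> Xr XF.
have rec n m : X n m = if s * m <= 0 then lmono s 1 * X n (m - s) else 0.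
  have := congr1 (fun M : lmat L => M n m) XF; rewrite /= -[mulm _ _ _ _]/((X * Fm) n m) MF.
  by move/eqP; rewrite subr_eq0 => /eqP.
apply: lmat_ext => n m; rewrite lmat0; case: (leP (s * m) 0) => m0; last first.
  by rewrite rec leNgt m0.
have it (j : nat) : X n m = lmono (s * j%:Z) 1 * X n (m - s * j%:Z).
  elim: j => [|j IH]; first by rewrite mulr0 subr0 lmono0_1 mul1r.
  rewrite IH rec ifT; last by move: m0; case: (p) => /=; lia.
  rewrite mulrA lmonoM mulr1; congr (lmono _ _ * X _ _); rewrite (_ : j.+1%:Z = j%:Z + 1); ring.
apply: sn_eq0 => -[i q]; apply/eqP; rewrite eq_le sn_ge0 andbT.
have [c [c0 cP]] := Xr ((i, q) : sn_index L) q.+1.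
apply: (@ler_addharm _ _ 0 c 0%N) => j _; rewrite add0r (it j).
apply: le_trans (sn_lmonoM _ _ _ _) _; rewrite ler_pdivlMr// mulrAC mulrC.
apply: le_trans (cP n (m - s * j%:Z)); apply: ler_wpM2l; first exact: sn_ge0.
have h : (j <= absz (m - s * j%:Z)%R)%N by move: m0; case: (p) => /=; lia.
have h' : absz (s * j%:Z) = j by case: (p) => /=; lia.
rewrite h' exprSr; apply: ler_pM; rewrite ?exprn_ge0//.
  apply: lerXn2r; rewrite ?nnegrE ?mulr_ge0// -natrM ler_nat; nia.
by rewrite -natrM ler_nat; nia.
Qed.

End Halfline.

(** * Toeplitz inverses and the conjugated multiplication matrices *)

Section Toeplitz.
Variables (R : realType) (C : cspRingType R).

Lemma rapid_matP (X : mat C) : rapid_mat X <-> rapidm X.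
Proof.
split=> [/rapidP Xr i k|Xr]; last (apply/rapidP => i k).
  have [c [c0 cP]] := Xr i (k + k)%N; exists c; split=> // n m.
  apply: le_trans (cP (n, m)) => /=; apply: ler_wpM2l; first exact: sn_ge0.
  rewrite exprD -exprMn; apply: lerXn2r; rewrite ?nnegrE ?mulr_ge0// -!natrM ler_nat.
  nia.
have [c [c0 cP]] := Xr i k; exists c; split=> // -[n m] /=.
apply: le_trans (cP n m); apply: ler_wpM2l; first exact: sn_ge0.
by apply: lerXn2r; rewrite ?nnegrE ?mulr_ge0// -!natrM ler_nat; nia.
Qed.

Lemma corner_UmxE (S : pred int) (a : int -> C) n m :
  mulm (mulm (diag1 C S) (Umx a)) (diag1 C S) n m =
  if S n && S m then a (n - m) else 0.
Proof.
rewrite /mulm (lsum_single (t0 := m)) => [|k /negbTE km]; last first.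
  by rewrite /diag1 km mulr0.
rewrite (lsum_single (t0 := n)) => [|k /negbTE nk]; last first.
  by rewrite /diag1 eq_sym nk mul0r.
by rewrite /diag1 !eqxx /Umx; case: (S n); case: (S m); rewrite /= ?mul1r ?mulr1 ?mul0r ?mulr0.
Qed.

Lemma decaying_toeplitz (M : mat C) : toeplitz M -> decaying M.
Proof.
move=> [an [ap [N [anr apr Nr ME]]]].
have cornerd (S : pred int) (a : int -> C) : rapid_seq a ->
    decaying (fun n m => if S n && S m then a (n - m) else 0).
  move=> /rapidP ar i k; have [c [c0 cP]] := ar i k; exists c; split=> // n m.
  by case: ifP => _; [exact: cP|rewrite sn0 mul0r].
have -> : M = fun n m => (if neg_int n && neg_int m then an (n - m) else 0) +
    (if pos_int n && pos_int m then ap (n - m) else 0) + N n m.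
  by apply/funext => n; apply/funext => m; rewrite ME !corner_UmxE.
apply: decayingD; last exact/decaying_rapidm/rapid_matP.
by apply: decayingD; exact: cornerd.
Qed.

Lemma toeplitz_UmD (a : laurent C) (X : lmat C) : rapidm (lent X) ->
  toeplitz (lent (Um a + X)).
Proof.
move=> Xr; pose S (n m : int) := ((n < 0) && (m < 0)) || ((0 < n) && (0 < m)).
exists a, a, (fun n m => (if S n m then 0 else a (n - m)) + X n m); split.
- exact: laurentP.
- exact: laurentP.
- apply/rapid_matP/rapidm_matD => //.
  apply: (@rapidm_coef _ _ a [:: 1]) => n m; rewrite /S; case: ifPn => nm; first by left.
  by right; exists 1, (n - m); split; rewrite ?mem_head ?mul1r//; move: nm; clear; lia.
- move=> n m; rewrite !corner_UmxE lmatD UmE /S /neg_int /pos_int addrA; congr (_ + _).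
  by case: (ltgtP n 0) => n0; case: (ltgtP m 0) => m0 /=; rewrite ?addr0 ?add0r.
Qed.

(** Uniqueness of inverses in the ring of decaying matrices identifies the
  chosen inverse. *)
Lemma toeplitz_invE (M N : lmat C) : toeplitz (lent N) -> M * N = 1 -> N * M = 1 ->
  toeplitz_inv (lent M) = lent N.
Proof.
move=> Nt MN NM; rewrite /toeplitz_inv; case: xgetP => [N' _ [N't [MN' N'M]]|].
  pose N1 := mk_lmat (decaying_toeplitz N't).
  suff -> : N = N1 by [].
  have h : N1 * M = 1 by apply: val_inj.
  by rewrite -[N1]mulr1 -MN mulrA h mul1r.
move=> /(_ (lent N)) []; split=> //.
by split; rewrite -lent_mul ?MN ?NM.
Qed.

End Toeplitz.

Section Conjugation.
Variables (R : realType) (A : cspRingType R) (p : bool).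
Local Notation L := (laurent A).
Local Notation s := (sgi p).
Local Notation F := (one_sub_t (@N_mat R A p)).
Implicit Types (Q : nat -> mat L).

Lemma mulm0l (M : mat L) n m : mulm (fun _ _ => 0) M n m = 0.
Proof. by rewrite /mulm (lsum_single (t0 := 0)) => [|k _]; rewrite mul0r. Qed.

Lemma mulm0r (M : mat L) n m : mulm M (fun _ _ => 0) n m = 0.
Proof. by rewrite /mulm (lsum_single (t0 := 0)) => [|k _]; rewrite mulr0. Qed.

Lemma mulm_Nl (M : mat L) n m : mulm (fun n m => - @N_mat R A p n m) M n m =
  - (if s * n < 0 then lmono s 1 * M (n + s) m else 0).
Proof.
rewrite /mulm (lsum_single (t0 := n + s)) /N_mat => [|k /negbTE ->].
  by rewrite eqxx andbT mulNr; case: ifP; rewrite ?mul0r.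
by rewrite andbF oppr0 mul0r.
Qed.

Lemma mulm_Nr (M : mat L) n m : mulm M (fun n m => - @N_mat R A p n m) n m =
  - (if s * m <= 0 then lmono s 1 * M n (m - s) else 0).
Proof.
rewrite /mulm (lsum_single (t0 := m - s)) /N_mat => [|k km].
  rewrite subrK eqxx andbT mulrN mulrC.
  have -> : (s * (m - s) < 0) = (s * m <= 0) by case: (p) => /=; lia.
  by case: ifP; rewrite ?mul0r.
case: ifP => [/andP[_ /eqP mk]|]; last by rewrite oppr0 mulr0.
by move/negP: km; rewrite mk addrK eqxx.
Qed.

Lemma mulpm_Fl Q d n m : mulpm F Q d n m = Q d n m -
  (if d is d'.+1 then (if s * n < 0 then lmono s 1 * Q d' (n + s) m else 0) else 0).
Proof.
case: d => [|d]; rewrite /mulpm.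
  by rewrite big_ord_recl big_ord0 addr0 subr0 -[F _]/(mat1 L) mul1m.
rewrite !big_ord_recl big1 ?addr0 => [|k _]; last exact: mulm0l.
by rewrite -[F _]/(mat1 L) mul1m; congr (_ + _); rewrite -mulm_Nl /= subSS subn0.
Qed.

Lemma mulpm_Fr Q d n m : mulpm Q F d n m = Q d n m -
  (if d is d'.+1 then (if s * m <= 0 then lmono s 1 * Q d' n (m - s) else 0) else 0).
Proof.
case: d => [|d]; rewrite /mulpm.
  by rewrite big_ord_recl big_ord0 addr0 subr0 -[F _]/(mat1 L) mulm1.
rewrite !big_ord_recr big1 ?add0r => [|k _] /=.
  by rewrite add0r subnn subSnn -mulm_Nr addrC -[F 0%N]/(mat1 L) mulm1.
have -> : (d.+1 - k = (d - k).-1.+2)%N by have := ltn_ord k; lia.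
exact: mulm0r.
Qed.

(** The power [N ^+ d] in closed form. All [d] steps from [n] to [m] must start
  in the half-line; the last one starts at [m - s], which is the condition
  [s * m <= 0]. *)
Definition geom (d : nat) : mat L := fun n m =>
  if (m == n + s * d%:Z) && ((d == 0%N) || (s * m <= 0)) then lmono (s * d%:Z) 1 else 0.

Lemma geom0 : geom 0 = mat1 L.
Proof.
apply/funext => n; apply/funext => m; rewrite /geom /mat1 /diag1 mulr0 addr0 !andbT eq_sym.
by case: ifP.
Qed.

Lemma geomSr d n m : geom d.+1 n m = if s * m <= 0 then lmono s 1 * geom d n (m - s) else 0.
Proof.
rewrite /geom; case: ifP => [/andP[/eqP -> /= m0]|nm].
  rewrite m0 ifT ?lmonoM ?mulr1; first by congr (lmono _ _); case: (p) => /=; lia.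
  by move: m0; case: (p) => /=; case: d => [|d]; lia.
case: ifP => // m0; rewrite ifF ?mulr0//; apply: contraFF nm => /andP[/eqP mE _].
by rewrite m0 orbT andbT; apply/eqP; case: (p) mE => /=; lia.
Qed.

Lemma geomSl d n m : geom d.+1 n m = if s * n < 0 then lmono s 1 * geom d (n + s) m else 0.
Proof.
rewrite /geom; case: ifP => [/andP[/eqP -> /= m0]|nm].
  rewrite ifT; last by case: (p) m0 => /=; lia.
  rewrite ifT ?lmonoM ?mulr1; first by congr (lmono _ _); case: (p) => /=; lia.
  by rewrite m0 orbT andbT; apply/eqP; case: (p) => /=; lia.
case: ifP => // n0; rewrite ifF ?mulr0//; apply: contraFF nm => /andP[/eqP mE h].
by move: mE h n0; case: (p) => /=; case: d => [|d]; lia.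
Qed.

Lemma invpm_F : invpm F = geom.
Proof.
rewrite /invpm; case: xgetP => [Q _ [_ QF]|].
  apply/funext; elim=> [|d IH]; apply/funext => n; apply/funext => m.
    have := congr1 (fun P => P 0%N n m) QF.
    by rewrite mulpm_Fr subr0 => ->; rewrite geom0.
  have := congr1 (fun P => P d.+1 n m) QF; rewrite mulpm_Fr geomSr IH.
  by rewrite /constpm /= => /eqP; rewrite subr_eq0 => /eqP.
move=> /(_ geom) []; split; apply/funext => -[|d]; apply/funext => n; apply/funext => m.
- by rewrite mulpm_Fl subr0 geom0.
- by rewrite mulpm_Fl geomSl subrr.
- by rewrite mulpm_Fr subr0 geom0.
- by rewrite mulpm_Fr geomSr subrr.
Qed.

Lemma mulm_geom (M : mat L) e n m : mulm M (geom e) n m =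
  if (e == 0%N) || (s * m <= 0) then M n (m - s * e%:Z) * lmono (s * e%:Z) 1 else 0.
Proof.
rewrite /mulm (lsum_single (t0 := m - s * e%:Z)) /geom => [|k km].
  by rewrite subrK eqxx /=; case: ifP; rewrite ?mulr0.
case: ifP => [/andP[/eqP mk _]|]; last by rewrite mulr0.
by move/negP: km; rewrite mk addrK eqxx.
Qed.

Lemma mulpm_Fconst (M : mat L) d : mulpm F (constpm M) d.+2 = fun _ _ => 0.
Proof.
by apply/funext => n; apply/funext => m; rewrite mulpm_Fl /constpm /= mulr0 if_same subr0.
Qed.

(** The entry [(n, m)] of the coefficient of [t ^+ d] in [F U(z^k) F^-1] is a
  monomial: the first summand comes from [U N^d], the second from
  [N U N^(d-1)]. *)
Definition conj_coef (n m : int) (d : nat) : A :=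
  ((d == 0%N) || (s * m <= 0))%:R -
  [&& (0 < d)%N, s * n < 0 & (d == 1%N) || (s * m <= 0)]%:R.

Lemma lmono_natr l (b : bool) : (if b then lmono l 1 else 0) = lmono l b%:R :> L.
Proof. by case: b => //; apply: laurent_ext => k; rewrite coef_lmono; case: ifP. Qed.

Lemma lmonoD l (x y : A) : lmono l x + lmono l y = lmono l (x + y).
Proof.
by apply: laurent_ext => k; rewrite coef_laurentD !coef_lmono; case: ifP; rewrite ?addr0.
Qed.

Lemma lmonoN l (x : A) : - lmono l x = lmono l (- x).
Proof. by apply: laurent_ext => k; rewrite coef_laurentN !coef_lmono; case: ifP; rewrite ?oppr0. Qed.

Lemma lmono0 l : lmono l 0 = 0 :> L.
Proof. by apply: laurent_ext => k; rewrite coef_lmono; case: ifP. Qed.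

Lemma Uz_zpow k n m : Uz (zpow A k) n m = (k == n - m)%:R.
Proof.
rewrite /Uz /Umx /zpow coef_lmono eq_sym; case: eqP => _; rewrite /cstw ?lmono0//.
Qed.

Lemma conjpm_zpow k d n m : conjpm F (zpow A k) d n m =
  if k == n - m + s * d%:Z then lmono (s * d%:Z) (conj_coef n m d) else 0.
Proof.
rewrite /conjpm invpm_F; set P := mulpm F _; rewrite /mulpm.
case: d => [|d].
  rewrite big_ord_recl big_ord0 addr0 /= mulm_geom /= /P mulpm_Fl subr0 /constpm /=.
  rewrite Uz_zpow mulr0 subr0 addr0 /conj_coef /= subr0 mulr1.
  by case: eqP.
rewrite !big_ord_recl big1 ?addr0 => [|j _]; last by rewrite /P mulpm_Fconst mulm0l.
rewrite /= !mulm_geom /P !mulpm_Fl /constpm /= subr0 sub0r subSS !subn0 !Uz_zpow.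
have -> : n - (m - s * d.+1%:Z) = n - m + s * d.+1%:Z by ring.
have -> : n + s - (m - s * d%:Z) = n - m + s * d.+1%:Z.
  by rewrite (_ : d.+1%:Z = d%:Z + 1); [ring|lia].
case: eqP => _; last by rewrite !mul0r !mulr0 !if_same oppr0 mul0r !if_same addr0.
rewrite mul1r mulr1 lmono_natr /conj_coef -lmonoD -lmonoN; congr (_ + _).
rewrite /= eqSS; case: (s * n < 0) => /=; last by rewrite oppr0 mul0r if_same lmono0 oppr0.
rewrite mulNr lmonoM mulr1.
have -> : s + s * d%:Z = s * d.+1%:Z by rewrite (_ : d.+1%:Z = d%:Z + 1); [ring|lia].
by rewrite -lmono_natr; case: ifP; rewrite ?oppr0.
Qed.

Lemma coef_Rhalf (a : L) n m l : Rhalf p a n m l =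
  if (s * n < 0) && (0 < s * m) then (if l == s then - a (n + s - m) else 0)
  else if (0 <= s * n) && (s * m <= 0) then (if 0 < s * l then a (n - m + l) else 0)
  else 0.
Proof.
rewrite -[Rhalf p a n m]/(Rhalf_mat p a n m) /Rhalf_mat; case: ifP => _; last first.
  by case: ifP => _; rewrite ?coef_tail ?coef_laurent0.
rewrite mulNr coef_laurentN coef_lmonoM mul1r /cstw coef_lmono subr_eq0.
by case: ifP; rewrite ?oppr0.
Qed.

(** Setting [t = 1] sums the monomials. For positive [d] the two contributions
  cancel outside the two blocks on which [Rhalf_mat] is nonzero. *)
Lemma conjpm1E a : conjpm1 F a = lent (Uhalf p a).
Proof.
apply/funext => n; apply/funext => m; rewrite /conjpm1.
have sumd k : lsum (fun d : nat => conjpm F (zpow A k) d n m) =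
    if 0 <= s * (k - (n - m)) then lmono (k - (n - m)) (conj_coef n m (absz (k - (n - m))%R)) else 0.
  rewrite (lsum_single (t0 := absz (k - (n - m))%R)) => [|d dk]; rewrite conjpm_zpow.
    case: (leP 0 (s * (k - (n - m)))) => k0; last by rewrite ifF//; case: (p) k0 => /=; lia.
    have E : s * (absz (k - (n - m))%R)%:Z = k - (n - m) by case: (p) k0 => /=; lia.
    by rewrite E ifT// addrC subrK.
  by rewrite ifF//; apply: contraNF dk => /eqP ->; apply/eqP; case: (p) => /=; lia.
under eq_fun do rewrite sumd.
apply: lsumE; set f := Uhalf p a n m.
have h : bijective (fun k : int => k - (n - m)).
  by exists (fun k => k + (n - m)) => k; rewrite ?subrK ?addrK.
apply: eq_sums_to (sums_to_bij h (sums_to_lmono f)) => k.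
rewrite -[LHS]/(lmono (k - (n - m)) (f (k - (n - m)))).
set l := k - (n - m); have kE : k = n - m + l by rewrite /l; ring.
have -> : f l = if 0 <= s * l then a (n - m + l) * conj_coef n m (absz l) else 0.
  rewrite /f lmatD coef_laurentD UmE coef_cst_coefs coef_Rhalf /cstw coef_lmono /conj_coef.
  case: (ltgtP 0 (s * l)) => l0.
  - rewrite ifF; last by case: (p) l0 => /=; lia.
    have l1 : (absz l == 0%N) = false by case: (p) l0 => /=; lia.
    rewrite l1 (_ : (0 < absz l)%N); last by lia.
    case: (ltP (s * n) 0) => n0; case: (ltP 0 (s * m)) => m0 /=.
    + rewrite orbF add0r sub0r; case: eqP => [ls|ls].
        rewrite (_ : (absz l == 1)%N = true); last by case: (p) l0 ls => /=; lia.
        by rewrite mulrN mulr1; congr (- a _); case: (p) l0 ls => /=; lia.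
      rewrite (_ : (absz l == 1)%N = false) ?oppr0 ?mulr0//.
      by case: (p) l0 ls => /=; lia.
    + by rewrite orbT subrr mulr0 addr0.
    + by rewrite subrr mulr0 addr0.
    + by rewrite add0r subr0 mulr1.
  - rewrite ifF; last by case: (p) l0 => /=; lia.
    rewrite add0r; case: ifP => _; last by rewrite if_same.
    by rewrite ifF//; case: (p) l0 => /=; lia.
  have -> : l = 0 by case: (p) l0 => /=; lia.
  rewrite eqxx if_same (_ : (0 == s) = false); last by case: (p).
  by rewrite !if_same !addr0 /= subr0; apply/esym/mulr1.
rewrite kE; case: ifP => _; last by rewrite mulr0 lmono0.
by rewrite /cstw lmonoM add0r.
Qed.

End Conjugation.

(** * The factorization *)

Lemma oneD_mul (B : pzRingType) (x y : B) :
  1 + (x + y + x * y) = (1 + x) * (1 + y).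
Proof.
by rewrite mulrDl !mulrDr !mul1r mulr1 -!addrA; congr (_ + _); rewrite addrCA.
Qed.

Lemma fdetMD (R : realType) (C : cspRingType R) (X Y Z : lmat C) :
  rapidm (lent X) -> rapidm (lent Y) -> 1 + Z = (1 + X) * (1 + Y) ->
  fdet Z = fdet X * fdet Y.
Proof.
move=> Xr Yr ZE; rewrite -(fdetM Xr Yr); congr fdet; apply: (addrI 1).
by rewrite ZE oneD_mul.
Qed.

Section HalflineAlgebra.
Variables (B : pzRingType) (U V W F F' T z : B).
Hypotheses (UV : U * V = 1) (VU : V * U = 1) (Uz : U * z = z * U).

(** The two conjugations, one after the other: [1 + F' S] is the conjugate by
  [F'] of [1 + R V], without inverting [F']. *)
Lemma intertwine_product S R R' : (U + R') * F' = F' * U -> S * F' = R * V ->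
  (U + R) * F = F * U ->
  (1 + F' * S) * (1 + R' * V) * U * (F' * F) = F' * F * U.
Proof.
move=> R'F SF RF.
have h1 : (1 + R' * V) * U = U + R' by rewrite mulrDl mul1r -mulrA VU mulr1.
have h2 : (1 + F' * S) * F' = F' * (1 + R * V).
  by rewrite mulrDl mulrDr mul1r mulr1 -mulrA SF.
have h3 : (1 + R * V) * U = U + R by rewrite mulrDl mul1r -mulrA VU mulr1.
rewrite -[_ * _ * U]mulrA h1 mulrA -[_ * _ * F']mulrA R'F mulrA h2.
by rewrite -[F' * _ * U]mulrA h3 -mulrA RF mulrA.
Qed.

Lemma quotient_difference X G rho : (1 + X) * U * (z * T) = z * W * T ->
  G * z = W - U - rho -> rho * T = 0 ->
  (X - z * (G * V)) * U * (z * T) = 0.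
Proof.
move=> XH GE rT; have -> : X - z * (G * V) = (1 + X) - 1 - z * (G * V).
  by rewrite [1 + X]addrC addrK.
have h : z * (G * V) * U * (z * T) = z * ((W - U - rho) * T).
  by rewrite -GE -!mulrA [V * (U * (z * T))]mulrA VU mul1r.
have h' : U * (z * T) = z * (U * T) by rewrite mulrA Uz mulrA.
by rewrite !mulrBl XH mul1r h h' !mulrBl rT subr0 mulrBr -mulrA subrr.
Qed.

(** Isolates [W' rho], which has a single nonzero column because [rho] has. *)
Lemma determinant_split rho W' : W * W' = 1 ->
  1 + (W - U - rho) * V = (1 + (W - U) * V) * (1 + U * - (W' * rho) * V).
Proof.
move=> WW'; have -> : 1 + (W - U) * V = W * V by rewrite mulrBl UV addrC subrK.
rewrite mulrDr mulr1 mulrN mulNr mulrN -[W * V * _]mulrA [V * (U * _ * V)]mulrA.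
rewrite [V * (U * _)]mulrA VU mul1r 2!mulrA WW' mul1r.
by rewrite mulrBl addrA mulrBl UV addrC [1 + _]addrC subrK addrC.
Qed.

End HalflineAlgebra.

Section EvaluationAtW.
Variables (R : realType) (A : cspRingType R).
Local Notation L := (laurent A).
Implicit Types (X : lmat L).

(** Multiplication by [1 - w / z]. It annihilates the column of entries
  [w^(- m)], hence the rows of a product [X * zw] vanish when they are paired
  with that column; this pairing is evaluation at [z = w]. *)
Definition zw : lmat L := Um (1 - lmono (-1) (lmono 1 1)).

Lemma MUm_lmono X l c n m : (X * Um (lmono l c)) n m = X n (m + l) * c.
Proof.
rewrite (lmatM_single (k := m + l)) => [|k].
  by rewrite UmE coef_lmono addrAC subrr add0r eqxx.
by rewrite UmE coef_lmono subr_eq [l + m]addrC => /negbTE ->; rewrite mulr0.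
Qed.

Lemma UmM_lmono X l c n m : (Um (lmono l c) * X) n m = c * X (n - l) m.
Proof.
rewrite (lmatM_single (k := n - l)) => [|k].
  by rewrite UmE coef_lmono opprB addrC subrK eqxx.
rewrite UmE coef_lmono => kn; rewrite ifF ?mul0r//.
by apply: contraNF kn => /eqP <-; rewrite opprB addrC subrK.
Qed.

Lemma zwE : zw = 1 - Um (lmono (-1) (lmono 1 1)).
Proof. by apply: lmat_ext => n m; rewrite lmatB -{1}Um1 !UmE. Qed.

Lemma Mzw X n m : (X * zw) n m = X n m - lmono 1 1 * X n (m - 1).
Proof. by rewrite zwE mulrBr mulr1 lmatB MUm_lmono mulrC. Qed.

Lemma zwM X n m : (zw * X) n m = X n m - lmono 1 1 * X (n + 1) m.
Proof. by rewrite zwE mulrBl mul1r lmatB UmM_lmono opprK. Qed.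

Lemma row_eval_cvg X n : rapidm (lent X) ->
  exists g, sums_to (fun m => lmono (- m) 1 * X n m) g.
Proof.
move=> Xr; apply: abs_summable_cvg => -[i q].
have [c [c0 cP]] := Xr ((i, q) : sn_index L) (q + 2)%N; exists (c * 4) => J.
apply: (@le_trans _ _ (\sum_(m <- J) c * vt R m)); last first.
  by rewrite -mulr_sumr ler_wpM2l ?sum_wt_le.
apply: ler_sum => m _; apply: le_trans (sn_lmonoM i q (- m) _) _.
rewrite ler_pdivlMr ?exprn_gt0// abszN mulrAC mulrC.
apply: le_trans (cP n m); apply: ler_wpM2l; first exact: sn_ge0.
rewrite -exprD; apply: lerXn2r; rewrite ?nnegrE ?mulr_ge0//.
by rewrite ler_peMl// wt_ge1.
Qed.

Lemma row_eval_zw X n : rapidm (lent X) ->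
  sums_to (fun m => lmono (- m) 1 * (X * zw) n m) 0.
Proof.
move=> Xr; have [g gP] := row_eval_cvg n Xr.
have sh : bijective (fun m : int => m - 1).
  by exists (fun m => m + 1) => m; rewrite ?subrK ?addrK.
have := sums_toD gP (sums_toM (-1) (sums_to_bij sh gP)).
rewrite mulN1r subrr; apply: eq_sums_to => m.
rewrite Mzw mulrBr mulN1r; congr (_ - _); rewrite /= mulrA lmonoM mulr1.
by congr (lmono _ _ * _); ring.
Qed.

End EvaluationAtW.

Section Factorization.
Variables (R : realType) (A : cspRingType R) (a : lunit A).
Local Notation L := (laurent A).
Local Notation u := (uval a).
Local Notation v := (uinv a).
Local Notation U := (Um (cst_coefs u)).
Local Notation V := (Um (cst_coefs v)).
Local Notation w := (lmono 1 1 : L).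
Local Notation w' := (lmono (-1) 1 : L).

Lemma ww' : w * w' = 1. Proof. by rewrite lmonoM subrr mulr1. Qed.

Lemma UV : U * V = 1. Proof. by rewrite -UmM -rmorphM uvalV rmorph1 Um1. Qed.
Lemma VU : V * U = 1. Proof. by rewrite Um_comm UV. Qed.

Definition pi_half p : L := fdet (Rhalf p u * V).
Definition pi_mid : L := fdet (U * (Ut w w' (cst_coefs v) - V)).

Let Fp : lmat L := Fm A true.
Let Fn : lmat L := Fm A false.
Let s : lmat L := Um (lmono (-1) 1).
Let s' : lmat L := Um (lmono 1 1).
Let F' := s * Fp * s'.
Let T := th w'.
Let W := Ut w w' (cst_coefs u).
Let W' := Ut w w' (cst_coefs v).

Lemma shiftV : s * s' = 1.
Proof. by rewrite /s /s' -UmM lmonoM mulr1 addNr Um1. Qed.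
Lemma shiftV' : s' * s = 1. Proof. by rewrite Um_comm shiftV. Qed.

(** As symbols, both sides are the factor [1 - w / z] on the negative
  half-line and [1 - z / w] on the other one. *)
Lemma half_factors : F' * Fn = zw A * T.
Proof.
have F'M X n m : (F' * X) n m = X n m - (if n + 1 < 0 then w * X (n + 1) m else 0).
  rewrite /F' /Fp /Fm mulrBr mulrBl mulr1 shiftV mulrBl mul1r lmatB; congr (_ - _).
  rewrite -!mulrA /s UmM_lmono mul1r opprK NM mul1r.
  by case: ifP => // _; rewrite /s' UmM_lmono mul1r addrK.
have FnE n m : Fn n m = (n == m)%:R - (if (0 < n) && (m == n - 1) then w' else 0).
  by rewrite /Fn lmatB lmat1 /= /N_mat /= mulN1r oppr_lt0.
have TE n m : T n m = if n < 0 then (m == n)%:R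
  else if 0 < n then (if m == n - 1 then - w' else 0) else 0 by [].
apply: lmat_ext => n m; rewrite F'M zwM !FnE !TE.
case: (ltgtP n 0) => n0.
- rewrite /= subr0 eq_sym; congr (_ - _).
  case: (ltgtP (n + 1) 0) => n1; last by rewrite mulr0.
    by rewrite /= subr0 eq_sym.
  by exfalso; lia.
- have -> : (n + 1 < 0) = false by lia.
  have -> : (0 < n + 1) = true by lia.
  rewrite addrK subr0 [m == n]eq_sym /=.
  case: (eqVneq n m) => [<-|nm].
    have -> : (n == n - 1) = false by lia.
    by rewrite subr0 sub0r mulrN opprK ww'.
  by rewrite mulr0 subr0 sub0r; case: ifP; rewrite ?oppr0.
- have -> : (n + 1 < 0) = false by lia.
  have -> : (0 < n + 1) = true by lia.
  have -> : (m == n + 1 - 1) = (n == m) by lia.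
  rewrite /= !subr0 sub0r.
  by case: (n == m); rewrite ?mulr0 ?oppr0// mulrN opprK ww'.
Qed.

Lemma U_zw : U * zw A = zw A * U. Proof. exact: Um_comm. Qed.
Lemma V_zw : V * zw A = zw A * V. Proof. exact: Um_comm. Qed.

Lemma rapid_W : rapidm (lent (W - U)). Proof. exact/rapidm_Ut/ww'. Qed.
Lemma rapid_W' : rapidm (lent (W' - V)). Proof. exact/rapidm_Ut/ww'. Qed.

Lemma W'W : W' * W = 1.
Proof. by rewrite UtM ?ww'// -rmorphM mulrC uvalV rmorph1 Ut1 ?ww'. Qed.
Lemma WW' : W * W' = 1.
Proof. by rewrite UtM ?ww'// -rmorphM uvalV rmorph1 Ut1 ?ww'. Qed.

Lemma div_F' X : rapidm (lent X) -> exists2 Y, rapidm (lent Y) & Y * F' = X.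
Proof.
move=> Xr; have [|Y Yr YF] := @div_F _ _ true (s' * X * s).
  exact/rapidm_mulr/rapidm_mull.
exists (s * Y * s'); first exact/rapidm_mulr/rapidm_mull.
rewrite /F' -!mulrA [s' * (s * _)]mulrA shiftV' mul1r [Y * _]mulrA -/Fp YF.
by rewrite !mulrA shiftV mul1r -mulrA shiftV mulr1.
Qed.

Lemma F'_inj X : rapidm (lent X) -> X * F' = 0 -> X = 0.
Proof.
move=> Xr; rewrite /F' !mulrA => /(congr1 (fun M => M * s)).
rewrite mul0r -[X * s * Fp * s' * s]mulrA shiftV' mulr1 => /(F_inj (rapidm_mulr s Xr)).
by move/(congr1 (fun M => M * s')); rewrite mul0r -mulrA shiftV mulr1.
Qed.

Let R' := s * Rhalf true u * s'.

Lemma shifted_intertwine : (U + R') * F' = F' * U.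
Proof.
have sU : s * U = U * s by exact: Um_comm.
have s'U : s' * U = U * s' by exact: Um_comm.
have -> : U + R' = s * Uhalf true u * s'.
  by rewrite /Uhalf mulrDr mulrDl sU -[U * s * s']mulrA shiftV mulr1.
rewrite /F' -!mulrA [s' * (s * _)]mulrA shiftV' mul1r [Uhalf _ _ * _]mulrA Uhalf_F.
by rewrite s'U !mulrA.
Qed.

Lemma pi_half_shift : pi_half true = fdet (R' * V).
Proof.
have s'V : s' * V = V * s' by exact: Um_comm.
rewrite /R' -mulrA s'V mulrA -[s * _ * V]mulrA fdet_conj ?shiftV'//.
exact/rapidm_mulr/rapidm_Rhalf.
Qed.

(** Conjugating the negative factor past the positive one gives a single
  perturbation whose determinant is the product of the two half-line ones. *)
Lemma half_product : exists X, [/\ rapidm (lent X),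
  fdet X = pi_half false * pi_half true
  & (1 + X) * U * (zw A * T) = zw A * W * T].
Proof.
have R1r : rapidm (lent (Rhalf false u * V)) by exact/rapidm_mulr/rapidm_Rhalf.
have [S Sr SF] := div_F' R1r.
have FSr := rapidm_mull F' Sr.
have R'Vr : rapidm (lent (R' * V)).
  by do 2!apply/rapidm_mulr; exact/rapidm_mull/rapidm_Rhalf.
exists (F' * S + R' * V + F' * S * (R' * V)).
have XE : 1 + (F' * S + R' * V + F' * S * (R' * V)) = (1 + F' * S) * (1 + R' * V).
  exact: oneD_mul.
split.
- exact: (rapidmD (rapidmD FSr R'Vr) (rapidm_mull (F' * S) R'Vr)).
- by rewrite (fdetMD FSr R'Vr XE) (fdet_sylvester F' Sr) SF pi_half_shift.
rewrite XE -half_factors.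
rewrite (intertwine_product VU shifted_intertwine SF (Uhalf_F false u)).
have TU : T * U = W * T by exact/esym/(Ut_th _ ww').
by rewrite half_factors -[zw A * T * U]mulrA TU mulrA.
Qed.

(** Dividing [(W - U) T] by both half-line factors and comparing with
  [half_factors] gives the quotient [G]; [rho] is what [T], which forgets the
  index 0, does not see. *)
Lemma twisted_quotient : exists2 G, rapidm (lent G) & exists2 rho : lmat L,
  rho = rho * e00 L & G * zw A = W - U - rho.
Proof.
have WTr : rapidm (lent ((W - U) * T)) by exact/rapidm_mulr/rapid_W.
have [G1 G1r G1F] := @div_F _ _ false _ WTr.
have [G Gr GF] := div_F' G1r.
exists G => //; exists (W - U - G * zw A); last by rewrite opprB addrC subrK.
set rho := W - U - _; have rT : rho * T = 0.
  by rewrite mulrBl -[G * _ * T]mulrA -half_factors mulrA GF G1F subrr.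
have := congr1 (fun M => M * thr w) rT.
by rewrite mul0r -mulrA th_thr ?ww'// mulrBr mulr1 => /eqP; rewrite subr_eq0 => /eqP.
Qed.

(** Row 0 of [G * zw] evaluates to 0 at [z = w]. Row 0 of [W] is that of the
  identity, that of [U] evaluates to [u] read in [w], and that of [rho] has a
  single entry. *)
Lemma quotient_corner G rho : rapidm (lent G) -> rho = rho * e00 L ->
  G * zw A = W - U - rho -> rho 0 0 = 1 - u.
Proof.
move=> Gr rhoE GE; have h := row_eval_zw 0 Gr; rewrite GE in h.
have opp : bijective (fun m : int => - m) by exists (fun m => - m) => m; rewrite opprK.
have d1 := @sums_to_delta _ L int (fun m => if m == 0 then 1 else 0) 0.
have d2 := @sums_to_delta _ L int (fun m => lmono (- m) 1 * rho 0 m) 0.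
have k := sums_toD (sums_toD (d1 _) (sums_toM (-1) (sums_to_bij opp (sums_to_lmono u))))
  (sums_toM (-1) (d2 _)).
apply/eqP; rewrite -subr_eq0 -oppr_eq0; apply/eqP.
apply: (sums_to_unique _ h); rewrite !mulN1r oppr0 lmono0_1 mul1r in k.
rewrite opprB; apply: eq_sums_to (k _ _) => [m|m /negbTE -> //|m m0]; last first.
  by rewrite rhoE Me00 (negbTE m0) mulr0.
rewrite !lmatB mulrBr !mulN1r; congr (_ - _).
have -> : W 0 m = if m == 0 then 1 else 0.
  by rewrite UtE ?ww'// ltxx andbF eqxx.
rewrite UmE coef_cst_coefs sub0r /cstw mulrBr lmonoM mul1r addr0.
by congr (_ - _); case: eqVneq => [->|_]; rewrite ?mulr0// oppr0 lmono0_1 mulr1.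
Qed.

(** Cancelling the half-line factors by injectivity identifies the perturbation
  of [half_product] with [zw * G * V]. Sylvester's identity moves [zw] to the
  other side, where [G * zw] is known, and the remaining determinant splits into
  the inverse of [pi_mid] and the determinant of a single column. *)
Theorem laurent_factorization : pi_half false * pi_mid * pi_half true = u.
Proof.
have [X [Xr Xdet XH]] := half_product.
have [G Gr [rho rhoE GE]] := twisted_quotient.
have rho00 := quotient_corner Gr rhoE GE.
have rhor : rapidm (lent rho).
  have -> : rho = W - U - G * zw A by rewrite GE opprB addrC subrK.
  by apply: rapidmB; [exact: rapid_W|exact: rapidm_mulr].
have rT : rho * T = 0 by rewrite rhoE -mulrA e00_th mulr0.
have GVr := rapidm_mulr V Gr; have zGVr := rapidm_mull (zw A) GVr.
have XE : X = zw A * (G * V).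
  apply/eqP; rewrite -subr_eq0; apply/eqP; set D := X - _.
  have Dr : rapidm (lent D) by exact: rapidmB.
  suff DU : D * U = 0 by rewrite -[D]mulr1 -UV mulrA DU mul0r.
  apply: F'_inj; first exact: rapidm_mulr.
  apply: (@F_inj _ _ false); first exact/rapidm_mulr/rapidm_mulr.
  rewrite -/Fn -mulrA half_factors.
  exact: (quotient_difference VU U_zw XH GE rT).
have WVr : rapidm (lent ((W - U) * V)) by exact/rapidm_mulr/rapid_W.
have rr : rapidm (lent (- (W' * rho))) by exact/rapidmN/rapidm_mull.
have Zr : rapidm (lent (U * - (W' * rho) * V)) by exact/rapidm_mulr/rapidm_mull.
have WV1 : 1 + (W - U) * V = W * V by rewrite mulrBl UV addrC subrK.
have E0 : fdet (U * - (W' * rho) * V) = u.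
  transitivity (fdet (- (W' * rho))); first exact: (fdet_conj rr VU).
  transitivity (1 + (- (W' * rho)) 0 0).
    apply: fdet_col0 rr => n m m0.
    by rewrite lmatN rhoE mulrA Me00 (negbTE m0) oppr0.
  rewrite lmatN; have -> : (W' * rho) 0 0 = rho 0 0.
    have := e00M (W' * rho) 0 0; rewrite eqxx mulrA e00_Ut => <-.
    by rewrite e00M eqxx.
  by rewrite rho00 opprB addrC subrK.
have E1 : fdet X = fdet ((W - U) * V) * u.
  transitivity (fdet ((W - U) * V) * fdet (U * - (W' * rho) * V)); last first.
    exact: (congr1 (fun x => fdet ((W - U) * V) * x) E0).
  transitivity (fdet ((W - U - rho) * V)).
    by rewrite XE (fdet_sylvester (zw A) GVr) -mulrA V_zw [G * _]mulrA GE.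
  exact: (fdetMD WVr Zr (determinant_split UV VU rho WW')).
have E2 : pi_mid * fdet ((W - U) * V) = 1.
  have r2 : rapidm (lent (U * (W' - V))) by exact/rapidm_mull/rapid_W'.
  rewrite -(fdet0 (laurent A)); apply/esym/(fdetMD r2 WVr).
  rewrite addr0 WV1 mulrBr UV [1 + _]addrC subrK mulrA -[U * W' * W]mulrA W'W mulr1.
  by rewrite UV.
by rewrite mulrAC -Xdet E1 mulrAC [fdet _ * pi_mid]mulrC E2 mul1r.
Qed.

Lemma Uz_Um (b : L) : Uz b = lent (Um (cst_coefs b)). Proof. by []. Qed.

Lemma toeplitz_inv_Uz : toeplitz_inv (Uz u) = lent V.
Proof.
rewrite Uz_Um; apply: toeplitz_invE; [|exact: UV|exact: VU].
by rewrite -[V]addr0; apply: toeplitz_UmD; exact: rapidm0.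
Qed.

Lemma pi_halfE p : pi_half p =
  detm (mulm (conjpm1 (one_sub_t (@N_mat R A p)) u) (toeplitz_inv (Uz u))).
Proof.
rewrite conjpm1E toeplitz_inv_Uz -lent_mul /pi_half /fdet.
by rewrite /Uhalf mulrDl UV.
Qed.

Lemma pi_plusE : pi_plus u = pi_half true.
Proof.
rewrite pi_halfE /pi_plus /Uplus1 (_ : FRplus A = one_sub_t (@N_mat R A true))//.
congr one_sub_t; apply/funext => n; apply/funext => m; rewrite /N_mat /= mul1r.
rewrite /mulm (lsum_single (t0 := n)) => [|k]; last first.
  by rewrite /diag1 eq_sym => /negbTE ->; rewrite mul0r.
rewrite /diag1 eqxx /neg_int Uz_zpow -natrM mulnb mulr_natr mulrb.
by have -> : (-1 == n - m) = (m == n + 1) by lia.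
Qed.

Lemma pi_minusE : pi_minus u = pi_half false.
Proof.
rewrite pi_halfE /pi_minus /Uminus1 (_ : FRminus A = one_sub_t (@N_mat R A false))//.
congr one_sub_t; apply/funext => n; apply/funext => m; rewrite /N_mat /= mulN1r oppr_lt0.
rewrite /mulm (lsum_single (t0 := n)) => [|k]; last first.
  by rewrite /diag1 eq_sym => /negbTE ->; rewrite mul0r.
rewrite /diag1 eqxx /pos_int Uz_zpow -natrM mulnb mulr_natr mulrb.
by have -> : (1 == n - m) = (m == n - 1) by lia.
Qed.

Lemma Utilde_Ut (b : L) : Utilde b = lent (Ut w w' (cst_coefs b)).
Proof. by apply/funext => n; apply/funext => m; rewrite UtE// ww'. Qed.

Lemma pi_tildeE : pi_tilde u = pi_mid.
Proof.
rewrite /pi_tilde Utilde_Ut (@toeplitz_invE _ _ W W') ?WW' ?W'W//.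
  by rewrite Uz_Um -lent_mul /pi_mid /fdet mulrBr UV addrC subrK.
by have := toeplitz_UmD (cst_coefs v) rapid_W'; rewrite addrC subrK.
Qed.

End Factorization.

(** * The half-line determinants as group elements *)

Section CoefficientClosure.
Variables (R : realType) (A : cspRingType R).
Local Notation L := (laurent A).

Lemma sums_to_zero (B : cspRingType R) (T : choiceType) (f : T -> B) :
  (forall t, f t = 0) -> sums_to f 0.
Proof.
move=> f0; apply/sums_toP => i e e0; exists fset0 => J _.
by rewrite big1 ?subrr ?sn0.
Qed.

Lemma uval1 : uval (1%g : lunit A) = 1. Proof. by []. Qed.
Lemma uinv1 : uinv (1%g : lunit A) = 1. Proof. by []. Qed.

Lemma laurentM_coef0 (f g : L) n : (forall k, f k * g (n - k) = 0) -> (f * g) n = 0.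
Proof.
move=> fg; apply: (sums_to_unique (coef_laurentM_cvg f g n)).
exact: sums_to_zero.
Qed.

Lemma net_lim_coef0 (f : {fset int} -> L) l n :
  net_lim f l -> (forall J, f J n = 0) -> l n = 0.
Proof.
move=> fl f0; apply: sn_eq0 => i; have [c cP] := fl ((i, 0%N) : sn_index L).
apply/eqP; rewrite eq_le sn_ge0 andbT; apply: (@ler_addharm _ _ 0 c 0%N) => K _.
rewrite add0r; apply: le_trans (cP K (win K) (fsubset_refl _)).
by have := sn_coef_le i 0 (l - f (win K)) n; rewrite coef_laurentB f0 subr0.
Qed.

Lemma sums_to_coef0 (T : choiceType) (f : T -> L) l n :
  sums_to f l -> (forall t, f t n = 0) -> l n = 0.
Proof.
move=> /sums_toP fl f0; apply: sn_eq0 => i; apply/eqP; rewrite eq_le sn_ge0 andbT.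
apply/ler_addgt0Pl => e e0; rewrite addr0.
have [J JP] := fl ((i, 0%N) : sn_index L) e e0.
apply: le_trans (ltW (JP J (fsubset_refl _))).
have := sn_coef_le i 0 (l - \sum_(t <- J) f t) n.
by rewrite coef_laurentB coef_laurent_sum big1 ?subr0.
Qed.

End CoefficientClosure.

(** Once [F] can be cancelled, [X] and [Y] are inverse to each other like [U]
  and [V], although [F] need not be invertible. *)
Lemma intertwined_inverse (B : pzRingType) (X Y U V F : B) :
  U * V = 1 -> X * F = F * U -> Y * F = F * V -> (X * Y - 1) * F = 0.
Proof. by move=> UV XF YF; rewrite mulrBl mul1r -mulrA YF mulrA XF -mulrA UV mulr1 subrr. Qed.

Lemma inverse_defect (B : pzRingType) (U V P Q : B) : U * V = 1 ->
  (U + P) * (V + Q) - 1 = P * (V + Q) + U * Q.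
Proof.
by move=> UV; rewrite mulrDl [U * (V + Q)]mulrDr UV addrC !addrA addNr add0r addrC.
Qed.

Lemma inverse_perturbation (B : pzRingType) (U V P Q : B) : U * V = 1 -> V * U = 1 ->
  (U + P) * (V + Q) = 1 -> 1 + 0 = (1 + P * V) * (1 + U * Q).
Proof.
move=> UV VU PQ; have -> : 1 + P * V = (U + P) * V by rewrite mulrDl UV.
have -> : 1 + U * Q = U * (V + Q) by rewrite mulrDr UV.
by rewrite addr0 mulrA -[_ * V * U]mulrA VU mulr1 PQ.
Qed.

Section HalfGroup.
Variables (R : realType) (A : cspRingType R) (p : bool).
Local Notation L := (laurent A).
Local Notation s := (sgi p).
Implicit Types (a b : lunit A).

Lemma rapid_Rhalf (f : L) : rapidm (lent (Rhalf p f)).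
Proof. exact: rapidm_Rhalf. Qed.

(** Series supported in the open half-line of direction [s] form a closed
  non-unital subring, and [R V] has its entries in it. *)
Lemma pi_half_coef a n : s * n <= 0 -> pi_half a p n = (n == 0)%:R.
Proof.
move=> n0; pose I (f : L) := forall k, s * k <= 0 -> f k = 0.
suff : I (pi_half a p - 1).
  by move=> /(_ n n0); rewrite coef_laurentB coef_laurent1 => /eqP; rewrite subr_eq0 => /eqP.
have Xr := rapidm_mulr (Um (cst_coefs (uinv a))) (rapid_Rhalf (uval a)).
refine (fdet_subring (I := I) Xr _ _ _ _ _ _).
- by [].
- by move=> x y Ix Iy k k0; rewrite coef_laurentD Ix ?Iy ?addr0.
- by move=> x Ix k k0; rewrite coef_laurentN Ix ?oppr0.
- move=> x y Ix Iy k k0; apply: laurentM_coef0 => l.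
  case: (leP (s * l) 0) => [/Ix ->|l0]; first by rewrite mul0r.
  by rewrite Iy ?mulr0//; case: (p) k0 l0 => /=; lia.
- by move=> f l fl fI k k0; apply: (net_lim_coef0 fl) => J; exact: fI.
move=> i m k k0; apply: (sums_to_coef0 (lmatM_cvg _ _ i m)) => l.
rewrite UmE coef_cst_coefs mulrC /cstw coef_lmonoM coef_Rhalf subr0.
case: ifP => _; first by rewrite ifF ?mulr0//; case: (p) k0 => /=; lia.
by case: ifP => _; rewrite ?mulr0// ifF ?mulr0//; case: (p) k0 => /=; lia.
Qed.

Lemma Uhalf_inv a : Uhalf p (uval a) * Uhalf p (uinv a) = 1.
Proof.
apply/eqP; rewrite -subr_eq0; apply/eqP.
apply: (F_inj _ (intertwined_inverse (UV a) (Uhalf_F p (uval a)) (Uhalf_F p (uinv a)))).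
have r1 := rapidm_mulr (Uhalf p (uinv a)) (rapid_Rhalf (uval a)).
have r2 := rapidm_mull (Um (cst_coefs (uval a))) (rapid_Rhalf (uinv a)).
rewrite (inverse_defect (Rhalf p (uval a)) (Rhalf p (uinv a)) (UV a)).
exact: rapidmD r1 r2.
Qed.

(** Writing the second determinant with the factors in the other order, the two
  perturbed identities multiply to 1. *)
Lemma pi_half_inv a : pi_half a p * pi_half (lunitV a) p = 1.
Proof.
have r1 := rapidm_mulr (Um (cst_coefs (uinv a))) (rapid_Rhalf (uval a)).
have r2 := rapidm_mull (Um (cst_coefs (uval a))) (rapid_Rhalf (uinv a)).
have -> : pi_half (lunitV a) p = fdet (Um (cst_coefs (uval a)) * Rhalf p (uinv a)).
  transitivity (fdet (Rhalf p (uinv a) * Um (cst_coefs (uval a)))); first by [].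
  exact: esym (fdet_sylvester (Um (cst_coefs (uval a))) (rapid_Rhalf (uinv a))).
have E := inverse_perturbation (UV a) (VU a) (Uhalf_inv a).
exact: etrans (esym (fdetMD r1 r2 E)) (fdet0 L).
Qed.

Definition proj_half a : lunit A :=
  @LUnit _ _ (pi_half a p, pi_half (lunitV a) p) (introT eqP (pi_half_inv a)).

Lemma uval_proj_half a : uval (proj_half a) = pi_half a p. Proof. by []. Qed.
Lemma uinv_proj_half a : uinv (proj_half a) = pi_half (lunitV a) p. Proof. by []. Qed.

Definition half_series : {pred lunit A} := fun a =>
  `[< uval a 0 = 1 /\ uinv a 0 = 1 /\
      forall n : int, s * n < 0 -> uval a n = 0 /\ uinv a n = 0 >].

Lemma half_seriesP a : reflect (uval a 0 = 1 /\ uinv a 0 = 1 /\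
  forall n : int, s * n < 0 -> uval a n = 0 /\ uinv a n = 0) (a \in half_series).
Proof. exact: asboolP. Qed.

Lemma proj_half_in a : proj_half a \in half_series.
Proof.
have e a' : pi_half a' p 0 = 1 by rewrite pi_half_coef ?mulr0.
have z a' n : s * n < 0 -> pi_half a' p n = 0.
  move=> n0; rewrite pi_half_coef ?(ltW n0)//.
  by case: eqP n0 => // ->; rewrite mulr0 ltxx.
apply/half_seriesP; rewrite uval_proj_half uinv_proj_half.
by split; [exact: e|split; [exact: e|move=> n n0; split; exact: z]].
Qed.

Lemma half_mul0 (f g : L) : (forall n, s * n < 0 -> f n = 0) ->
  (forall n, s * n < 0 -> g n = 0) -> (f * g) 0 = f 0 * g 0.
Proof.
move=> f0 g0; apply: (sums_to_unique (coef_laurentM_cvg f g 0)).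
have -> : f 0 * g 0 = (fun k => f k * g (0 - k)) 0 by rewrite subr0.
apply: sums_to_delta => k k0; case: (ltP (s * k) 0) => sk; first by rewrite f0 ?mul0r.
by rewrite g0 ?mulr0//; move: k0 sk => /eqP; case: (p) => /=; lia.
Qed.

Lemma half_mul (f g : L) n : (forall n, s * n < 0 -> f n = 0) ->
  (forall n, s * n < 0 -> g n = 0) -> s * n < 0 -> (f * g) n = 0.
Proof.
move=> f0 g0 n0; apply: laurentM_coef0 => k.
case: (ltP (s * k) 0) => sk; first by rewrite f0 ?mul0r.
by rewrite g0 ?mulr0//; move: n0 sk; case: (p) => /=; lia.
Qed.

Lemma half_series_group : group_closed half_series.
Proof.
split=> [|a b /half_seriesP[a0 [a'0 an]] /half_seriesP[b0 [b'0 bn]]].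
  apply/half_seriesP; rewrite uval1 uinv1 !coef_laurent1; split=> //; split=> // n n0.
  by rewrite !coef_laurent1; case: eqP n0 => // ->; rewrite mulr0 ltxx.
apply/half_seriesP.
have -> : uval (a * b^-1)%g = uval a * uinv b by [].
have -> : uinv (a * b^-1)%g = uinv a * uval b by [].
split; first by rewrite half_mul0 ?a0 ?b'0 ?mulr1// => n n0; [case: (an n n0)|case: (bn n n0)].
split; first by rewrite half_mul0 ?a'0 ?b0 ?mulr1// => n n0; [case: (an n n0)|case: (bn n n0)].
by move=> n n0; split; apply: half_mul n0 => k k0; case: (an k k0) (bn k k0) => [? ?] [].
Qed.

End HalfGroup.

Section OrthogonalGroup.
Variables (R : realType) (A : cspRingType R).
Local Notation L := (laurent A).
Implicit Types (a b : lunit A).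

Lemma orthP a : reflect (forall n m : int, n != m -> uval a n * uval a m = 0)
  (a \in @orthogonal_series R A).
Proof. exact: asboolP. Qed.

(** When [a] is orthogonal, these products are orthogonal idempotents of sum 1,
  so identities may be checked after multiplication by each of them. *)
Lemma unit_sum a : sums_to (fun k => uval a k * uinv a (- k)) 1.
Proof.
have := coef_laurentM_cvg (uval a) (uinv a) 0; rewrite uvalV coef_laurent1.
by apply: eq_sums_to => k; rewrite sub0r.
Qed.

Lemma unit_sum_eq0 a (x : A) : (forall k, x * (uval a k * uinv a (- k)) = 0) -> x = 0.
Proof.
move=> x0; rewrite -[x]mulr1; apply: (sums_to_unique (sums_toM x (unit_sum a))).
exact: sums_to_zero.
Qed.

(** Multiplying the convolution for [a * a^-1 = 1] by [a_n] leaves a single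
  term. *)
Lemma orth_sq a n m : a \in @orthogonal_series R A ->
  uval a n * uval a n * uinv a m = if m == - n then uval a n else 0.
Proof.
move=> /orthP ao; have := coef_laurentM_cvg (uval a) (uinv a) (n + m).
move/(sums_toM (uval a n)); rewrite uvalV coef_laurent1 => h.
have -> : (m == - n) = (n + m == 0) by lia.
transitivity (uval a n * (n + m == 0)%:R); last by case: ifP; rewrite ?mulr1 ?mulr0.
apply: sums_to_unique h.
have -> : uval a n * uval a n * uinv a m = (fun k => uval a n * (uval a k * uinv a (n + m - k))) n.
  by rewrite mulrA; congr (_ * uinv a _); ring.
by apply: sums_to_delta => k kn; rewrite mulrA ao ?mul0r// eq_sym.
Qed.

Lemma orth_inv_coef a n m : a \in @orthogonal_series R A -> m != - n ->
  uval a n * uinv a m = 0.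
Proof.
move=> ao mn; have := orth_sq n (- n) ao; rewrite eqxx => <-.
by rewrite mulrAC (orth_sq _ _ ao) (negbTE mn) mul0r.
Qed.

Lemma orth_inv a : a \in @orthogonal_series R A ->
  forall n m : int, n != m -> uinv a n * uinv a m = 0.
Proof.
move=> ao n m nm; apply: (unit_sum_eq0 (a := a)) => k.
case: (eqVneq n (- k)) => [nk|nk]; last first.
  by rewrite mulrA [_ * uval a k]mulrC mulrA (orth_inv_coef ao nk) !mul0r.
rewrite mulrA [_ * uval a k]mulrC [uinv a n * _]mulrC mulrA (orth_inv_coef ao) ?mul0r//.
by rewrite -nk eq_sym.
Qed.

Lemma orthogonal_group : group_closed (@orthogonal_series R A).
Proof.
split=> [|a b ao bo].
  apply/orthP => n m nm; rewrite uval1 !coef_laurent1.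
  by case: eqP => [n0|_]; case: eqP => [m0|_]; rewrite ?mulr0 ?mul0r//; rewrite n0 m0 in nm.
apply/orthP => n m nm; have -> : uval (a * b^-1)%g = uval a * uinv b by [].
rewrite mulrC; apply: (sums_to_unique (sums_toM _ (coef_laurentM_cvg (uval a) (uinv b) n))).
have aux k : (uval a * uinv b) m * (uval a k * uinv b (n - k)) = 0.
  rewrite mulrC; apply: (sums_to_unique (sums_toM _ (coef_laurentM_cvg (uval a) (uinv b) m))).
  have e l : uval a k * uinv b (n - k) * (uval a l * uinv b (m - l)) = 0.
    rewrite mulrACA; case: (eqVneq k l) => [<-|kl].
      by rewrite [uinv b _ * _](orth_inv bo) ?mulr0//; apply: contra nm => /eqP/addIr ->.
    by move/orthP: ao => ->; rewrite ?mul0r.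
  exact: sums_to_zero.
exact: sums_to_zero.
Qed.

(** If a product of members of the three subgroups is 1, comparing supports
  on each idempotent component kills all coefficients of the orthogonal factor
  but the constant one, and then the two remaining factors are inverse to each
  other with supports in opposite half-lines. *)
Lemma factors_trivial x1 x2 x3 :
  x1 \in half_series false -> x2 \in @orthogonal_series R A -> x3 \in half_series true ->
  (x1 * x2 * x3)%g = lunit1 A -> [/\ x1 = lunit1 A, x2 = lunit1 A & x3 = lunit1 A].
Proof.
move=> /half_seriesP[x10 [x1'0 x1n]] x2o /half_seriesP[x30 [x3'0 x3n]] xE.
have E : uval x1 * uval x2 * uval x3 = 1 by have := congr1 (@uval R A) xE.
have E3 : uval x3 = uinv x2 * uinv x1.
  rewrite -[LHS]mul1r -(uvalV x1) -[LHS]mulr1 -(uvalV x2).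
  rewrite [LHS](_ : _ = uval x1 * uval x2 * uval x3 * (uinv x2 * uinv x1)); last by ring.
  by rewrite E mul1r.
have E1 : uval x1 = uinv x2 * uinv x3.
  rewrite -[LHS]mul1r -(uvalV x3) -[LHS]mulr1 -(uvalV x2).
  rewrite [LHS](_ : _ = uval x1 * uval x2 * uval x3 * (uinv x2 * uinv x3)); last by ring.
  by rewrite E mul1r.
have comp n (g : L) m : uval x2 n * (uinv x2 * g) m = uval x2 n * uinv x2 (- n) * g (m + n).
  apply: (sums_to_unique (sums_toM (uval x2 n) (coef_laurentM_cvg (uinv x2) g m))).
  have -> : uval x2 n * uinv x2 (- n) * g (m + n) =
      (fun k => uval x2 n * (uinv x2 k * g (m - k))) (- n) by rewrite opprK mulrA.
  by apply: sums_to_delta => k kn; rewrite mulrA (orth_inv_coef x2o kn) mul0r.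
have x2pos n : 0 < n -> uval x2 n = 0.
  move=> n0; rewrite -[LHS]mulr1 -x30 E3 comp add0r.
  by case: (x1n n); rewrite ?mulN1r ?oppr_lt0// => _ ->; rewrite mulr0.
have x2neg n : n < 0 -> uval x2 n = 0.
  move=> n0; rewrite -[LHS]mulr1 -x10 E1 comp add0r.
  by case: (x3n n); rewrite ?mul1r// => _ ->; rewrite mulr0.
have x2z n : n != 0 -> uval x2 n = 0.
  by case: (ltgtP n 0) => // n0 _; [exact: x2neg|exact: x2pos].
have x2'0 : uval x2 0 * uinv x2 0 = 1.
  apply: (sums_to_unique _ (unit_sum x2)).
  rewrite -[X in uinv x2 X]oppr0.
  by apply: (@sums_to_delta _ _ _ (fun k => uval x2 k * uinv x2 (- k)) 0) => k /x2z ->; rewrite mul0r.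
have x1x3 m : uval x2 0 * uval x1 m = uinv x3 m by rewrite E1 comp oppr0 addr0 x2'0 mul1r.
have x20 : uval x2 0 = 1 by have := x1x3 0; rewrite x10 x3'0 mulr1.
have x2E : x2 = lunit1 A.
  apply: lunit_ext; apply: laurent_ext => n; rewrite [uval (lunit1 A)]/(1 : L) coef_laurent1.
  by case: eqVneq => [->|/x2z].
have x3V : x3 = lunit1 A.
  apply: (can_inj (@invgK _)); apply: lunit_ext.
  have -> : uval (x3^-1)%g = uinv x3 by [].
  have -> : uval ((lunit1 A)^-1)%g = 1 by [].
  apply: laurent_ext => n; rewrite coef_laurent1; case: (ltgtP n 0) => n0.
  - by case: (x3n n); rewrite ?mul1r.
  - rewrite -x1x3 x20 mul1r; by case: (x1n n); rewrite ?mulN1r ?oppr_lt0.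
  - by rewrite n0.
split=> //; apply: lunit_ext; have -> : uval (lunit1 A) = 1 by [].
by move: E; rewrite x2E x3V; have -> : uval (lunit1 A) = 1 by []; rewrite !mulr1.
Qed.

End OrthogonalGroup.

(** * Orthogonality of the middle factor *)

Lemma gauged_difference (B : pzRingType) (g g' X Y : B) : g * g' = 1 -> g' * g = 1 ->
  g * X * g' * (g * Y * g') - 1 = g * (X * Y - 1) * g'.
Proof.
move=> gg gg'; rewrite mulrBr mulr1 mulrBl gg; congr (_ - _).
by rewrite !mulrA -[_ * g' * g]mulrA gg' mulr1.
Qed.

Section TwistedDeterminant.
Variables (R : realType) (C : cspRingType R) (al be : laurent C).
Hypothesis albe : al * be = 1.
Implicit Types o p : C.

(** [1 + twist o o'] is the quotient of the plain by the twisted matrix with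
  scaling [o], and [untwist] is the perturbation of the inverse quotient. *)
Definition twist o o' : lmat C := Um al * (Ut o o' be - Um be).
Definition untwist o o' : lmat C := (Ut o o' al - Um al) * Um be.

Lemma UmV : Um al * Um be = 1. Proof. by rewrite -UmM albe Um1. Qed.
Lemma UmV' : Um be * Um al = 1. Proof. by rewrite Um_comm UmV. Qed.

Lemma twistE o o' : 1 + twist o o' = Um al * Ut o o' be.
Proof. by rewrite /twist mulrBr UmV addrC subrK. Qed.

Lemma untwistE o o' : 1 + untwist o o' = Ut o o' al * Um be.
Proof. by rewrite /untwist mulrBl UmV addrC subrK. Qed.

Lemma rapid_twist o o' : o * o' = 1 -> rapidm (lent (twist o o')).
Proof. by move=> oo; apply: rapidm_mull; exact: rapidm_Ut. Qed.

Lemma rapid_untwist o o' : o * o' = 1 -> rapidm (lent (untwist o o')).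
Proof. by move=> oo; apply: rapidm_mulr; exact: rapidm_Ut. Qed.

Definition ratio o o' p p' : lmat C := Ut o o' be * Ut p p' al - 1.

Lemma rapid_ratio o o' p p' : o * o' = 1 -> p * p' = 1 ->
  rapidm (lent (ratio o o' p p')).
Proof.
move=> oo pp; have -> : ratio o o' p p' =
    (Ut o o' be - Um be) * Ut p p' al + Um be * (Ut p p' al - Um al).
  by rewrite /ratio mulrBl mulrBr UmV' addrA subrK.
by apply: rapidmD; [apply: rapidm_mulr|apply: rapidm_mull]; exact: rapidm_Ut.
Qed.

(** The plain matrices cancel in the product up to conjugation. *)
Lemma twist_untwist o o' p p' : o * o' = 1 -> p * p' = 1 ->
  fdet (twist o o') * fdet (untwist p p') = fdet (ratio o o' p p').
Proof.
move=> oo pp; have Xr := rapid_ratio oo pp.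
transitivity (fdet (Um al * ratio o o' p p' * Um be)); last exact: (fdet_conj Xr UmV').
apply/esym/(fdetMD (rapid_twist oo) (rapid_untwist pp)).
rewrite twistE untwistE /ratio mulrBr mulr1 mulrBl UmV addrC subrK.
by rewrite !mulrA.
Qed.

Lemma untwistK o o' : o * o' = 1 -> fdet (twist o o') * fdet (untwist o o') = 1.
Proof. by move=> oo; rewrite twist_untwist// /ratio UtM// [be * al]mulrC albe Ut1// subrr fdet0. Qed.

(** Conjugation by this diagonal matrix multiplies the scaling of [Ut] by [o]. *)
Definition gauge_mat o : mat C := fun n m => if n == m then (if n < 0 then o else 1) else 0.

Lemma decaying_gauge o : decaying (gauge_mat o).
Proof.
apply: (@decaying_banded _ _ 0 [:: 0; 1; o]) => n m; rewrite /gauge_mat.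
  by case: eqP => [->|//]; rewrite subrr.
by do 2?case: ifP => _; rewrite !inE eqxx ?orbT.
Qed.

Definition gauge o : lmat C := mk_lmat (decaying_gauge o).

Lemma gaugeM o X n m : (gauge o * X) n m = (if n < 0 then o else 1) * X n m.
Proof.
rewrite (lmatM_single (k := n)) /= /gauge_mat ?eqxx// => l.
by rewrite eq_sym => /negbTE ->; rewrite mul0r.
Qed.

Lemma Mgauge o X n m : (X * gauge o) n m = X n m * (if m < 0 then o else 1).
Proof.
rewrite (lmatM_single (k := m)) /= /gauge_mat ?eqxx// => l.
by move=> /negbTE ->; rewrite mulr0.
Qed.

Lemma gaugeK o o' : o * o' = 1 -> gauge o * gauge o' = 1.
Proof.
move=> oo; apply: lmat_ext => n m; rewrite gaugeM lmat1 /= /gauge_mat.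
by case: ifP => _; case: ifP => _; rewrite ?mulr0 ?mulr1.
Qed.

Lemma Ut_gauge o o' p p' a : o * o' = 1 -> p * p' = 1 ->
  Ut (o * p) (o' * p') a = gauge o * Ut p p' a * gauge o'.
Proof.
move=> oo pp; have op : o * p * (o' * p') = 1 by rewrite mulrACA oo pp mulr1.
apply: lmat_ext => n m; rewrite Mgauge gaugeM !UtE//.
case: (ltgtP n 0) => n0; case: (ltgtP m 0) => m0 /=; rewrite ?mul1r ?mulr1 ?mulr0 ?mul0r//.
- by rewrite mulrAC oo mul1r.
- by rewrite mulrA mulrN.
- by rewrite mulrAC; congr (_ * _); rewrite mulNr mulrC.
Qed.

Lemma cross_ratio (a b c d e e1 : C) :
  a * e = c * e1 -> d * e = 1 -> b * e1 = 1 -> a * b = c * d.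
Proof.
move=> E Ed Eb; transitivity (a * e * (d * b)); first by rewrite mulrA -[a * e * d]mulrA [e * d]mulrC Ed mulr1.
by rewrite E mulrACA [e1 * b]mulrC Eb mulr1.
Qed.

(** Conjugating by a gauge matrix shifts both scalings of a ratio. Hence the
  twisted determinant is, up to the value at 1, multiplicative in the scaling. *)
Lemma twist_mul o o' p p' : o * o' = 1 -> p * p' = 1 ->
  fdet (twist (p * o) (p' * o')) * fdet (twist 1 1) = fdet (twist o o') * fdet (twist p p').
Proof.
move=> oo pp; have o1 : 1 * 1 = 1 :> C by rewrite mulr1.
have po : p * o * (p' * o') = 1 by rewrite mulrACA oo pp mulr1.
have p1 : p' * p = 1 by rewrite mulrC.
have E : fdet (twist (p * o) (p' * o')) * fdet (untwist p p') =
    fdet (twist o o') * fdet (untwist 1 1).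
  apply: etrans (twist_untwist po pp) _; apply: etrans _ (esym (twist_untwist oo o1)).
  apply: etrans _ (fdet_conj (rapid_ratio oo o1) (gaugeK p1)); congr fdet.
  rewrite /ratio (Ut_gauge be pp oo).
  have -> : Ut p p' al = gauge p * Ut 1 1 al * gauge p'.
    by rewrite -(Ut_gauge al pp o1) !mulr1.
  exact: gauged_difference (gaugeK pp) (gaugeK p1).
exact: (cross_ratio E (untwistK pp) (untwistK o1)).
Qed.

End TwistedDeterminant.

Section TwistMap.
Variables (R : realType) (C C' : cspRingType R) (f : {rmorphism C -> C'}).
Hypothesis fb : sn_bounded f.

Lemma fdet_twist_map (al be : laurent C) (al' be' : laurent C') o o' :
  (forall n, al' n = f (al n)) -> (forall n, be' n = f (be n)) -> o * o' = 1 ->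
  f (fdet (twist al be o o')) = fdet (twist al' be' (f o) (f o')).
Proof.
move=> alE beE oo; have foo : f o * f o' = 1 by rewrite -rmorphM oo rmorph1.
apply: (fdet_map fb); [exact: rapid_twist|exact: rapid_twist|move=> n m].
apply: (sums_to_unique (lmatM_cvg (Um al') (Ut (f o) (f o') be' - Um be') n m)).
have h := sums_to_map fb (lmatM_cvg (Um al) (Ut o o' be - Um be) n m).
apply: eq_sums_to h => k.
transitivity (f (Um al n k * (Ut o o' be - Um be) k m)); first by [].
rewrite rmorphM !UmE alE; congr (_ * _).
rewrite !lmatB rmorphB !UmE beE; congr (_ - _).
rewrite !UtE// !(fun_if f) !rmorphM !rmorphN rmorph0 rmorph1 -!beE.
by [].
Qed.

End TwistMap.

Section MiddleFactor.
Variables (R : realType) (A : cspRingType R) (a : lunit A).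
Local Notation L := (laurent A).
Local Notation u := (uval a).
Local Notation v := (uinv a).
Local Notation w := (lmono 1 1 : L).
Local Notation w' := (lmono (-1) 1 : L).

Lemma net_lim_coef (C : cspRingType R) (f : {fset int} -> laurent C) l n :
  net_lim f l -> net_lim (fun J => f J n) (l n).
Proof.
move=> fl i; have [c cP] := fl ((i, 0%N) : sn_index (laurent C)); exists c => K J KJ.
apply: le_trans (cP K J KJ).
by have := sn_coef_le i 0 (l - f J) n; rewrite coef_laurentB.
Qed.

Lemma sums_to_coef (C : cspRingType R) (T : choiceType) (f : T -> laurent C) l n :
  sums_to f l -> sums_to (fun t => f t n) (l n).
Proof.
move=> /sums_toP fl; apply/sums_toP => i e e0.
have [J JP] := fl ((i, 0%N) : sn_index (laurent C)) e e0; exists J => K /JP.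
apply: le_lt_trans; have := sn_coef_le i 0 (l - \sum_(t <- K) f t) n.
by rewrite coef_laurentB coef_laurent_sum.
Qed.

(** The series in two variables that only depend on their product. *)
Definition diagonal_series (F : laurent L) : Prop := forall k l : int, k != l -> F k l = 0.

Lemma diagonalD F G : diagonal_series F -> diagonal_series G -> diagonal_series (F + G).
Proof. by move=> Fd Gd k l kl; rewrite !coef_laurentD Fd ?Gd ?addr0. Qed.

Lemma diagonalN F : diagonal_series F -> diagonal_series (- F).
Proof. by move=> Fd k l kl; rewrite !coef_laurentN Fd ?oppr0. Qed.

Lemma diagonal0 : diagonal_series 0.
Proof. by move=> k l _; rewrite !coef_laurent0. Qed.

Lemma diagonalM F G : diagonal_series F -> diagonal_series G -> diagonal_series (F * G).
Proof.
move=> Fd Gd k l kl; apply: (sums_to_coef0 (coef_laurentM_cvg F G k)) => j.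
apply: laurentM_coef0 => i; case: (eqVneq j i) => [<-|ji]; last by rewrite Fd ?mul0r.
rewrite Gd ?mulr0//; apply: contra kl => /eqP e; apply/eqP; lia.
Qed.

Lemma diagonal_lmono n (x : A) : diagonal_series (lmono n (lmono n x)).
Proof.
move=> k l kl; rewrite coef_lmono; case: eqP => [kn|_]; last by rewrite coef_laurent0.
by rewrite coef_lmono -kn eq_sym (negbTE kl).
Qed.

Lemma diagonal_Um_cst (f : L) n m : diagonal_series (Um (cst_coefs (cst_coefs f)) n m).
Proof. exact: diagonal_lmono. Qed.

Lemma diagonal1 : diagonal_series 1.
Proof. exact: diagonal_lmono. Qed.

Lemma diagonal_twist (f g : L) o o' : o * o' = 1 -> diagonal_series o -> diagonal_series o' ->
  cst_coefs (cst_coefs f) * cst_coefs (cst_coefs g) = 1 ->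
  diagonal_series (fdet (twist (cst_coefs (cst_coefs f)) (cst_coefs (cst_coefs g)) o o')).
Proof.
move=> oo od o'd fg; set X := twist _ _ _ _.
rewrite -[fdet X](subrK 1); apply: diagonalD; last exact: diagonal1.
have Xr : rapidm (lent X) by exact: rapid_twist.
refine (fdet_subring (I := diagonal_series) Xr diagonal0 diagonalD diagonalN diagonalM _ _).
  by move=> F l Fl Fd k m km; apply: (net_lim_coef0 (net_lim_coef k Fl)) => J; exact: Fd.
move=> n m k l kl.
rewrite /X /twist.
have h := lmatM_cvg (Um (cst_coefs (cst_coefs f)))
  (Ut o o' (cst_coefs (cst_coefs g)) - Um (cst_coefs (cst_coefs g))) n m.
refine (sums_to_coef0 (n := l) (sums_to_coef (n := k) h) _) => j.
suff : diagonal_series (Um (cst_coefs (cst_coefs f)) n j *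
   (Ut o o' (cst_coefs (cst_coefs g)) - Um (cst_coefs (cst_coefs g))) j m) by apply.
apply: diagonalM; first exact: diagonal_Um_cst.
rewrite lmatB; apply: diagonalD; last exact/diagonalN/diagonal_Um_cst.
have gd i : diagonal_series (cst_coefs (cst_coefs g) i) by exact: diagonal_lmono.
rewrite UtE//; do 4?case: ifP => _; rewrite ?mulNr.
- exact: gd.
- by apply: diagonalN; apply: diagonalM => //; exact: gd.
- by apply: diagonalN; apply: diagonalM => //; exact: gd.
- exact: diagonal1.
- exact: diagonal0.
Qed.

(** The determinant [pi_mid a], read in one variable, multiplied by itself,
  read in an independent variable, only depends on the product of the two
  variables, because the twisted determinant is multiplicative. *)
Lemma pi_mid_orth k l : k != l -> pi_mid a k * pi_mid a l = 0.
Proof.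
move=> kl.
pose al := cst_coefs (cst_coefs u); pose be := cst_coefs (cst_coefs v).
have albe : al * be = 1 by rewrite -!rmorphM uvalV !rmorph1.
have w1 : w * w' = 1 by exact: ww'.
have cw : cst_coefs w * cst_coefs w' = 1 by rewrite -rmorphM w1 rmorph1.
have sw : cstw w * cstw w' = 1 by rewrite -rmorphM w1 rmorph1.
have E1 : cst_coefs (pi_mid a) = fdet (twist al be (cst_coefs w) (cst_coefs w')).
  have cc (f : L) n : cst_coefs (cst_coefs f) n = cst_coefs (cst_coefs f n).
    apply: laurent_ext => m; rewrite !coef_cst_coefs !coef_lmono.
    by case: eqP => _; rewrite ?rmorph0.
  exact: (fdet_twist_map (@cst_coefs_bounded R A) (cc u) (cc v) w1).
have E2 : cstw (pi_mid a) = fdet (twist al be (cstw w) (cstw w')).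
  exact: (fdet_twist_map (@cstw_bounded R L) _ _ w1).
have E := twist_mul albe cw sw; rewrite -E1 -E2 in E.
have D : diagonal_series (cst_coefs (pi_mid a) * cstw (pi_mid a)).
  rewrite -E; apply: diagonalM; apply: diagonal_twist => //.
  - by rewrite mulrACA sw cw mulr1.
  - have -> : cstw w * cst_coefs w = lmono 1 w.
      apply: laurent_ext => n; rewrite coef_lmonoM subr0 coef_cst_coefs !coef_lmono.
      by case: eqP => _; rewrite /cstw ?lmono0_1 ?mulr1// lmono0 mulr0.
    exact: diagonal_lmono.
  - have -> : cstw w' * cst_coefs w' = lmono (-1) w'.
      apply: laurent_ext => n; rewrite coef_lmonoM subr0 coef_cst_coefs !coef_lmono.
      by case: eqP => _; rewrite /cstw ?lmono0_1 ?mulr1// lmono0 mulr0.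
    exact: diagonal_lmono.
  - by rewrite mulr1.
  - exact: diagonal1.
  - exact: diagonal1.
have := D k l kl.
by rewrite mulrC coef_lmonoM subr0 coef_cst_coefs mulrC coef_lmonoM subr0.
Qed.

End MiddleFactor.

(** * Continuity of the projections *)

Lemma bilinear_difference (B : pzRingType) (x y x0 y0 : B) :
  x0 * y0 - x * y = (x0 - x) * y + x0 * (y0 - y).
Proof. by rewrite mulrBl mulrBr [RHS]addrC addrA subrK. Qed.

Section Continuity.
Variables (R : realType) (A : cspRingType R).
Local Notation L := (laurent A).

(** The two arguments stand for a unit and its inverse, but are independent: as
  a function of both the matrix is bilinear. *)
Definition half_pert p (f g : L) : lmat L := Rhalf p f * Um (cst_coefs g).

Lemma rapid_half_pert p f g : rapidm (lent (half_pert p f g)).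
Proof. exact: rapidm_mulr (rapid_Rhalf p f). Qed.

Lemma half_pert_bound p (j : sn_index L) : exists (c : R) (J J' : sn_index L),
  0 <= c /\ forall f g, sq_bound j (lent (half_pert p f g)) (c * (sn J f * sn J' g)).
Proof.
have [i iP] := sn_mul j; have [c [J [c0 cP]]] := Rhalf_bound p i 4.
case: i iP cP => i q iP cP; pose J' : sn_index L := (i, 2%N).
exists (c * 2 ^+ q * 4), J, J'; split=> [|f g n m]; first by rewrite !mulr_ge0 ?exprn_ge0.
have d0 : 0 <= c * 2 ^+ q * (sn J f * sn J' g) by rewrite !mulr_ge0 ?sn_ge0 ?exprn_ge0.
rewrite [leRHS](_ : _ = c * 2 ^+ q * (sn J f * sn J' g) * (vt R n * vt R m) * 4); last by ring.
have h := lmatM_cvg (Rhalf p f) (Um (cst_coefs g)) n m; rewrite /half_pert.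
apply: (sums_to_sn_le4 (g := fun k => vt R k) h).
- by apply: mulr_ge0 => //; rewrite mulr_ge0 ?vt_ge0.
- move=> k; rewrite UmE coef_cst_coefs.
  apply: le_trans (iP _ _) _.
  have h1 : sn ((i, q) : sn_index L) (Rhalf p f n k) <= c * sn J f / (wt R n * wt R k) ^+ 4.
    by rewrite ler_pdivlMr ?exprn_gt0 ?mulr_gt0//; exact: cP.
  have h2 : sn ((i, q) : sn_index L) (cstw (g (k - m))) <= 2 ^+ q * sn J' g / wt R (k - m) ^+ 2.
    apply: le_trans (sn_cstw i q _) _; rewrite -mulrA; apply: ler_wpM2l; first by rewrite exprn_ge0.
    rewrite ler_pdivlMr ?exprn_gt0//; apply: le_trans (laurent_snP J' g (k - m)) => /=.
    by apply: ler_wpM2l; [exact: sn_ge0|rewrite lerXn2r ?nnegrE// ler_nat].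
  apply: le_trans (ler_pM (sn_ge0 _ _) (sn_ge0 _ _) h1 h2) _.
  rewrite [leLHS](_ : _ = c * 2 ^+ q * (sn J f * sn J' g) *
    (((wt R n * wt R k) ^+ 4)^-1 * vt R (k - m))); last by ring.
  rewrite -[leRHS]mulrA; apply: ler_wpM2l => //.
  rewrite -!invfM lef_pV2 ?posrE ?mulr_gt0 ?exprn_gt0 ?mulr_gt0//.
  rewrite [leLHS](_ : _ = (wt R n * wt R m * wt R k) ^+ 2); last by ring.
  rewrite [leRHS](_ : _ = (wt R n ^+ 2 * wt R k ^+ 2 * wt R (k - m)) ^+ 2); last by ring.
  apply: lerXn2r; rewrite ?nnegrE ?mulr_ge0 ?exprn_ge0// -!natrX -!natrM ler_nat.
  have : (absz m <= absz k + absz (k - m)%R)%N by lia.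
  by nia.
- exact: sum_wt_le.
Qed.

Lemma Rhalf_matB p (f g : L) n m : Rhalf_mat p (f - g) n m = Rhalf_mat p f n m - Rhalf_mat p g n m.
Proof.
rewrite /Rhalf_mat; case: ifP => _; last case: ifP => _; last by rewrite subr0.
  by rewrite coef_laurentB rmorphB mulrBr.
apply: laurent_ext => k; rewrite coef_laurentB !coef_tail.
by case: ifP => _; rewrite ?subr0// coef_laurentB.
Qed.

Lemma RhalfB p (f g : L) : Rhalf p (f - g) = Rhalf p f - Rhalf p g.
Proof. by apply: lmat_ext => n m; rewrite lmatB !RhalfE Rhalf_matB. Qed.

Lemma UmB (C : cspRingType R) (f g : laurent C) : Um (f - g) = Um f - Um g.
Proof. by apply: lmat_ext => n m; rewrite lmatB !UmE. Qed.

Lemma half_pertB p f g f0 g0 : half_pert p f0 g0 - half_pert p f g =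
  half_pert p (f0 - f) g + half_pert p f0 (g0 - g).
Proof.
rewrite /half_pert RhalfB rmorphB UmB; exact: bilinear_difference.
Qed.

Lemma fdet_half_pert_near p (i : sn_index L) (f0 g0 : L) (e : R) : 0 < e ->
  exists (d : R) (J J' : sn_index L), 0 < d /\ forall f g,
    sn J (f0 - f) < d -> sn J' (g0 - g) < d ->
    sn i (fdet (half_pert p f0 g0) - fdet (half_pert p f g)) < e.
Proof.
move=> e0; have [j ij] := sn_prod_seq i.
have [c [J [J' [c0 cP]]]] := half_pert_bound p j.
pose M := 1 + sn J f0; pose N := 1 + sn J' g0.
have M1 : 1 <= M by rewrite lerDl sn_ge0.
have N1 : 1 <= N by rewrite lerDl sn_ge0.
have M0 : 0 <= M := le_trans ler01 M1; have N0 : 0 <= N := le_trans ler01 N1.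
pose B := 2 * c * (M * N); have B0 : 0 <= B by rewrite !mulr_ge0.
have E0 : 0 < 2 * expR (32 * B) by rewrite mulr_gt0 ?expR_gt0.
pose d := Num.min 1 (e / (2 * expR (32 * B))).
have d0 : 0 < d by rewrite lt_min ltr01 divr_gt0.
have d1 : d <= 1 by rewrite ge_min lexx.
exists d, J, J'; split=> // f g fd gd.
(* [B] bounds both matrices when [d <= 1], and the factor 2 in it covers the two
   summands of [half_pertB], each of them at most [d * c * (M * N)]. *)
have fM : sn J f <= M.
  rewrite -[f](subKr f0); apply: le_trans (ler_snB _ _ _) _; rewrite /M addrC lerD2r.
  exact: ltW (lt_le_trans fd d1).
have gN : sn J' g <= N.
  rewrite -[g](subKr g0); apply: le_trans (ler_snB _ _ _) _; rewrite /N addrC lerD2r.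
  exact: ltW (lt_le_trans gd d1).
have f0M : sn J f0 <= M by rewrite lerDr.
have g0N : sn J' g0 <= N by rewrite lerDr.
have cB x : x <= M * N -> c * x <= B.
  move=> xM; apply: le_trans (ler_wpM2l c0 xM) _.
  by rewrite /B -mulrA ler_peMl ?mulr_ge0// ler1n.
have v0 n m : 0 <= vt R n * vt R m by rewrite mulr_ge0 ?vt_ge0.
have X0B : sq_bound j (lent (half_pert p f0 g0)) B.
  move=> n m; apply: le_trans (cP f0 g0 n m) _; apply: ler_wpM2r => //; apply: cB.
  by rewrite ler_pM ?sn_ge0.
have XB : sq_bound j (lent (half_pert p f g)) B.
  move=> n m; apply: le_trans (cP f g n m) _; apply: ler_wpM2r => //; apply: cB.
  by rewrite ler_pM ?sn_ge0.
have DB : sq_bound j (lent (half_pert p f0 g0 - half_pert p f g)) (d * B).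
  move=> n m; rewrite half_pertB lmatD; apply: le_trans (ler_snD _ _ _) _.
  apply: le_trans (lerD (cP _ _ n m) (cP _ _ n m)) _.
  rewrite -mulrDl; apply: ler_wpM2r => //; rewrite -mulrDr.
  rewrite [leRHS](_ : _ = c * (d * (M * N) + d * (M * N))); last by rewrite /B; ring.
  apply: ler_wpM2l => //; apply: lerD.
    apply: le_trans (ler_pM (sn_ge0 _ _) (sn_ge0 _ _) (ltW fd) gN) _.
    by apply: ler_wpM2l; [exact: ltW|rewrite ler_peMl].
  apply: le_trans (ler_pM (sn_ge0 _ _) (sn_ge0 _ _) f0M (ltW gd)) _.
  by rewrite mulrC; apply: ler_wpM2l; [exact: ltW|rewrite ler_peMr].
apply: le_lt_trans (fdet_est ij (rapid_half_pert p f0 g0) (rapid_half_pert p f g) B0 (ltW d0) X0B XB DB) _.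
apply: (@le_lt_trans _ _ (e / (2 * expR (32 * B)) * expR (32 * B))).
  by apply: ler_wpM2r; [exact: expR_ge0|rewrite ge_min lexx orbT].
rewrite invfM mulrA -mulrA mulVf ?mulr1; last by rewrite gt_eqF ?expR_gt0.
by rewrite ltr_pdivrMr// ltr_pMr// ltr1n.
Qed.

Lemma near_fst (C : cspRingType R) (x0 y0 : C) (j : sn_index C) (d : R) :
  0 < d -> \forall z \near (x0, y0), sn j (x0 - z.1) < d.
Proof.
move=> d0; have h := @cvg_fst C C (nbhs x0) (nbhs y0) (nbhs_filter y0).
exact: (cvg_snP _ _).1 h j d d0.
Qed.

Lemma near_snd (C : cspRingType R) (x0 y0 : C) (j : sn_index C) (d : R) :
  0 < d -> \forall z \near (x0, y0), sn j (y0 - z.2) < d.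
Proof.
move=> d0; have h := @cvg_snd C C (nbhs x0) (nbhs y0) (nbhs_filter x0).
exact: (cvg_snP _ _).1 h j d d0.
Qed.

Lemma fdet_half_pert_cont p :
  continuous (fun x : L * L => fdet (half_pert p x.1 x.2)).
Proof.
move=> [f0 g0]; apply/cvg_snP => i e e0.
have [d [J [J' [d0 dP]]]] := fdet_half_pert_near p i f0 g0 e0.
have h1 : \forall x \near (f0, g0), sn J (f0 - x.1) < d.
  exact: near_fst.
have h2 : \forall x \near (f0, g0), sn J' (g0 - x.2) < d.
  exact: near_snd.
by apply: filterS2 h1 h2 => x h1 h2; exact: dP.
Qed.

Lemma mul_cont (C : cspRingType R) : continuous (fun x : C * C => x.1 * x.2).
Proof.
move=> [x0 y0]; apply/cvg_snP => i e e0; have [j jP] := sn_mul i.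
pose M := 2 + sn j x0 + sn j y0.
have M1 : 0 < M by rewrite /M -addrA ltr_pwDl// addr_ge0 ?sn_ge0.
pose d := Num.min 1 (e / M); have d0 : 0 < d by rewrite lt_min ltr01 divr_gt0.
have d1 : d <= 1 by rewrite ge_min lexx.
have h1 : \forall z \near (x0, y0), sn j (x0 - z.1) < d.
  exact: near_fst.
have h2 : \forall z \near (x0, y0), sn j (y0 - z.2) < d.
  exact: near_snd.
apply: filterS2 h1 h2 => -[x y] /= xd yd.
rewrite bilinear_difference; apply: le_lt_trans (ler_snD _ _ _) _.
have yN : sn j y <= 1 + sn j y0.
  rewrite -[y](subKr y0); apply: le_trans (ler_snB _ _ _) _; rewrite addrC lerD2r.
  exact: ltW (lt_le_trans yd d1).
apply: le_lt_trans (lerD (jP _ _) (jP _ _)) _.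
apply: (@le_lt_trans _ _ (d * (1 + sn j y0) + sn j x0 * d)).
  apply: lerD; first by apply: ler_pM; rewrite ?sn_ge0 ?(ltW xd).
  by apply: ler_wpM2l; [exact: sn_ge0|exact: ltW].
apply: (@lt_le_trans _ _ (d * M)).
  by rewrite [sn j x0 * d]mulrC -mulrDr ltr_pM2l// /M; lra.
by rewrite -ler_pdivlMr// ge_min lexx orbT.
Qed.

Lemma uval_cont : continuous (@uval R A).
Proof.
move=> a; apply: (@cvg_comp _ _ _ (@lunit_pair R A) fst (nbhs a) (nbhs (lunit_pair a)) (nbhs (uval a)));
  last exact: cvg_fst.
exact: (@initial_continuous _ _ (@lunit_pair R A)).
Qed.

Lemma uinv_cont : continuous (@uinv R A).
Proof.
move=> a; apply: (@cvg_comp _ _ _ (@lunit_pair R A) snd (nbhs a) (nbhs (lunit_pair a)) (nbhs (uinv a)));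
  last exact: cvg_snd.
exact: (@initial_continuous _ _ (@lunit_pair R A)).
Qed.

Lemma cont2 (T : topologicalType) (h : L * L -> L) (f g : T -> L) : continuous h ->
  continuous f -> continuous g -> continuous (fun x => h (f x, g x)).
Proof.
move=> hc fc gc x; apply: (@cvg_comp _ _ _ (fun x => (f x, g x)) h); last exact: hc.
exact: cvg_pair (fc x) (gc x).
Qed.

Lemma mul_fun_cont (T : topologicalType) (f g : T -> L) :
  continuous f -> continuous g -> continuous (fun x => f x * g x).
Proof. exact: (@cont2 T (fun z => z.1 * z.2) f g (@mul_cont L)). Qed.

Lemma lunit_cont (T : topologicalType) (f : T -> lunit A) :
  continuous (fun x => uval (f x)) -> continuous (fun x => uinv (f x)) -> continuous f.
Proof.
move=> f1 f2; apply: continuous_comp_initial => x.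
have -> : @lunit_pair R A \o f = fun x => (uval (f x), uinv (f x)).
  by apply/funext => y /=; rewrite /uval /uinv; case: (lunit_pair (f y)).
exact: cvg_pair (f1 x) (f2 x).
Qed.

Lemma proj_half_cont p : continuous (@proj_half R A p).
Proof.
apply: lunit_cont.
- exact: (cont2 (@fdet_half_pert_cont p) uval_cont uinv_cont).
- exact: (cont2 (@fdet_half_pert_cont p) uinv_cont uval_cont).
Qed.

End Continuity.

(** * The decomposition *)

Lemma cancel_outer (B : comPzRingType) (p m q u p' q' : B) :
  p * m * q = u -> p * p' = 1 -> q * q' = 1 -> p' * u * q' = m.
Proof. by move=> <- pp qq; rewrite !mulrA [p' * p]mulrC pp mul1r -mulrA qq mulr1. Qed.

Lemma mulrACA3 (B : comPzRingType) (a b c d e f : B) :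
  a * b * (c * d) * (e * f) = a * c * e * (b * d * f).
Proof. by rewrite [a * b * (c * d)]mulrACA [LHS]mulrACA. Qed.

Section Decomposition.
Variables (R : realType) (A : cspRingType R).
Local Notation L := (laurent A).
Implicit Types a x y : lunit A.

Lemma lunit_mulC x y : (x * y)%g = (y * x)%g.
Proof. by apply: lunit_ext; exact: mulrC. Qed.

(** Defined as the cofactor of the outer projections: it is then a unit and
  continuous, and the factorization identifies it with [pi_mid]. *)
Definition proj_mid a : lunit A := ((proj_half false a)^-1 * a * (proj_half true a)^-1)%g.

Lemma uval_proj_mid a : uval (proj_mid a) = pi_mid a.
Proof.
exact: (cancel_outer (laurent_factorization a) (uvalV (proj_half false a)) (uvalV (proj_half true a))).
Qed.

Lemma proj_mid_in a : proj_mid a \in @orthogonal_series R A.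
Proof. by apply/orthP => n m nm; rewrite uval_proj_mid; exact: pi_mid_orth. Qed.

Lemma proj_factor a : a = (proj_half false a * proj_mid a * proj_half true a)%g.
Proof. by rewrite /proj_mid !mulgA mulgV mul1g mulgVK. Qed.

Lemma proj_mid_cont : continuous proj_mid.
Proof.
have uc p : continuous (fun a => uval (proj_half p a)).
  by move=> a; apply: (@cvg_comp _ _ _ (proj_half p) (@uval R A) (nbhs a) (nbhs (proj_half p a)));
    [exact: proj_half_cont|exact: uval_cont].
have vc p : continuous (fun a => uinv (proj_half p a)).
  by move=> a; apply: (@cvg_comp _ _ _ (proj_half p) (@uinv R A) (nbhs a) (nbhs (proj_half p a)));
    [exact: proj_half_cont|exact: uinv_cont].
apply: lunit_cont.
- have h : continuous (fun a => uinv (proj_half false a) * uval a) := mul_fun_cont (vc false) (@uval_cont R A).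
  have h' : continuous (fun a => uinv (proj_half false a) * uval a * uinv (proj_half true a)).
    exact: mul_fun_cont h (vc true).
  exact: h'.
- have h : continuous (fun a => uval (proj_half false a) * uinv a) := mul_fun_cont (uc false) (@uinv_cont R A).
  have h' : continuous (fun a => uval (proj_half false a) * uinv a * uval (proj_half true a)).
    exact: mul_fun_cont h (uc true).
  exact: h'.
Qed.

Lemma half_series_true : half_series true = @strictly_holomorphic R A.
Proof.
apply/funext => a; apply/asboolP/asboolP => -[a0 [b0 an]]; split=> //; split=> // n n0;
  apply: an; move: n0; rewrite mul1r; exact.
Qed.

Lemma half_series_false : half_series false = @strictly_antiholomorphic R A.
Proof.
apply/funext => a; apply/asboolP/asboolP => -[a0 [b0 an]]; split=> //; split=> // n n0;
  apply: an; move: n0; rewrite mulN1r oppr_lt0; exact.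
Qed.

(** The quotients of corresponding factors are a decomposition of 1. *)
Lemma factors_unique x1 x2 x3 y1 y2 y3 :
  x1 \in half_series false -> x2 \in @orthogonal_series R A -> x3 \in half_series true ->
  y1 \in half_series false -> y2 \in @orthogonal_series R A -> y3 \in half_series true ->
  (y1 * y2 * y3)%g = (x1 * x2 * x3)%g -> [/\ y1 = x1, y2 = x2 & y3 = x3].
Proof.
move=> X1 X2 X3 Y1 Y2 Y3 E.
have [_ g1] := half_series_group A false; have [_ g2] := orthogonal_group A.
have [_ g3] := half_series_group A true.
have h : (y1 * x1^-1 * (y2 * x2^-1) * (y3 * x3^-1))%g = lunit1 A.
  have -> : (y1 * x1^-1 * (y2 * x2^-1) * (y3 * x3^-1))%g = (y1 * y2 * y3 * (x1 * x2 * x3)^-1)%g.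
    apply: lunit_ext; exact: (mulrACA3 (uval y1) (uinv x1) (uval y2) (uinv x2) (uval y3) (uinv x3)).
  by rewrite E mulgV.
have [h1 h2 h3] := factors_trivial (g1 _ _ Y1 X1) (g2 _ _ Y2 X2) (g3 _ _ Y3 X3) h.
have eq_quot u v : (u * v^-1)%g = lunit1 A -> u = v.
  by move=> uv; rewrite -[u](mulgVK v) uv; exact: mul1g.
by split; exact: eq_quot.
Qed.

End Decomposition.

Theorem theorem1p3 (R : realType) (A : cspRingType R) :
  exists pim pit pip : lunit A -> lunit A,
    inner_direct_product (@strictly_antiholomorphic R A)
      (@orthogonal_series R A) (@strictly_holomorphic R A) pim pit pip /\
    forall a : lunit A,
      [/\ uval (pim a) = pi_minus (uval a),
          uval (pit a) = pi_tilde (uval a)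
        & uval (pip a) = pi_plus (uval a)].
Proof.
exists (proj_half false), (@proj_mid R A), (proj_half true); split; last first.
  by move=> a; rewrite pi_minusE pi_tildeE pi_plusE uval_proj_mid.
rewrite -half_series_false -half_series_true; split.
- exact: half_series_group.
- exact: orthogonal_group.
- exact: half_series_group.
- by move=> x1 x2 x3 _ _ _; split; exact: lunit_mulC.
- by move=> a; split; [exact: proj_half_in|exact: proj_mid_in|exact: proj_half_in].
- exact: proj_factor.
- move=> x1 x2 x3 X1 X2 X3; apply: factors_unique => //; rewrite -?proj_factor//.
  + exact: proj_half_in.
  + exact: proj_mid_in.
  + exact: proj_half_in.
- by split; [exact: proj_half_cont|exact: proj_mid_cont|exact: proj_half_cont].
Qed.
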